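(* Let $M\subset\mathbb{R}^{2n}$ be a real analytic hypersurface with $0\in M$ and let $J$ be a real analytic almost complex structure on $\mathbb{R}^{2n}$. If $J$ is integrable, then for all real analytic vector fields $X\in\ker\mathcal{L}$ and all $p\in M$ in a neighborhood of $0$, there exists a (germ of) $J$-holomorphic disc $\gamma$, included in $M$, such that $\gamma(0)=p$ and $\frac{\partial\gamma}{\partial x}(0)=X(p)$.
   Context: A real analytic hypersurface is $M=\{\varphi=0\}$ with $\varphi$ real valued, real analytic, and $d\varphi$ nowhere vanishing on $M$. An almost complex structure is a field $J$ of endomorphisms of the tangent spaces with $J^2=-\mathrm{Id}$. $T^JM=TM\cap J\,TM$. The Levi form of $M$ is $\mathcal{L}_\varphi(X)=d\varphi(J[X,JX])$ for sections $X$ of $T^JM$, with polar form $\hat{\mathcal{L}}_\varphi(X,Y)=d\varphi(J[X,JY]+J[Y,JX])+i\,d\varphi(J[X,Y]+J[JX,JY])$; both depend only on pointwise values. $\ker\mathcal{L}$ is the kernel of this form: $(\ker\mathcal{L})_p=\{X\in T^J_pM:\hat{\mathcal{L}}_\varphi(X,Y)=0\ \forall\,Y\in T^J_pM\}$. No assumption is made that $\ker\mathcal{L}$ has constant rank. ''$X\in\ker\mathcal{L}$'' means that $X$ is a real analytic vector field near $0$ with $X(z)\in(\ker\mathcal{L})_z$ for all $z\in M$ near $0$. In the integrable case a section $X$ of $T^JM$ is in $\ker\mathcal{L}$ if and only if $[X,Y]\in T^JM$ for all sections $Y$ of $T^JM$. A germ of $J$-holomorphic disc is a $C^1$ map $\gamma$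 defined on some disc $\{|\zeta|<\varepsilon\}\subset\mathbb{C}$, $\varepsilon>0$, $\zeta=x+iy$, with values in $\mathbb{R}^{2n}$ and with $d\gamma(\zeta)\circ J_0=J(\gamma(\zeta))\circ d\gamma(\zeta)$ ($J_0$ the standard structure of $\mathbb{C}$). It is included in $M$ if its image (after shrinking $\varepsilon$ if necessary) lies in $M$. *)

(* Defs.v *)
From HB Require Import structures.
From mathcomp Require Import all_boot all_order all_algebra finmap.
From mathcomp Require Import complex.
From mathcomp Require Import all_classical all_reals all_analysis.
From mathcomp.analysis.showcase Require Import summability.

Set Implicit Arguments.
Unset Strict Implicit.
Unset Printing Implicit Defensive.

Import Order.TTheory GRing.Theory Num.Theory.
Import numFieldNormedType.Exports.

Local Open Scope classical_set_scope.
Local Open Scope ring_scope.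

Section analytic.
Variables (R : realType) (m : nat).
Implicit Types (f : 'rV[R]_m -> R) (X : 'rV[R]_m -> 'rV[R]_m)
  (J : 'rV[R]_m -> 'M[R]_m) (a : 'rV[R]_m).

(* Near a, f is the sum of a power series in the m variables x_i - a_i. The
   series is summed along the filter [totally] of all finite sets of
   multi-indices, so that convergence means absolute convergence. *)
Definition analytic_at f a :=
  exists c : {ffun 'I_m -> nat} -> R, \forall x \near a,
    partial_sum (fun al => c al * \prod_(i < m) ((x : 'rV[R]_m) 0 i - a 0 i) ^+ al i)
      @ totally --> f x.

Definition analytic_field_at X a := forall j, analytic_at (fun z => X z 0 j) a.

Definition lie_bracket X Y : 'rV[R]_m -> 'rV[R]_m :=
  fun z => 'd Y z (X z) - 'd X z (Y z).

(* As tangent vectors are row vectors, J z acts on them by v |-> v *m J z. *)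
Definition mulJ J X : 'rV[R]_m -> 'rV[R]_m := fun z => X z *m J z.

Definition analytic_almost_complex J :=
  (forall i j a, analytic_at (fun z => J z i j) a) /\
  (forall z, J z *m J z = - 1%:M).

Definition nijenhuis J X Y : 'rV[R]_m -> 'rV[R]_m := fun z =>
  lie_bracket (mulJ J X) (mulJ J Y) z
  - lie_bracket (mulJ J X) Y z *m J z
  - lie_bracket X (mulJ J Y) z *m J z
  - lie_bracket X Y z.

(* Vanishing of the Nijenhuis tensor; since it is a tensor, testing it on
   (locally defined) real analytic vector fields is enough. *)
Definition integrable_structure J := forall (p : 'rV[R]_m) X Y,
  (\forall z \near p, analytic_field_at X z) ->
  (\forall z \near p, analytic_field_at Y z) ->
  nijenhuis J X Y p = 0.

End analytic.

Section levi.
Variables (R : realType) (m : nat).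
Variables (phi : 'rV[R]_m -> R) (J : 'rV[R]_m -> 'M[R]_m).
Implicit Types (X Y : 'rV[R]_m -> 'rV[R]_m) (p z v w : 'rV[R]_m).

Definition hypersurface : set 'rV[R]_m := [set z | phi z = 0].

Definition analytic_defining_function :=
  (forall a, analytic_at phi a) /\
  (forall z, hypersurface z -> exists v, 'd phi z v != 0).

Definition tangent_space z : set 'rV[R]_m := [set v | 'd phi z v = 0].

Definition J_tangent_space z : set 'rV[R]_m :=
  tangent_space z `&` [set u *m J z | u in tangent_space z].

(* X is a local real analytic section of the bundle of J-invariant tangent
   vectors, given by a field on a neighborhood of p in the ambient space. *)
Definition J_tangent_section p X :=
  (\forall z \near p, analytic_field_at X z) /\
  (\forall z \near p, hypersurface z -> J_tangent_space z (X z)).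

Definition levi_polar X Y z : R[i] :=
  Complex
    ('d phi z ((lie_bracket X (mulJ J Y) z + lie_bracket Y (mulJ J X) z) *m J z
               : 'rV[R]_m))
    ('d phi z ((lie_bracket X Y z + lie_bracket (mulJ J X) (mulJ J Y) z) *m J z
               : 'rV[R]_m)).

(* On J-tangent sections, levi_polar X Y p only depends on X p and Y p, so the
   value of the form on v, w is computed with any sections extending v, w. *)
Definition levi_kernel p : set 'rV[R]_m :=
  [set v | J_tangent_space p v /\
    forall w, J_tangent_space p w ->
    forall X Y, J_tangent_section p X -> J_tangent_section p Y ->
      X p = v -> Y p = w -> levi_polar X Y p = 0].

Definition field_in_levi_kernel X :=
  (\forall z \near (0 : 'rV[R]_m), analytic_field_at X z) /\
  (\forall z \near (0 : 'rV[R]_m), hypersurface z -> levi_kernel z (X z)).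

End levi.

Section discs.
Variables (R : realType) (m : nat).

(* The complex plane is identified with R * R by x + i y <-> (x, y). *)
Definition disc (eps : R) : set (R * R) :=
  [set zeta | zeta.1 ^+ 2 + zeta.2 ^+ 2 < eps ^+ 2].

Definition J0 (h : R * R) : R * R := (- h.2, h.1).

Definition C1_on (D : set (R * R)) (gamma : R * R -> 'rV[R]_m) :=
  forall zeta, D zeta -> differentiable gamma zeta /\
    forall h, {for zeta, continuous (fun xi : R * R => 'd gamma xi h : 'rV[R]_m)}.

Definition holomorphic_disc_germ (J : 'rV[R]_m -> 'M[R]_m)
    (gamma : R * R -> 'rV[R]_m) :=
  exists2 eps : R, 0 < eps & C1_on (disc eps) gamma /\
    forall zeta, disc eps zeta ->
    forall h, 'd gamma zeta (J0 h) = 'd gamma zeta h *m J (gamma zeta).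

Definition germ_included (gamma : R * R -> 'rV[R]_m) (M : set 'rV[R]_m) :=
  exists2 eps : R, 0 < eps & forall zeta, disc eps zeta -> M (gamma zeta).

End discs.

(* Main.v *)
(* Let K be the set of fields tangent to the J-invariant tangent spaces of M
   whose brackets with all sections of T^J M remain sections. By integrability
   K contains the fields of the Levi kernel and is stable under J, and by the
   Jacobi identity it is stable under brackets.

   Let gam(x, y) be the J-holomorphic disc obtained by solving
   gam_y = J(gam) gam_x, where gam(x, 0) is the integral curve of X through p.
   Put A_0 = X and (i+1) A_{i+1} = sum_{l+k=i} [A_l, J A_k], so that the series
   sum_i y^i A_i solves A_y = [A, J A] formally, with all A_i in K. Comparing
   y-derivatives gives gam_x = sum_{i<=k} y^i A_i(gam) + O(y^{k+1}) for all k,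
   hence gam_y = sum_{i<=k} y^i (J A_i)(gam) + O(y^{k+1}). For f vanishing on M,
   so do A_i f and (J A_i) f; therefore f(gam) vanishes at 0 to every order, and
   being analytic it is zero.

   The existence of gam is the Cauchy-Kovalevskaya theorem. It is proved in a
   weighted l^1 algebra of power series in (x, y), in which differentiation in
   x followed by integration in y is a bounded operator of small norm. *)
From HB Require Import structures.
Require Import Defs.
From mathcomp Require Import all_boot all_order all_algebra finmap.
From mathcomp Require Import all_classical all_reals all_analysis.
From mathcomp.analysis.showcase Require Import summability.
From mathcomp Require Import ring lra.
Set Implicit Arguments.
Unset Strict Implicit.
Unset Printing Implicit Defensive.
Import Order.TTheory GRing.Theory Num.Theory.
Import numFieldNormedType.Exports.
Local Open Scope classical_set_scope.
Local Open Scope ring_scope.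

(** * Unconditional sums of real families *)

(** The kernel may change rank, so the fields of K need not span a subbundle and M has no foliation
    to put the disc in. What can be controlled is a jet at one point, which analyticity turns into
    an inclusion.

    The equation A_y = [A, J A] is the compatibility condition of gam_x = A(y, gam) and gam_y = (J
    A)(y, gam). The y-derivative of the first is A_y plus the derivative of A along J A, the
    x-derivative of the second is the derivative of J A along A, and the mixed derivatives of gam
    agree. Only truncations of sum_i y^i A_i enter, so its convergence never has to be discussed.

    Errors in gam_x are measured by the power of y alone. Differentiation in x keeps this order, and
    passing from the y-derivative back to the error raises it by one, because the error is exactly
    zero at y = 0 for every small x. The total degree would drop under d/dx and the induction would
    stall. It returns only at the end, where all functions vanishing on M are treated together: each
    derivative of f(gam) involves new functions A_i f and (J A_i) f of the same kind. *)

HB.lock Definition tsum (R : realType) (I : choiceType) (f : I -> R) : R :=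
  lim (partial_sum f @ totally).

Section sums.
Variable R : realType.
Local Existing Instance totally_filter.

(** Absolute summability with an explicit constant, tested on finite sets only: such bounds add,
    scale and pass to limits. Without one, [tsum] may be a mere default value. *)
Definition abs_bounded (I : choiceType) (f : I -> R) (M : R) :=
  forall A : {fset I}, \sum_(i <- A) `|f i| <= M.

Section one_index.
Variable I : choiceType.
Implicit Types (f g : I -> R) (A : {fset I}).

Lemma partial_sumE f A : partial_sum f A = \sum_(i <- A) f i.
Proof. by rewrite /partial_sum big_seq_fsetE. Qed.

Lemma abs_bounded_ge0 f M : abs_bounded f M -> 0 <= M.
Proof. by move=> /(_ fset0); rewrite big_seq_fset0. Qed.

Lemma abs_bounded_ler f g M : (forall i, `|f i| <= `|g i|) ->
  abs_bounded g M -> abs_bounded f M.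
Proof. by move=> fg gM A; apply: le_trans (gM A); apply: ler_sum. Qed.

Lemma abs_boundedW f M M' : M <= M' -> abs_bounded f M -> abs_bounded f M'.
Proof. by move=> MM' fM A; apply: le_trans MM'. Qed.

Lemma abs_boundedD f g M N : abs_bounded f M -> abs_bounded g N ->
  abs_bounded (fun i => f i + g i) (M + N).
Proof.
move=> fM gN A; apply: le_trans (lerD (fM A) (gN A)).
by rewrite -big_split/=; apply: ler_sum => i _; exact: ler_normD.
Qed.

Lemma abs_boundedZ f c M : abs_bounded f M ->
  abs_bounded (fun i => c * f i) (`|c| * M).
Proof.
move=> fM A; under eq_bigr do rewrite normrM.
by rewrite -mulr_sumr ler_wpM2l.
Qed.

Lemma abs_bounded_sum (T : Type) (s : seq T) (F : T -> I -> R) (M : T -> R) :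
  (forall t, abs_bounded (F t) (M t)) ->
  abs_bounded (fun i => \sum_(t <- s) F t i) (\sum_(t <- s) M t).
Proof.
move=> FM; elim: s => [A|t s IH].
  by rewrite big1 ?big_nil// => i _; rewrite big_nil normr0.
rewrite big_cons; apply: abs_bounded_ler (abs_boundedD (FM t) IH) => i.
by rewrite big_cons.
Qed.

Lemma abs_bounded_term f M i : abs_bounded f M -> `|f i| <= M.
Proof. by move=> /(_ [fset i]%fset); rewrite big_seq_fset1. Qed.

Lemma tsum_cvg_ge0 f M : (forall i, 0 <= f i) -> abs_bounded f M ->
  partial_sum f @ totally --> sup (range (partial_sum f)).
Proof.
move=> f0 fM.
have hs : has_sup (range (partial_sum f)).
  split; first by exists (partial_sum f fset0), fset0.
  exists M => _ [A _ <-]; rewrite partial_sumE; apply: le_trans (fM A).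
  by apply: ler_sum => i _; exact: ler_norm.
apply/cvgrPdist_lt => e e0.
have [_ [A _ <-] hA] := sup_adherent e0 hs.
exists A => // B AB /=.
have sAB : partial_sum f A <= partial_sum f B.
  rewrite !partial_sumE [leRHS](big_fsetID _ (mem A))/=.
  have -> : [fset x | x in B & x \in A]%fset = A.
    apply/fsetP => x; rewrite !inE/= andbC.
    by case: (boolP (x \in A)) => //= /(fsubsetP AB).
  by rewrite lerDl sumr_ge0.
have Bs : partial_sum f B <= sup (range (partial_sum f)).
  by apply: ub_le_sup; [case: hs|exists B].
rewrite ger0_norm ?subr_ge0//; lra.
Qed.

Lemma tsum_cvg f M : abs_bounded f M -> partial_sum f @ totally --> tsum f.
Proof.
move=> fM; rewrite tsum.unlock; suff: cvg (partial_sum f @ totally) by [].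
(* A signed family is the difference of the nonnegative families [|f|] and [|f| - f], both bounded,
   so the monotone case applies twice. *)
pose g i := `|f i| - f i.
have g0 i : 0 <= g i by rewrite subr_ge0 ler_norm.
have fM' : abs_bounded (fun i => `|f i|) M.
  by apply: abs_bounded_ler fM => i; rewrite normr_id.
have gM : abs_bounded g (M + M).
  apply: abs_bounded_ler (abs_boundedD fM' fM') => i.
  rewrite ger0_norm// ger0_norm ?addr_ge0// lerD2l -normrN; exact: ler_norm.
have -> : partial_sum f = (fun A => partial_sum (fun i => `|f i|) A - partial_sum g A).
  apply/funext => A; rewrite !partial_sumE -sumrB.
  by apply: eq_bigr => i _; rewrite /g; lra.
by apply: is_cvgB; apply/cvg_ex; eexists; apply: tsum_cvg_ge0; eauto.
Qed.

Lemma tsum_unique f (l : R) : partial_sum f @ totally --> l -> tsum f = l.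
Proof. by move=> h; rewrite tsum.unlock; apply: cvg_lim => //; exact: h. Qed.

Lemma eq_tsum f g : f =1 g -> tsum f = tsum g.
Proof. by move=> /funext ->. Qed.

Lemma tsum0 : tsum (fun _ : I => 0 : R) = 0.
Proof.
apply: tsum_unique; apply: (@cvg_near_cst _ _ _ _ totally).
by exists fset0 => // B _; rewrite partial_sumE big1.
Qed.

Lemma tsumD f g M N : abs_bounded f M -> abs_bounded g N ->
  tsum (fun i => f i + g i) = tsum f + tsum g.
Proof.
move=> fM gN; apply: tsum_unique.
rewrite [X in X @ _](_ : _ = (fun A => partial_sum f A + partial_sum g A)).
  by apply: cvgD; apply: tsum_cvg; eauto.
by apply/funext => A; rewrite !partial_sumE big_split.
Qed.

Lemma tsumZ f c M : abs_bounded f M -> tsum (fun i => c * f i) = c * tsum f.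
Proof.
move=> fM; apply: tsum_unique.
rewrite [X in X @ _](_ : _ = (fun A => c * partial_sum f A)).
  by apply: cvgM; [exact: cvg_cst|apply: tsum_cvg; eauto].
by apply/funext => A; rewrite !partial_sumE mulr_sumr.
Qed.

Lemma tsum_sum (T : Type) (s : seq T) (F : T -> I -> R) (M : T -> R) :
  (forall t, abs_bounded (F t) (M t)) ->
  tsum (fun i => \sum_(t <- s) F t i) = \sum_(t <- s) tsum (F t).
Proof.
move=> FM; elim: s => [|t s IH].
  by rewrite big_nil -[RHS]tsum0; apply: eq_tsum => i; rewrite big_nil.
rewrite big_cons -IH -(tsumD (FM t) (abs_bounded_sum s FM)).
by apply: eq_tsum => i; rewrite big_cons.
Qed.

Lemma ler_tsum f g M N : (forall i, f i <= g i) -> abs_bounded f M ->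
  abs_bounded g N -> tsum f <= tsum g.
Proof.
move=> fg fM gN; have fN := abs_boundedZ (-1) fM.
have h := abs_boundedD gN fN.
have : 0 <= tsum (fun i => g i + -1 * f i).
  rewrite tsum.unlock; apply: limr_ge; first by apply/cvg_ex; eexists; apply: tsum_cvg h.
  apply: nearW => A; rewrite partial_sumE; apply: sumr_ge0 => i _.
  by rewrite mulN1r subr_ge0.
by rewrite (tsumD gN fN) (tsumZ _ fM) mulN1r subr_ge0.
Qed.

Lemma partial_sum_le_tsum f M A : (forall i, 0 <= f i) -> abs_bounded f M ->
  \sum_(i <- A) f i <= tsum f.
Proof.
move=> f0 fM; rewrite -partial_sumE (tsum_unique (tsum_cvg_ge0 f0 fM)).
apply: ub_le_sup; last by exists A.
exists M => _ [B _ <-]; rewrite partial_sumE; apply: le_trans (fM B).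
by apply: ler_sum => i _; exact: ler_norm.
Qed.

Lemma normr_tsum f M : abs_bounded f M -> `|tsum f| <= M.
Proof.
move=> fM; have h : `|partial_sum f A| @[A --> totally] --> `|tsum f|.
  by apply: cvg_norm; apply: tsum_cvg fM.
rewrite -(cvg_lim _ h)//; apply: limr_le; first by apply/cvg_ex; eexists; exact: h.
apply: nearW => A; rewrite /= partial_sumE; apply: le_trans (fM A).
exact: ler_norm_sum.
Qed.

Lemma abs_bounded_point (i0 : I) f :
  abs_bounded (fun i => if i == i0 then f i else 0) `|f i0|.
Proof.
move=> A; case: (boolP (i0 \in A)) => iA.
  rewrite (bigD1_seq i0)//= eqxx big1 ?addr0// => i /negPf ->.
  by rewrite normr0.
rewrite big_seq big1// => i; case: (eqVneq i i0) => [->|_ _].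
  by rewrite (negPf iA).
by rewrite normr0.
Qed.

Lemma tsum_point (i0 : I) f : tsum (fun i => if i == i0 then f i else 0) = f i0.
Proof.
apply: tsum_unique; apply: (@cvg_near_cst _ _ _ _ totally).
exists [fset i0]%fset => // B /= iB; rewrite partial_sumE.
have {}iB : i0 \in B by rewrite -fsub1set.
by rewrite (bigD1_seq i0)//= eqxx big1 ?addr0// => i /negPf ->.
Qed.

Lemma abs_bounded_norm f M : abs_bounded f M -> abs_bounded (fun i => `|f i|) M.
Proof. by apply: abs_bounded_ler => i; rewrite normr_id. Qed.

(** By the Cauchy criterion with error 1, finite sums avoiding some [A0] are at most 2 in absolute
    value; the nonnegative and the negative terms outside [A0], summed apart, give 2 each, hence the
    4. This turns the convergence required by [analytic_at] into absolute bounds. *)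
Lemma cvg_abs_bounded f (l : R) : partial_sum f @ totally --> l ->
  exists M, abs_bounded f M.
Proof.
move=> h; have [A0 _ hA0] := (cvgrPdist_lt (FF := totally_filter) _ _).1 h 1 ltr01.
have hB B : [disjoint A0 & B]%fset -> `|\sum_(i <- B) f i| <= 2.
  move=> dAB.
  have h1 := hA0 A0 (fsubset_refl _); have h2 := hA0 (A0 `|` B)%fset (fsubsetUl _ _).
  rewrite /= in h1 h2; rewrite !partial_sumE in h1 h2.
  rewrite (big_fsetID _ (mem A0))/= in h2.
  have e1 : [fset x | x in A0 `|` B & x \in A0]%fset = A0.
    apply/fsetP => x; rewrite !inE/= andbC.
    by case: (x \in A0).
  have e2 : [fset x | x in A0 `|` B & x \notin A0]%fset = B.
    apply/fsetP => x; rewrite !inE/= andbC.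
    by case: (boolP (x \in A0)) => //= /(fdisjointP dAB)/negPf ->.
  rewrite e1 e2 in h2.
  by rewrite ltr_norml in h1; rewrite ltr_norml in h2; rewrite ler_norml; lra.
exists (\sum_(i <- A0) `|f i| + 4) => A.
rewrite (big_fsetID _ (mem A0))/=; apply: lerD.
  pose A1 := [fset x | x in A & x \in A0]%fset; rewrite -/A1.
  rewrite [leRHS](big_fsetID _ (mem A1))/=.
  have -> : [fset x | x in A0 & x \in A1]%fset = A1.
    apply/fsetP => x; rewrite /A1 !inE/=; by case: (x \in A0); rewrite ?andbT ?andbF.
  by rewrite lerDl sumr_ge0.
pose A1 := [fset x | x in A & x \notin A0]%fset; rewrite -/A1.
have dA1 : [disjoint A0 & A1]%fset.
  apply/fdisjointP => x xA; rewrite /A1 !inE/= xA/= andbF//.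
rewrite (big_fsetID _ (fun i => 0 <= f i))/=.
have -> : 4 = 2 + 2 :> R by lra.
apply: lerD.
  apply: le_trans (hB [fset x | x in A1 & 0 <= f x]%fset _).
    apply: le_trans (ler_norm _); rewrite big_seq [leRHS]big_seq.
    by apply: ler_sum => i; rewrite !inE => /andP[_ fi]; rewrite ger0_norm.
  by apply: fdisjointWr dA1; apply/fsubsetP => x; rewrite !inE => /andP[].
apply: le_trans (hB [fset x | x in A1 & ~~ (0 <= f x)]%fset _).
  rewrite -[leRHS]normrN; apply: le_trans (ler_norm _); rewrite -sumrN.
  rewrite big_seq [leRHS]big_seq; apply: ler_sum => i; rewrite !inE => /andP[_].
  by rewrite -ltNge => fi; rewrite ltr0_norm.
by apply: fdisjointWr dA1; apply/fsubsetP => x; rewrite !inE => /andP[].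
Qed.

End one_index.

(** One half of Tonelli's theorem: finitely many columns are summed under the outer [tsum], where
    they cannot exceed the full row. Used in both directions it gives equality. *)
Lemma tsum_swap_le (I J : choiceType) (F : I -> J -> R) b M :
  (forall i j, 0 <= F i j) -> (forall i, abs_bounded (F i) (b i)) ->
  abs_bounded b M ->
  abs_bounded (fun j => tsum (F^~ j)) (tsum (fun i => tsum (F i))).
Proof.
move=> F0 Fb bM B.
have FjM j : abs_bounded (F^~ j) M.
  apply: abs_bounded_ler bM => i; apply: le_trans (ler_norm _).
  exact: abs_bounded_term.
have FbM : abs_bounded (fun i => tsum (F i)) M.
  apply: abs_bounded_ler bM => i; apply: le_trans (ler_norm _).
  exact: normr_tsum.
have -> : \sum_(j <- B) `|tsum (F^~ j)| = \sum_(j <- B) tsum (F^~ j).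
  apply: eq_bigr => j _; rewrite ger0_norm//.
  by apply: le_trans (partial_sum_le_tsum fset0 _ (FjM j)); rewrite ?big_seq_fset0.
rewrite -(tsum_sum B FjM).
apply: ler_tsum FbM => [i|]; first exact: (partial_sum_le_tsum _ _ (Fb i)).
exact: (abs_bounded_sum B FjM).
Qed.

Section swap.
Variables (I J : choiceType) (F : I -> J -> R) (b : I -> R) (M : R).
Hypotheses (Fb : forall i, abs_bounded (F i) (b i)) (bM : abs_bounded b M).

Lemma abs_bounded_swap_col j : abs_bounded (F^~ j) M.
Proof.
apply: abs_bounded_ler bM => i; apply: le_trans (ler_norm _).
exact: abs_bounded_term.
Qed.

Lemma abs_bounded_tsum_row : abs_bounded (fun i => tsum (F i)) M.
Proof.
apply: abs_bounded_ler bM => i; apply: le_trans (ler_norm _).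
exact: normr_tsum.
Qed.

Lemma abs_bounded_tsum_col : abs_bounded (fun j => tsum (F^~ j)) M.
Proof.
pose G i j := `|F i j|.
have GM j : abs_bounded (G^~ j) M by exact/abs_bounded_norm/abs_bounded_swap_col.
have Gb i : abs_bounded (G i) (b i) by exact/abs_bounded_norm/Fb.
apply: (abs_bounded_ler (g := fun j => tsum (G^~ j))).
  move=> j; apply: le_trans (ler_norm _); apply: normr_tsum => A.
  by apply: partial_sum_le_tsum (GM j) => i; rewrite /G.
have le : tsum (fun i => tsum (G i)) <= M.
  apply: (le_trans (ler_norm _)); apply: normr_tsum.
  apply: abs_bounded_ler bM => i; apply: le_trans (ler_norm _).
  exact: normr_tsum.
by apply: abs_boundedW le _; apply: tsum_swap_le Gb bM => i j; rewrite /G.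
Qed.

End swap.

(** Two opposite inequalities settle the nonnegative case; a signed [F] is then split as
    [|F| - (|F| - F)]. *)
Lemma tsum_swap (I J : choiceType) (F : I -> J -> R) b M :
  (forall i, abs_bounded (F i) (b i)) -> abs_bounded b M ->
  tsum (fun i => tsum (F i)) = tsum (fun j => tsum (F^~ j)).
Proof.
have key (F' : I -> J -> R) b' M' : (forall i j, 0 <= F' i j) ->
    (forall i, abs_bounded (F' i) (b' i)) -> abs_bounded b' M' ->
    tsum (fun i => tsum (F' i)) = tsum (fun j => tsum (F'^~ j)).
  move=> F0 Fb bM.
  have t0 i : 0 <= tsum (F' i).
    by apply: le_trans (partial_sum_le_tsum fset0 _ (Fb i)); rewrite ?big_seq_fset0.
  have GM j := abs_bounded_swap_col Fb bM j.
  have Gb i : abs_bounded (F' i) (tsum (F' i)).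
    move=> A; under eq_bigr do rewrite ger0_norm//.
    exact: partial_sum_le_tsum (Fb i).
  have GbM := abs_bounded_tsum_row Fb bM.
  have C1 := tsum_swap_le F0 Gb GbM.
  have Gb' j : abs_bounded (F'^~ j) (tsum (F'^~ j)).
    move=> A; under eq_bigr do rewrite ger0_norm//.
    exact: partial_sum_le_tsum (GM j).
  have C2 := @tsum_swap_le _ _ (fun j i => F' i j) _ _ (fun j i => F0 i j) Gb' C1.
  apply/eqP; rewrite eq_le; apply/andP; split.
    exact: le_trans (ler_norm _) (normr_tsum C2).
  exact: le_trans (ler_norm _) (normr_tsum C1).
move=> Fb bM.
pose G i j := `|F i j|; pose H i j := `|F i j| - F i j.
have Gb i : abs_bounded (G i) (b i) by exact/abs_bounded_norm/Fb.
have Hb i : abs_bounded (H i) (b i + b i).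
  apply: abs_bounded_ler (abs_boundedD (Gb i) (Gb i)) => j; rewrite /H /G.
  have := ler_norm (- F i j); rewrite normrN => ?; have := ler_norm (F i j).
  by move=> ?; rewrite [leLHS]ger0_norm ?subr_ge0// [leRHS]ger0_norm ?addr_ge0//; lra.
have hG := key _ _ _ (fun i j => normr_ge0 _) Gb bM.
have H0 i j : 0 <= H i j by rewrite subr_ge0 ler_norm.
have hH := key _ _ _ H0 Hb (abs_boundedD bM bM).
have e1 i : tsum (F i) = tsum (G i) + -1 * tsum (H i).
  rewrite -(tsumZ _ (Hb i)) -(tsumD (Gb i) (abs_boundedZ (-1) (Hb i))).
  by apply: eq_tsum => j; rewrite /G /H; lra.
have e2 j : tsum (F^~ j) = tsum (G^~ j) + -1 * tsum (H^~ j).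
  have Gj := abs_bounded_swap_col Gb bM j.
  have Hj := abs_bounded_swap_col Hb (abs_boundedD bM bM) j.
  rewrite -(tsumZ _ Hj) -(tsumD Gj (abs_boundedZ (-1) Hj)).
  by apply: eq_tsum => i; rewrite /G /H; lra.
rewrite (eq_tsum e1) (eq_tsum e2).
have rG := abs_bounded_tsum_row Gb bM.
have rH := abs_bounded_tsum_row Hb (abs_boundedD bM bM).
have cG := abs_bounded_tsum_col Gb bM.
have cH := abs_bounded_tsum_col Hb (abs_boundedD bM bM).
rewrite (tsumD rG (abs_boundedZ (-1) rH)) (tsumD cG (abs_boundedZ (-1) cH)).
by rewrite (tsumZ _ rH) (tsumZ _ cH) hG hH.
Qed.

End sums.

(** * Power series in several variables *)

Section power_series.
Variables (R : realType) (k : nat).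
Local Notation midx := {ffun 'I_k -> nat}.
Implicit Types (al be ga : midx) (u v : midx -> R) (x : 'I_k -> R).

Definition mon x al : R := \prod_(i < k) x i ^+ al i.

Definition ev u x : R := tsum (fun al => u al * mon x al).

Definition deg al : nat := (\sum_(i < k) al i)%N.

Definition unit_idx (i : 'I_k) : midx := [ffun j => (j == i : nat)].

Definition one_ps al : R := (al == 0)%:R.

(** The Cauchy product, with an indicator over all pairs of indices in place of the finite set of
    splittings of [al]: norm bounds and evaluation then become exchanges of sums. *)
Definition mul_ps u v al : R :=
  tsum (fun be => tsum (fun ga => if be + ga == al then u be * v ga else 0)).

Definition pow_ps u n : midx -> R := iter n (mul_ps u) one_ps.

Lemma midxD al be i : (al + be) i = (al i + be i)%N.
Proof. by rewrite ffunE. Qed.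

Lemma midx0 i : (0 : midx) i = 0%N.
Proof. by rewrite ffunE. Qed.

Lemma midx_addIr be al ga : be + al == be + ga = (al == ga).
Proof.
apply/eqP/eqP => [/ffunP h|->//]; apply/ffunP => i.
by have := h i; rewrite !midxD => /addnI.
Qed.

Lemma midx_add_eq0 be ga : (be + ga == 0) = (be == 0) && (ga == 0).
Proof.
apply/eqP/andP => [/ffunP h|[/eqP -> /eqP ->]]; last by rewrite addr0.
by split; apply/eqP/ffunP => i; have := h i; rewrite midxD midx0 => /eqP;
  rewrite addn_eq0 => /andP[/eqP ? /eqP ?].
Qed.

Lemma midx_add_unit be ga i : (be + ga == unit_idx i) =
  ((be == 0) && (ga == unit_idx i)) || ((be == unit_idx i) && (ga == 0)).
Proof.
apply/idP/orP => [/eqP/ffunP h|[]/andP[/eqP -> /eqP ->]]; last 2 first.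
- by rewrite add0r.
- by rewrite addr0.
have hj j : j != i -> be j = 0%N /\ ga j = 0%N.
  move=> ji; have := h j; rewrite midxD ffunE (negPf ji) => /eqP.
  by rewrite addn_eq0 => /andP[/eqP ? /eqP ?].
have := h i; rewrite midxD ffunE eqxx.
case ei : (be i) => [|[|//]] gi.
  left; apply/andP; split; apply/eqP/ffunP => j; rewrite ?midx0 ?ffunE;
    by case: (eqVneq j i) => [->|/hj[]].
right; move: gi => [gi]; apply/andP; split; apply/eqP/ffunP => j;
  by rewrite ?midx0 ?ffunE; case: (eqVneq j i) => [->|/hj[]].
Qed.

Lemma unit_idx_neq0 i : (unit_idx i == 0) = false.
Proof. by apply/eqP => /ffunP/(_ i); rewrite !ffunE eqxx. Qed.

Lemma degD al be : deg (al + be) = (deg al + deg be)%N.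
Proof. by rewrite /deg -big_split; apply: eq_bigr => i _; rewrite midxD. Qed.

Lemma deg0 : deg 0 = 0%N.
Proof. by rewrite /deg big1// => i _; rewrite midx0. Qed.

Lemma deg_unit i : deg (unit_idx i) = 1%N.
Proof.
rewrite /deg (bigD1 i)//= big1; first by rewrite ffunE eqxx.
by move=> j /negPf ji; rewrite ffunE ji.
Qed.

Lemma mon0 x : mon x 0 = 1.
Proof. by rewrite /mon big1// => i _; rewrite midx0. Qed.

Lemma monD x al be : mon x (al + be) = mon x al * mon x be.
Proof.
by rewrite /mon -big_split; apply: eq_bigr => i _; rewrite midxD exprD.
Qed.

Lemma mon_unit x i : mon x (unit_idx i) = x i.
Proof.
rewrite /mon (bigD1 i)//= big1; first by rewrite ffunE eqxx mulr1.
by move=> j /negPf ji; rewrite ffunE ji.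
Qed.

Lemma mon_ge0 x al : (forall i, 0 <= x i) -> 0 <= mon x al.
Proof. by move=> x0; apply: prodr_ge0 => i _; exact: exprn_ge0. Qed.

Lemma mon_gt0 x al : (forall i, 0 < x i) -> 0 < mon x al.
Proof. by move=> x0; apply: prodr_gt0 => i _; exact: exprn_gt0. Qed.

Lemma normr_mon x al : `|mon x al| = mon (fun i => `|x i|) al.
Proof. by rewrite /mon normr_prod; apply: eq_bigr => i _; rewrite normrX. Qed.

Lemma ler_mon x y al : (forall i, 0 <= x i <= y i) -> mon x al <= mon y al.
Proof.
move=> xy; apply: ler_prod => i _; have /andP[x0 xyi] := xy i.
by rewrite exprn_ge0//= lerXn2r// nnegrE// (le_trans x0).
Qed.

Lemma mon_cst (r : R) al : mon (fun=> r) al = r ^+ deg al.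
Proof. by rewrite /mon /deg prodrXr. Qed.

Section mul_coef.
Variables u v : midx -> R.

Lemma mul_ps_coef0 : mul_ps u v 0 = u 0 * v 0.
Proof.
rewrite -[RHS](tsum_point 0 (fun be => u be * v 0)); apply: eq_tsum => be.
case: eqVneq => [->|b0].
  rewrite -[RHS](tsum_point 0 (fun ga => u 0 * v ga)); apply: eq_tsum => ga.
  by rewrite add0r.
rewrite -[RHS](tsum0 R midx); apply: eq_tsum => ga.
by rewrite midx_add_eq0 (negPf b0).
Qed.

Lemma mul_ps_coef_unit i :
  mul_ps u v (unit_idx i) = u 0 * v (unit_idx i) + u (unit_idx i) * v 0.
Proof.
rewrite -(tsum_point 0 (fun be => u be * v (unit_idx i))).
rewrite -(tsum_point (unit_idx i) (fun be => u be * v 0)).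
rewrite -(tsumD (abs_bounded_point _ _) (abs_bounded_point _ _)).
apply: eq_tsum => be.
have [->|b0] := eqVneq be 0.
  rewrite eq_sym unit_idx_neq0 addr0.
  rewrite -[RHS](tsum_point (unit_idx i) (fun ga => u 0 * v ga)).
  by apply: eq_tsum => ga; rewrite add0r.
rewrite add0r; have [->|bi] := eqVneq be (unit_idx i).
  rewrite -[RHS](tsum_point 0 (fun ga => u (unit_idx i) * v ga)).
  apply: eq_tsum => ga; rewrite midx_add_unit unit_idx_neq0 eqxx/=.
  by [].
rewrite -[RHS](tsum0 R midx); apply: eq_tsum => ga.
by rewrite midx_add_unit (negPf b0) (negPf bi).
Qed.

End mul_coef.

Section local.
Variable d : midx -> nat.
Hypothesis dD : forall al be, d (al + be) = (d al + d be)%N.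

(** The grading [d] stays abstract because three occur: a weighted degree in the fixed point
    argument, and the power of y and the total degree for orders of vanishing. *)
Lemma mul_ps_local u u' v v' N :
  (forall be, (d be < N)%N -> u be = u' be) ->
  (forall be, (d be < N)%N -> v be = v' be) ->
  forall al, (d al < N)%N -> mul_ps u v al = mul_ps u' v' al.
Proof.
move=> uu vv al aN; apply: eq_tsum => be; apply: eq_tsum => ga.
case: eqP => // e; rewrite -e dD in aN.
by rewrite uu ?vv// (leq_ltn_trans _ aN)// ?leq_addr ?leq_addl.
Qed.

Lemma pow_ps_local u u' n N : (forall be, (d be < N)%N -> u be = u' be) ->
  forall al, (d al < N)%N -> pow_ps u n al = pow_ps u' n al.
Proof.
move=> uu; elim: n => [|n IH] al aN; first by [].
rewrite /pow_ps !iterS; exact: (@mul_ps_local u u' _ _ N uu IH al aN).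
Qed.

Lemma mul_ps_order u v N M :
  (forall be, (d be < N)%N -> u be = 0) ->
  (forall be, (d be < M)%N -> v be = 0) ->
  forall al, (d al < N + M)%N -> mul_ps u v al = 0.
Proof.
move=> uN vM al aNM; rewrite -[RHS](tsum0 R midx); apply: eq_tsum => be.
rewrite -[RHS](tsum0 R midx); apply: eq_tsum => ga; case: eqP => // e.
have [bN|Nb] := ltnP (d be) N; first by rewrite uN// mul0r.
rewrite vM ?mulr0//; move: aNM; rewrite -e dD => h.
by rewrite -(ltn_add2l (d be)) (leq_trans h)// leq_add2r.
Qed.

End local.

Section weight.
Variable w : midx -> R.
Hypotheses (w_gt0 : forall al, 0 < w al) (w0 : w 0 = 1).
Hypothesis wM : forall al be, w (al + be) <= w al * w be.

(** A norm bound in the weighted l^1 space; submultiplicativity of [w] makes it a Banach algebra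
    under [mul_ps]. *)
Definition wbounded u A := abs_bounded (fun al => u al * w al) A.

Let w_ge0 al : 0 <= w al. Proof. exact/ltW/w_gt0. Qed.

Section mul.
Variables (u v : midx -> R) (A B : R) (chi : midx -> R).
Hypotheses (uA : wbounded u A) (vB : wbounded v B).
Hypothesis chiw : forall al, `|chi al| <= w al.

Let row be : abs_bounded (fun ga => `|u be * v ga * chi (be + ga)|)
  (`|u be * w be| * B).
Proof.
have := abs_boundedZ (`|u be * w be|) vB; rewrite normr_id.
apply: abs_bounded_ler => ga; rewrite normr_id !normrM !normr_id.
rewrite (ger0_norm (w_ge0 be)) (ger0_norm (w_ge0 ga)).
have -> : `|u be| * w be * (`|v ga| * w ga) = `|u be| * `|v ga| * (w be * w ga).
  by ring.
by rewrite ler_wpM2l ?mulr_ge0//; exact: le_trans (chiw _) (wM _ _).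
Qed.

Let point be ga : abs_bounded
  (fun al => if be + ga == al then u be * v ga * chi al else 0)
  `|u be * v ga * chi (be + ga)|.
Proof.
apply: abs_bounded_ler (abs_bounded_point (be + ga) (fun al => u be * v ga * chi al)).
by move=> al; rewrite eq_sym.
Qed.

Let col : abs_bounded (fun be => `|u be * w be| * B) (A * B).
Proof.
have := abs_boundedZ B uA; rewrite (ger0_norm (abs_bounded_ge0 vB)) mulrC.
by apply: abs_bounded_ler => be; rewrite [leLHS]normrM normr_id -normrM mulrC.
Qed.

Let mul_psE al : mul_ps u v al * chi al = tsum (fun be => tsum (fun ga =>
   if be + ga == al then u be * v ga * chi al else 0)).
Proof.
have b1 be : abs_bounded (fun ga => if be + ga == al then u be * v ga else 0)
    (`|u be * w be| * B * (w al)^-1).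
  have := abs_boundedZ (`|u be * w be| * (w al)^-1) vB.
  have -> : `| `|u be * w be| * (w al)^-1| = `|u be * w be| * (w al)^-1.
    by rewrite ger0_norm// mulr_ge0// invr_ge0.
  rewrite mulrAC.
  apply: abs_bounded_ler => ga; case: eqP => [<-|_]; last by rewrite normr0.
  rewrite !normrM normr_id normrV ?unitfE ?gt_eqF// !(ger0_norm (w_ge0 _)).
  apply: (@le_trans _ _ (`|u be| * `|v ga| * (w be * w ga / w (be + ga)))).
    by rewrite ler_peMr ?mulr_ge0// ler_pdivlMr// mul1r.
  by rewrite le_eqVlt; apply/orP; left; apply/eqP; ring.
rewrite mulrC -(tsumZ _ (abs_bounded_tsum_row (b := fun be =>
    `|u be * w be| * B * (w al)^-1) (M := `|(w al)^-1| * (A * B)) _ _)) => [| |].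
- apply: eq_tsum => be; rewrite -(tsumZ _ (b1 be)); apply: eq_tsum => ga.
  by case: eqP => _; rewrite ?mulr0// mulrC.
- exact: b1.
- by apply: abs_bounded_ler (abs_boundedZ (w al)^-1 col) => be; rewrite mulrC.
Qed.

(** The test family [chi], dominated by the weight, serves two purposes: [chi = w] yields the norm
    of a product, [chi = mon x] its value at [x]. *)
Lemma mul_ps_bounded_key : abs_bounded (fun al => mul_ps u v al * chi al) (A * B).
Proof.
rewrite (funext mul_psE); apply: abs_bounded_tsum_col col => be.
exact: abs_bounded_tsum_col (point be) (row be).
Qed.

Lemma mul_ps_tsum : tsum (fun al => mul_ps u v al * chi al) =
  tsum (fun be => tsum (fun ga => u be * v ga * chi (be + ga))).
Proof.
rewrite (funext mul_psE).
rewrite -(tsum_swap (b := fun be => `|u be * w be| * B) (M := A * B)) => [|be|].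
- apply: eq_tsum => be; rewrite -(tsum_swap (point be) (row be)).
  apply: eq_tsum => ga.
  rewrite -[RHS](tsum_point (be + ga) (fun al => u be * v ga * chi al)).
  by apply: eq_tsum => al; rewrite eq_sym.
- exact: abs_bounded_tsum_col (point be) (row be).
- exact: col.
Qed.

End mul.

Let normw al : `|w al| <= w al. Proof. by rewrite ger0_norm. Qed.

Lemma wbounded_mul u v A B : wbounded u A -> wbounded v B ->
  wbounded (mul_ps u v) (A * B).
Proof. by move=> uA vB; exact: mul_ps_bounded_key normw. Qed.

Lemma wbounded_one : wbounded one_ps 1.
Proof.
rewrite -[X in wbounded _ X]normr1.
apply: abs_bounded_ler (abs_bounded_point 0 (fun=> 1)) => al.
by rewrite /one_ps; case: eqP => [->|_]; rewrite ?w0 ?mulr1 ?mul0r.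
Qed.

Lemma wbounded_pow u A n : wbounded u A -> wbounded (pow_ps u n) (A ^+ n).
Proof.
move=> uA; elim: n => [|n IH]; first exact: wbounded_one.
by rewrite exprS; exact: wbounded_mul.
Qed.

Lemma wboundedD u v A B : wbounded u A -> wbounded v B ->
  wbounded (fun al => u al + v al) (A + B).
Proof.
by move=> uA vB; apply: abs_bounded_ler (abs_boundedD uA vB) => al; rewrite mulrDl.
Qed.

Lemma wboundedZ c u A : wbounded u A -> wbounded (fun al => c * u al) (`|c| * A).
Proof. by move=> uA; apply: abs_bounded_ler (abs_boundedZ c uA) => al; rewrite mulrA. Qed.

Lemma wbounded_sum (T : Type) (s : seq T) (F : T -> midx -> R) (M : T -> R) :
  (forall t, wbounded (F t) (M t)) ->
  wbounded (fun al => \sum_(t <- s) F t al) (\sum_(t <- s) M t).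
Proof.
by move=> FM; apply: abs_bounded_ler (abs_bounded_sum s FM) => al; rewrite mulr_suml.
Qed.

Section eval.
Variable x : 'I_k -> R.
Hypothesis xw : forall al, `|mon x al| <= w al.

Lemma ev_bounded u A : wbounded u A -> abs_bounded (fun al => u al * mon x al) A.
Proof.
apply: abs_bounded_ler => al; rewrite !normrM ler_wpM2l//.
by rewrite (ger0_norm (w_ge0 _)).
Qed.

Lemma normr_ev u A : wbounded u A -> `|ev u x| <= A.
Proof. by move=> /ev_bounded; exact: normr_tsum. Qed.

Lemma ev_one : ev one_ps x = 1.
Proof.
rewrite -[RHS](tsum_point (0 : midx) (fun=> 1)); apply: eq_tsum => al.
by rewrite /one_ps; case: eqP => [->|_]; rewrite ?mon0 ?mulr1 ?mul0r.
Qed.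

Lemma ev_mul u v A B : wbounded u A -> wbounded v B ->
  ev (mul_ps u v) x = ev u x * ev v x.
Proof.
move=> uA vB; rewrite /ev (mul_ps_tsum uA vB)//.
rewrite mulrC -(tsumZ _ (ev_bounded uA)); apply: eq_tsum => be.
rewrite mulrC -(tsumZ _ (ev_bounded vB)); apply: eq_tsum => ga.
by rewrite monD; ring.
Qed.

Lemma ev_pow u A n : wbounded u A -> ev (pow_ps u n) x = ev u x ^+ n.
Proof.
move=> uA; elim: n => [|n IH]; first exact: ev_one.
by rewrite exprS -IH (ev_mul uA (wbounded_pow n uA)).
Qed.

Lemma evD u v A B : wbounded u A -> wbounded v B ->
  ev (fun al => u al + v al) x = ev u x + ev v x.
Proof.
move=> uA vB; rewrite /ev -(tsumD (ev_bounded uA) (ev_bounded vB)).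
by apply: eq_tsum => al; rewrite mulrDl.
Qed.

Lemma evZ c u A : wbounded u A -> ev (fun al => c * u al) x = c * ev u x.
Proof.
move=> uA; rewrite /ev -(tsumZ _ (ev_bounded uA)).
by apply: eq_tsum => al; rewrite mulrA.
Qed.

Lemma ev_sum (T : Type) (s : seq T) (F : T -> midx -> R) (M : T -> R) :
  (forall t, wbounded (F t) (M t)) ->
  ev (fun al => \sum_(t <- s) F t al) x = \sum_(t <- s) ev (F t) x.
Proof.
move=> FM; rewrite /ev -(tsum_sum s (fun t => ev_bounded (FM t))).
by apply: eq_tsum => al; rewrite mulr_suml.
Qed.

End eval.
End weight.
End power_series.

(** * Substitution of power series into a power series *)

Section composition.
Variables (R : realType) (k m : nat).
Local Notation midx := {ffun 'I_k -> nat}.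
Implicit Types (c : {ffun 'I_m -> nat} -> R) (g : 'I_m -> midx -> R)
  (al : {ffun 'I_m -> nat}) (be : midx) (s : seq 'I_m).

Definition mprod_ps g al s : midx -> R :=
  foldr (fun j acc => mul_ps (pow_ps (g j) (al j)) acc) (@one_ps R k) s.

Definition mpow_ps g al : midx -> R := mprod_ps g al (enum 'I_m).

(** The inner series may have constant terms, so each coefficient is a genuinely infinite sum. It
    converges when the norms of the [g j] are radii at which [c] converges absolutely. *)
Definition comp_ps c g be : R := tsum (fun al => c al * mpow_ps g al be).

Lemma mpow_ps_local (d : midx -> nat) g g' N :
  (forall be be', d (be + be') = (d be + d be')%N) ->
  (forall j be, (d be < N)%N -> g j be = g' j be) ->
  forall al be, (d be < N)%N -> mpow_ps g al be = mpow_ps g' al be.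
Proof.
move=> dD gg al; rewrite /mpow_ps; elim: (enum 'I_m) => [|j s IH] be bN //=.
by apply: (mul_ps_local dD) bN => // ga; apply: (pow_ps_local dD); exact: gg.
Qed.

Lemma comp_ps_local (d : midx -> nat) c g g' N :
  (forall be be', d (be + be') = (d be + d be')%N) ->
  (forall j be, (d be < N)%N -> g j be = g' j be) ->
  forall be, (d be < N)%N -> comp_ps c g be = comp_ps c g' be.
Proof.
by move=> dD gg be bN; apply: eq_tsum => al; rewrite (mpow_ps_local dD gg).
Qed.

Section weight.
Variable w : midx -> R.
Hypotheses (w_gt0 : forall be, 0 < w be) (w0 : w 0 = 1).
Hypothesis wM : forall be be', w (be + be') <= w be * w be'.
Variables (c : {ffun 'I_m -> nat} -> R) (g : 'I_m -> midx -> R) (r : 'I_m -> R) (C : R).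
Hypothesis gr : forall j, wbounded w (g j) (r j).
Hypothesis cC : abs_bounded (fun al => c al * mon r al) C.

Let r_ge0 j : 0 <= r j. Proof. exact: abs_bounded_ge0 (gr j). Qed.

Lemma wbounded_mpow al : wbounded w (mpow_ps g al) (mon r al).
Proof.
rewrite /mpow_ps /mon -big_enum; elim: (enum 'I_m) => [|j s IH].
  by rewrite big_nil; exact: wbounded_one.
rewrite big_cons; apply: wbounded_mul => //.
exact: wbounded_pow.
Qed.

Let comp_psE (chi : midx -> R) be : (forall be, `|chi be| <= w be) ->
  comp_ps c g be * chi be = tsum (fun al => c al * (mpow_ps g al be * chi be)).
Proof.
move=> chiw; rewrite /comp_ps mulrC -(tsumZ _ (M := (w be)^-1 * C)).
  by apply: eq_tsum => al; ring.
have := abs_boundedZ (w be)^-1 cC.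
rewrite (ger0_norm (x := (w be)^-1)) ?invr_ge0 ?ltW//.
apply: abs_bounded_ler => al; have := abs_bounded_term be (wbounded_mpow al).
rewrite !normrM (gtr0_norm (w_gt0 _)) -ler_pdivlMr// => h.
rewrite mulrCA ler_wpM2l// (ger0_norm (mon_ge0 al r_ge0)).
by rewrite mulrC (gtr0_norm (x := (w be)^-1)) ?invr_gt0.
Qed.

Section chi.
Variable chi : midx -> R.
Hypothesis chiw : forall be, `|chi be| <= w be.

Let row al : abs_bounded (fun be => c al * (mpow_ps g al be * chi be))
  `|c al * mon r al|.
Proof.
rewrite normrM (ger0_norm (mon_ge0 al r_ge0)).
apply: abs_boundedZ; apply: abs_bounded_ler (wbounded_mpow al) => be.
by rewrite !normrM ler_wpM2l// (gtr0_norm (w_gt0 _)).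
Qed.

Lemma comp_ps_bounded_key : abs_bounded (fun be => comp_ps c g be * chi be) C.
Proof.
under [X in abs_bounded X]eq_fun do rewrite (comp_psE _ chiw).
exact: abs_bounded_tsum_col row (abs_bounded_norm cC).
Qed.

Lemma comp_ps_tsum : tsum (fun be => comp_ps c g be * chi be) =
  tsum (fun al => c al * tsum (fun be => mpow_ps g al be * chi be)).
Proof.
rewrite (eq_tsum (fun be => comp_psE be chiw)).
rewrite -(tsum_swap row (abs_bounded_norm cC)); apply: eq_tsum => al.
rewrite (tsumZ _ (M := mon r al))//; apply: abs_bounded_ler (wbounded_mpow al) => be.
by rewrite !normrM ler_wpM2l// (gtr0_norm (w_gt0 _)).
Qed.

End chi.

Lemma wbounded_comp : wbounded w (comp_ps c g) C.
Proof. by apply: comp_ps_bounded_key => be; rewrite gtr0_norm. Qed.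

Variable x : 'I_k -> R.
Hypothesis xw : forall be, `|mon x be| <= w be.

Lemma ev_mpow al : ev (mpow_ps g al) x = mon (fun j => ev (g j) x) al.
Proof.
rewrite /mpow_ps /mon -big_enum.
suff /(_ (enum 'I_m))[] : forall s, ev (mprod_ps g al s) x =
  \prod_(j <- s) ev (g j) x ^+ al j /\ exists B, wbounded w (mprod_ps g al s) B by [].
elim=> [|j s [IH [B IB]]].
  by rewrite big_nil ev_one; split=> //; exists 1; exact: wbounded_one.
have pj := wbounded_pow w_gt0 w0 wM (al j) (gr j).
rewrite big_cons /= (ev_mul w_gt0 wM xw pj IB) IH (ev_pow w_gt0 w0 wM xw _ (gr j)).
by split=> //; eexists; exact: (wbounded_mul w_gt0 wM pj IB).
Qed.

Lemma ev_comp : ev (comp_ps c g) x = ev c (fun j => ev (g j) x).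
Proof.
rewrite /ev (comp_ps_tsum xw); apply: eq_tsum => al.
by rewrite -ev_mpow.
Qed.

End weight.
End composition.

(** * Re-expansion at another point and termwise differentiation *)

Section derivative_coefficients.
Variables (R : realType) (k : nat).
Local Notation midx := {ffun 'I_k -> nat}.
Implicit Types (al be : midx) (c : midx -> R) (x : 'I_k -> R) (i : 'I_k).

Definition pred_idx i al : midx := [ffun j => (al j - (j == i))%N].

Lemma pred_idxK i al : (0 < al i)%N -> pred_idx i al + unit_idx i = al.
Proof.
move=> ai; apply/ffunP => j; rewrite midxD !ffunE.
by case: eqVneq => [->|_]; rewrite ?subnK// subn0 addn0.
Qed.

Lemma add_unit_inj i : injective (fun be : midx => be + unit_idx i).
Proof.
by move=> al be /eqP; rewrite ![_ + unit_idx i]addrC midx_addIr => /eqP.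
Qed.

Section shift.
Variables (i : 'I_k) (f : midx -> R) (M : R).
Hypotheses (f0 : forall al, al i = 0%N -> f al = 0) (fM : abs_bounded f M).

Let F al be := if be + unit_idx i == al then f al else 0.

Let FE al : (0 < al i)%N ->
  F al = (fun be => if be == pred_idx i al then f al else 0).
Proof.
move=> ai; apply/funext => be; rewrite /F -{1}(pred_idxK ai).
by rewrite (inj_eq (@add_unit_inj i)).
Qed.

Let FE0 al : al i = 0%N -> F al = (fun=> 0).
Proof. by move=> ai; apply/funext => be; rewrite /F f0// if_same. Qed.

Let rowF al : abs_bounded (F al) `|f al|.
Proof.
case: (posnP (al i)) => ai; last by rewrite FE//; exact: abs_bounded_point.
by rewrite FE0// => A; rewrite big1// => j _; rewrite normr0.
Qed.

Let colF be : tsum (F^~ be) = f (be + unit_idx i).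
Proof.
rewrite -[RHS](tsum_point (be + unit_idx i) f); apply: eq_tsum => al.
by rewrite /F eq_sym.
Qed.

Lemma abs_bounded_shift : abs_bounded (fun be => f (be + unit_idx i)) M.
Proof.
have := abs_bounded_tsum_col rowF (abs_bounded_norm fM).
by apply: abs_bounded_ler => be; rewrite colF.
Qed.

(** Reindexing along the injection [be |-> be + unit_idx i], whose image contains the support of
    [f]: the sums over the graph of the injection are exchanged. *)
Lemma tsum_shift : tsum f = tsum (fun be => f (be + unit_idx i)).
Proof.
rewrite -(eq_tsum colF) -(tsum_swap rowF (abs_bounded_norm fM)).
apply: eq_tsum => al; case: (posnP (al i)) => ai.
  by rewrite FE0// tsum0 f0.
by rewrite FE// tsum_point.
Qed.

End shift.

Definition deriv_ps i c be : R := (be i).+1%:R * c (be + unit_idx i).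

(** The affine function [y |-> x j + y j] as a series in y; substituting these into [c] re-expands
    it around [x]. *)
Definition trans_ps x (j : 'I_k) be : R := x j * one_ps R be + (be == unit_idx j)%:R.

Lemma pow_ps_coef0 (u : midx -> R) n : pow_ps u n 0 = u 0 ^+ n.
Proof.
elim: n => [|n IH]; first by rewrite /pow_ps /= /one_ps eqxx expr0.
by rewrite exprS -IH -mul_ps_coef0.
Qed.

Lemma pow_ps_coef_unit (u : midx -> R) n i :
  pow_ps u n (unit_idx i) = n%:R * u 0 ^+ n.-1 * u (unit_idx i).
Proof.
elim: n => [|n IH]; first by rewrite /pow_ps /= /one_ps unit_idx_neq0 !mul0r.
rewrite /pow_ps iterS mul_ps_coef_unit -!/(pow_ps u n) IH pow_ps_coef0 /=.
by case: n {IH} => [|n]; rewrite /= ?mulr0n; [ring|rewrite exprS; ring].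
Qed.

Lemma trans_ps0 x j : trans_ps x j 0 = x j.
Proof. by rewrite /trans_ps /one_ps eqxx eq_sym unit_idx_neq0 mulr1 addr0. Qed.

Lemma unit_idx_inj i j : (unit_idx i == unit_idx j :> midx) = (i == j).
Proof.
apply/eqP/eqP => [/ffunP/(_ i)|->//]; rewrite !ffunE eqxx.
by case: eqVneq.
Qed.

Lemma trans_ps_unit x j i : trans_ps x j (unit_idx i) = (i == j)%:R.
Proof. by rewrite /trans_ps /one_ps unit_idx_neq0 mulr0 add0r unit_idx_inj. Qed.

Lemma mprod_trans0 x al s :
  mprod_ps (trans_ps x) al s 0 = \prod_(j <- s) x j ^+ al j.
Proof.
elim: s => [|j s IH]; first by rewrite big_nil /= /one_ps eqxx.
by rewrite big_cons /= mul_ps_coef0 IH pow_ps_coef0 trans_ps0.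
Qed.

Lemma mprod_trans_notin x al s i : i \notin s ->
  mprod_ps (trans_ps x) al s (unit_idx i) = 0.
Proof.
elim: s => [|j s IH] /=; first by rewrite /one_ps unit_idx_neq0.
rewrite inE negb_or => /andP[ij /IH h]; rewrite mul_ps_coef_unit h.
by rewrite pow_ps_coef_unit trans_ps_unit (negPf ij) !mulr0 mul0r addr0.
Qed.

Lemma mprod_trans_in x be s i : i \in s -> uniq s ->
  mprod_ps (trans_ps x) (be + unit_idx i) s (unit_idx i) =
  (be i).+1%:R * \prod_(j <- s) x j ^+ be j.
Proof.
elim: s => [//|j s IH]; rewrite inE => /predU1P[<-|ins] /andP[nis us] /=.
  rewrite mul_ps_coef_unit (mprod_trans_notin _ _ nis) mulr0 add0r.
  rewrite pow_ps_coef_unit trans_ps_unit eqxx mulr1 trans_ps0 mprod_trans0.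
  rewrite big_cons midxD ffunE eqxx addn1 /= mulrA; congr (_ * _).
  apply: eq_big_seq => l ls; rewrite midxD ffunE.
  by case: eqVneq ls nis => [->->//|_ _ _]; rewrite addn0.
have ji : (i == j) = false by apply: contraNF nis => /eqP <-.
rewrite mul_ps_coef_unit IH// pow_ps_coef_unit trans_ps_unit ji !mulr0 mul0r addr0.
rewrite pow_ps_coef0 trans_ps0 big_cons midxD ffunE eq_sym ji addn0.
by ring.
Qed.

Lemma mpow_trans_unit x be i :
  mpow_ps (trans_ps x) (be + unit_idx i) (unit_idx i) = (be i).+1%:R * mon x be.
Proof. by rewrite /mpow_ps mprod_trans_in ?enum_uniq ?mem_enum// big_enum. Qed.

Lemma mprod_trans_idx0 x al i s : al i = 0%N ->
  mprod_ps (trans_ps x) al s (unit_idx i) = 0.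
Proof.
move=> ai; elim: s => [|j s IH] /=; first by rewrite /one_ps unit_idx_neq0.
rewrite mul_ps_coef_unit IH pow_ps_coef_unit trans_ps_unit.
by case: eqVneq => [<-|_]; rewrite ?ai !(mulr0, mul0r) addr0.
Qed.

Section translation.
Variables (c : midx -> R) (rho C : R) (x : 'I_k -> R) (t : R).
Hypotheses (t0 : 0 < t) (xt : forall j, `|x j| + t <= rho).
Hypothesis cC : abs_bounded (fun al => c al * rho ^+ deg al) C.

Let w : midx -> R := mon (fun=> t).

Let w_gt0 al : 0 < w al. Proof. exact: mon_gt0. Qed.
Let w0 : w 0 = 1. Proof. exact: mon0. Qed.
Let wM al be : w (al + be) <= w al * w be. Proof. by rewrite /w monD. Qed.

Let wbounded_unit j : wbounded w (fun be => (be == unit_idx j)%:R) t.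
Proof.
apply: abs_bounded_ler (abs_boundedW _ (abs_bounded_point (unit_idx j) (fun=> t))).
  by move=> be; case: eqP => [->|_]; rewrite ?mul1r ?mul0r// /w mon_unit.
by rewrite gtr0_norm.
Qed.

Let wbounded_trans j : wbounded w (trans_ps x j) rho.
Proof.
apply: abs_boundedW (xt j) _.
have h1 := wboundedZ (x j) (wbounded_one w0).
by have := wboundedD h1 (wbounded_unit j); rewrite mulr1.
Qed.

Let cC' : abs_bounded (fun al => c al * mon (fun=> rho) al) C.
Proof. by apply: abs_bounded_ler cC => al; rewrite mon_cst. Qed.

Lemma trans_bounded : abs_bounded (fun be => comp_ps c (trans_ps x) be * t ^+ deg be) C.
Proof.
have := wbounded_comp w_gt0 w0 wM wbounded_trans cC'.
by apply: abs_bounded_ler => be; rewrite /w mon_cst.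
Qed.

Lemma ev_trans y : (forall j, `|y j| <= t) ->
  ev (comp_ps c (trans_ps x)) y = ev c (fun j => x j + y j).
Proof.
move=> yt; have yw be : `|mon y be| <= w be.
  by rewrite normr_mon; apply: ler_mon => i; rewrite normr_ge0 yt.
rewrite (ev_comp w_gt0 w0 wM wbounded_trans cC' yw); congr ev; apply/funext => j.
have h1 := wboundedZ (x j) (wbounded_one w0).
rewrite (evD w_gt0 yw h1 (wbounded_unit j)) (evZ w_gt0 yw _ (wbounded_one w0)).
rewrite ev_one mulr1; congr (_ + _).
rewrite -[RHS](tsum_point (unit_idx j) (fun=> y j)); apply: eq_tsum => be.
by case: eqP => [->|_]; rewrite ?mul1r ?mul0r// mon_unit.
Qed.

Let dbound i : abs_bounded (fun al => c al * mpow_ps (trans_ps x) al (unit_idx i)) (t^-1 * C).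
Proof.
have := abs_boundedZ t^-1 cC'; rewrite (gtr0_norm (x := t^-1)) ?invr_gt0//.
apply: abs_bounded_ler => al; rewrite mulrCA !normrM ler_wpM2l//.
have := abs_bounded_term (unit_idx i) (wbounded_mpow w_gt0 w0 wM wbounded_trans al).
rewrite {1}/w mon_unit normrM (gtr0_norm t0) -ler_pdivlMr// => h.
rewrite mulrC (gtr0_norm (x := t^-1)) ?invr_gt0// (ger0_norm (x := mon _ _))//.
apply: mon_ge0 => j; apply: le_trans (xt j); rewrite addr_ge0// ltW//.
Qed.

Let dzero i al : al i = 0%N -> c al * mpow_ps (trans_ps x) al (unit_idx i) = 0.
Proof. by move=> ai; rewrite /mpow_ps mprod_trans_idx0// mulr0. Qed.

(** A Cauchy estimate: the linear coefficient of a re-centred monomial, multiplied by [t], is at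
    most the norm of that monomial, so a loss [t] of radius costs the factor [t^-1]. *)
Lemma deriv_bounded i : abs_bounded (fun be => deriv_ps i c be * mon x be) (t^-1 * C).
Proof.
apply: abs_bounded_ler (abs_bounded_shift (@dzero i) (@dbound i)) => be.
by rewrite mpow_trans_unit /deriv_ps mulrCA mulrA.
Qed.

(** This justifies termwise differentiation: a derivative at [x] is a linear coefficient of the
    expansion around [x], and that coefficient is the value of the formally differentiated
    series. *)
Lemma comp_trans_unit i : comp_ps c (trans_ps x) (unit_idx i) = ev (deriv_ps i c) x.
Proof.
rewrite /comp_ps (tsum_shift (@dzero i) (@dbound i)); apply: eq_tsum => be.
by rewrite mpow_trans_unit /deriv_ps mulrCA mulrA.
Qed.

End translation.
End derivative_coefficients.

(** * Analytic functions *)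

Lemma differentiable_littleo (R : realType) (V W : normedModType R) (f : V -> W)
    (df : {linear V -> W}) a :
  continuous df ->
  (forall e : R, 0 < e -> \forall v \near (0 : V),
    `|f (v + a) - (f a + df v)| <= e * `|v|) ->
  differentiable f a /\ 'd f a = df :> (V -> W).
Proof.
move=> dfc fdf.
have fo (dg : {linear V -> W}) : dg = df :> (V -> W) ->
    f \o shift a = cst (f a) + dg +o_ 0 id.
  by move=> gE; apply/eqaddoP => e e0; rewrite gE; exact: fdf.
have dE := diff_unique dfc (fo _ erefl).
by split=> //; apply/diff_locallyP; split; [rewrite dE|exact: fo].
Qed.

Section analytic_functions.
Variables (R : realType) (k : nat).
Local Notation midx := {ffun 'I_k -> nat}.
Implicit Types (f g h : 'rV[R]_k -> R) (a b z v : 'rV[R]_k) (c : midx -> R).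

Lemma ler_coord_norm z i : `|z 0 i| <= `|z|.
Proof. by rewrite [leRHS]/Num.Def.normr/= mx_normrE; exact: (le_bigmax _ _ (0, i)). Qed.

Lemma ler_norm_coord z (r : R) : 0 <= r -> (forall i, `|z 0 i| <= r) -> `|z| <= r.
Proof.
move=> r0 zr; rewrite [leLHS]/Num.Def.normr/= mx_normrE bigmax_le// => -[i j] _ /=.
by rewrite (ord1 i).
Qed.

(** The norm of row vectors is the sup norm, so the ball is a closed polydisc, and the bound at
    radius [rho] gives absolute convergence up to its boundary. *)
Definition ps_on f a c (rho : R) := [/\ 0 < rho,
  exists C, abs_bounded (fun al => c al * rho ^+ deg al) C &
  forall z, `|z - a| <= rho -> f z = ev c (fun i => z 0 i - a 0 i)].

Lemma near_normP (P : 'rV[R]_k -> Prop) a :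
  (\forall z \near a, P z) <-> exists2 e : R, 0 < e & forall z, `|z - a| <= e -> P z.
Proof.
split=> [/nbhs_ballP[e /= e0 aP]|[e e0 aP]].
  exists (e / 2); first by rewrite divr_gt0.
  move=> z ze; apply: aP; rewrite -ball_normE /= distrC.
  by rewrite (le_lt_trans ze)// ltr_pdivrMr// ltr_pMr// ltrDl.
apply/nbhs_ballP; exists e => //= z; rewrite -ball_normE /= distrC => /ltW; exact: aP.
Qed.

Lemma normr_mon_le (x : 'I_k -> R) (r : R) al :
  (forall i, `|x i| <= r) -> `|mon x al| <= r ^+ deg al.
Proof.
by move=> xr; rewrite normr_mon -mon_cst; apply: ler_mon => i; rewrite normr_ge0 xr.
Qed.

Lemma abs_bounded_mon c (rho C : R) (x : 'I_k -> R) : 0 <= rho ->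
  (forall i, `|x i| <= rho) -> abs_bounded (fun al => c al * rho ^+ deg al) C ->
  abs_bounded (fun al => c al * mon x al) C.
Proof.
move=> rho0 xr; apply: abs_bounded_ler => al; rewrite !normrM ler_wpM2l//.
by rewrite [leRHS]ger0_norm ?exprn_ge0//; exact: normr_mon_le.
Qed.

Lemma coordB z a i : (z - a) 0 i = z 0 i - a 0 i.
Proof. by rewrite !mxE. Qed.

Lemma ps_on_mon f a c rho z : ps_on f a c rho -> `|z - a| <= rho ->
  exists C, abs_bounded (fun al => c al * mon (fun i => z 0 i - a 0 i) al) C.
Proof.
move=> [rho0 [C cC] _] za; exists C; apply: abs_bounded_mon cC; first exact: ltW.
by move=> i; rewrite -coordB; exact: le_trans (ler_coord_norm _ _) za.
Qed.

Lemma analytic_atP f a : analytic_at f a <-> exists c rho, ps_on f a c rho.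
Proof.
split=> [[c /near_normP[e e0 H]]|[c [rho fc]]]; last first.
  exists c; apply/near_normP; exists rho; first by case: fc.
  move=> z za; case: (fc) => _ _ ->//.
  by have [C] := ps_on_mon fc za; exact: tsum_cvg.
exists c, e; split=> //.
  (* At the corner of the polydisc every monomial equals [e ^+ deg al]; convergence there dominates
     all other points. *)
  have /H : `|(a + const_mx e) - a| <= e.
    rewrite addrC addKr; apply: ler_norm_coord => [|i]; first exact: ltW.
    by rewrite mxE gtr0_norm.
  move=> /cvg_abs_bounded[M hM]; exists M; apply: abs_bounded_ler hM => al.
  rewrite -mon_cst /mon; under [in leRHS]eq_bigr do rewrite !mxE addrAC subrr add0r.
  by [].
by move=> z /H /tsum_unique.
Qed.

Lemma ps_on_shrink f a c (rho rho' : R) : 0 < rho' <= rho -> ps_on f a c rho ->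
  ps_on f a c rho'.
Proof.
move=> /andP[r0 rr] [rho0 [C cC] fc]; split=> //; last first.
  by move=> z za; apply: fc; exact: le_trans rr.
exists C; have := abs_bounded_mon (ltW rho0) (x := fun=> rho') _ cC.
under [X in abs_bounded X]eq_fun do rewrite mon_cst.
by apply=> i; rewrite gtr0_norm.
Qed.

Lemma ps_on_trans f a c rho b : ps_on f a c rho -> `|b - a| < rho ->
  ps_on f b (comp_ps c (trans_ps (fun i => b 0 i - a 0 i))) (rho - `|b - a|).
Proof.
move=> [rho0 [C cC] fc] ba; have t0 : 0 < rho - `|b - a| by rewrite subr_gt0.
have xt i : `|b 0 i - a 0 i| + (rho - `|b - a|) <= rho.
  by rewrite -coordB addrCA gerDl subr_le0 ler_coord_norm.
split=> //; first by exists C; exact: trans_bounded xt cC.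
move=> z zb; rewrite (ev_trans t0 xt cC); last first.
  by move=> i; rewrite -coordB; exact: le_trans (ler_coord_norm _ _) zb.
rewrite fc; first by congr ev; apply/funext => i; ring.
rewrite -(subrK b z) -addrA; apply: le_trans (ler_normD _ _) _.
by rewrite -lerBrDr.
Qed.

Lemma analytic_at_near f a : analytic_at f a -> \forall z \near a, analytic_at f z.
Proof.
move=> /analytic_atP[c [rho fc]]; have rho0 : 0 < rho by case: fc.
apply/near_normP; exists (rho / 2); first by rewrite divr_gt0.
move=> z za; apply/analytic_atP; do 2!eexists; apply: ps_on_trans fc _.
by rewrite (le_lt_trans za)// ltr_pdivrMr// ltr_pMr// ltrDl.
Qed.

Definition lin_form (l : 'I_k -> R) v : R := \sum_i v 0 i * l i.

Fact lin_form_linear l : linear (lin_form l).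
Proof.
move=> r u v; rewrite /lin_form scaler_sumr -big_split; apply: eq_bigr => i _ /=.
by rewrite !mxE mulrDl -mulrA.
Qed.

HB.instance Definition _ l :=
  GRing.isLinear.Build R 'rV[R]_k R *:%R (lin_form l) (lin_form_linear l).

Lemma lin_form_continuous l : continuous (lin_form l).
Proof.
move=> v; apply: differentiable_continuous.
have -> : lin_form l = \sum_(i < k) (l i *: (fun v : 'rV[R]_k => v 0 i)).
  apply/funext => u; rewrite fct_sumE; apply: eq_bigr => i _.
  by rewrite mulrC.
apply: differentiable_sum => i; apply: differentiableZ.
exact: differentiable_coord.
Qed.

Lemma deg_eq0 (al : midx) : deg al = 0%N -> al = 0.
Proof.
move=> d0; apply/ffunP => i; rewrite midx0; apply/eqP; rewrite -leqn0 -d0 /deg.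
by rewrite (bigD1 i)//= leq_addr.
Qed.

Lemma deg_gt0 (al : midx) n : deg al = n.+1 -> exists i, (0 < al i)%N.
Proof.
move=> dn; case: (pickP (fun i => 0 < al i)%N) => [i ai|h]; first by exists i.
suff : deg al = 0%N by rewrite dn.
by rewrite /deg big1// => i _; apply/eqP; rewrite -leqn0 leqNgt h.
Qed.

Lemma deg_eq1 (al : midx) : deg al = 1%N -> exists i, al = unit_idx i.
Proof.
move=> d1; have [i ai] := deg_gt0 d1; exists i.
rewrite -[al](pred_idxK ai); suff -> : pred_idx i al = 0 by rewrite add0r.
apply: deg_eq0; have := degD (pred_idx i al) (unit_idx i).
by rewrite pred_idxK// d1 deg_unit addn1 => -[].
Qed.

Lemma ev0 c : ev c (fun=> 0) = c 0.
Proof.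
rewrite -[RHS](tsum_point (0 : midx) c); apply: eq_tsum => al.
case: eqP => [->|/eqP a0]; first by rewrite mon0 mulr1.
rewrite mon_cst; case d: (deg al) => [|n]; last by rewrite expr0n mulr0.
by rewrite (deg_eq0 d) eqxx in a0.
Qed.

Lemma ps_on_differentiable f a c rho : ps_on f a c rho ->
  differentiable f a /\ 'd f a = lin_form (fun i => c (unit_idx i)) :> (_ -> _).
Proof.
move=> fc; case: (fc) => rho0 [C cC] fE; set l := fun i => c (unit_idx i).
have C0 := abs_bounded_ge0 cC.
(* [p] collects the terms of degree at most 1 and [q] the others. For [|v| <= rho] a monomial of
   degree at least 2 is at most [(|v| / rho) ^+ 2] times its value at radius [rho]. *)
pose p al := (if al == 0 then c 0 else 0) +
  \sum_(i <- enum 'I_k) (if al == unit_idx i then c (unit_idx i) else 0).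
pose q al := if (deg al < 2)%N then 0 else c al.
have cpq al : c al = p al + q al.
  rewrite /p /q; case d : (deg al) => [|[|n]] /=; rewrite ?addr0.
  - rewrite (deg_eq0 d) eqxx big1 ?addr0// => i _.
    by rewrite eq_sym unit_idx_neq0.
  - have [i ->] := deg_eq1 d; rewrite unit_idx_neq0 add0r big_enum/= (bigD1 i)//=.
    by rewrite eqxx big1 ?addr0// => j ji; rewrite unit_idx_inj eq_sym (negPf ji).
  - case: eqP => [a0|_]; first by move: d; rewrite a0 deg0.
    rewrite big1 ?add0r// => i _; case: eqP => [ai|//].
    by move: d; rewrite ai deg_unit.
have key v : `|v| <= rho ->
    `|f (v + a) - (f a + lin_form l v)| <= (`|v| / rho) ^+ 2 * C.
  move=> vr; have vr' : `|(v + a) - a| <= rho by rewrite addrK.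
  have xr i : `|v 0 i| <= rho by exact: le_trans (ler_coord_norm _ _) vr.
  have ar : `|a - a| <= rho by rewrite subrr normr0 ltW.
  rewrite (fE _ vr') (fE _ ar).
  have -> : (fun i => (v + a) 0 i - a 0 i) = (fun i => v 0 i).
    by apply/funext => i; rewrite mxE addrK.
  have -> : (fun i => a 0 i - a 0 i) = (fun=> 0 : R) by apply/funext => i; rewrite subrr.
  rewrite ev0.
  have qb : abs_bounded (fun al => q al * mon (fun i => v 0 i) al) ((`|v| / rho) ^+ 2 * C).
    have := abs_boundedZ ((`|v| / rho) ^+ 2) cC.
    rewrite ger0_norm ?exprn_ge0 ?divr_ge0 ?(ltW rho0)//.
    apply: abs_bounded_ler => al; rewrite /q; case: ltnP => [_|d2].
      by rewrite mul0r normr0.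
    rewrite mulrCA normrM [leRHS]normrM ler_wpM2l//.
    have -> : `|(`|v| / rho) ^+ 2 * rho ^+ deg al| = `|v| ^+ 2 * rho ^+ (deg al - 2).
      rewrite [LHS]ger0_norm ?mulr_ge0 ?exprn_ge0 ?divr_ge0 ?invr_ge0 ?(ltW rho0)//.
      rewrite -{1}(subnK d2) exprD.
      by field; rewrite gt_eqF.
    apply: le_trans (normr_mon_le _ (ler_coord_norm v)) _.
    rewrite -{1}(subnK d2) exprD mulrC ler_wpM2l ?exprn_ge0//.
    by rewrite lerXn2r// nnegrE// ltW.
  have pt (al0 : midx) : abs_bounded (fun al => (if al == al0 then c al0 else 0) *
      mon (fun i => v 0 i) al) `|c al0 * mon (fun i => v 0 i) al0|.
    apply: abs_bounded_ler (abs_bounded_point al0 (fun al => c al0 * mon (fun i => v 0 i) al)).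
    by move=> al; case: eqP; rewrite ?mul0r.
  have tpt (al0 : midx) : tsum (fun al => (if al == al0 then c al0 else 0) *
      mon (fun i => v 0 i) al) = c al0 * mon (fun i => v 0 i) al0.
    rewrite -[RHS](tsum_point al0 (fun al => c al0 * mon (fun i => v 0 i) al)).
    by apply: eq_tsum => al; case: eqP; rewrite ?mul0r.
  have ps := abs_bounded_sum (enum 'I_k) (fun i => pt (unit_idx i)).
  have -> : ev c (fun i => v 0 i) = ev p (fun i => v 0 i) + ev q (fun i => v 0 i).
    have [M hp] : exists M, abs_bounded (fun al => p al * mon (fun i => v 0 i) al) M.
      eexists; apply: abs_bounded_ler (abs_boundedD (pt 0) ps) => al.
      by rewrite /p mulrDl mulr_suml.
    by rewrite /ev -(tsumD hp qb); apply: eq_tsum => al; rewrite cpq mulrDl.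
  have -> : ev p (fun i => v 0 i) = c 0 + lin_form l v.
    rewrite /ev; under eq_tsum do rewrite /p mulrDl mulr_suml.
    rewrite (tsumD (pt 0) ps) tpt mon0 mulr1 (tsum_sum _ (fun i => pt (unit_idx i))).
    congr (_ + _); rewrite big_enum; apply: eq_bigr => i _.
    by rewrite tpt mon_unit mulrC.
  rewrite (addrC (c 0 + lin_form l v)) addrK; exact: normr_tsum qb.
apply: (differentiable_littleo (@lin_form_continuous l)) => e e0; apply/near_normP.
(* The second radius makes the quadratic error [|v|^2 C / rho^2] at most [e |v|]; the 1 in [C + 1]
   guards against [C = 0]. *)
exists (Num.min rho (e * rho ^+ 2 / (C + 1))).
  rewrite lt_min rho0 divr_gt0 ?mulr_gt0 ?exprn_gt0//.
  by rewrite ltr_wpDl.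
move=> v; rewrite subr0 le_min => /andP[vr ve]; rewrite /=.
apply: le_trans (key v vr) _.
rewrite ler_pdivlMr ?ltr_wpDl// in ve.
rewrite expr_div_n mulrAC ler_pdivrMr ?exprn_gt0//.
have := ler_wpM2l (normr_ge0 v) ve; have := sqr_ge0 `|v|.
by rewrite !expr2; lra.
Qed.

Definition pd (i : 'I_k) f z : R := 'd f z (delta_mx 0 i).

Lemma analytic_differentiable f a : analytic_at f a -> differentiable f a.
Proof. by move=> /analytic_atP[c [rho /ps_on_differentiable[]]]. Qed.

Lemma lin_form_delta l i : lin_form l (delta_mx 0 i) = l i.
Proof.
rewrite /lin_form (bigD1 i)//= big1 ?addr0; first by rewrite mxE !eqxx mul1r.
by move=> j ji; rewrite mxE (negPf ji) andbF mul0r.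
Qed.

Lemma diff_pd f a v : analytic_at f a -> 'd f a v = \sum_i v 0 i * pd i f a.
Proof.
move=> /analytic_atP[c [rho /ps_on_differentiable[_ dE]]].
by rewrite dE; apply: eq_bigr => i _; rewrite /pd dE lin_form_delta.
Qed.

(** Half of the radius is spent on reaching [z]; the other half is the radius left for the expansion
    around [z] that gives the derivative. *)
Lemma ps_on_pd i f a c rho : ps_on f a c rho -> ps_on (pd i f) a (deriv_ps i c) (rho / 2).
Proof.
move=> fc; case: (fc) => rho0 [C cC] fE.
have r2 : 0 < rho / 2 by rewrite divr_gt0.
have h2 (r : R) : r <= rho / 2 -> r + rho / 2 <= rho by move=> ?; lra.
split=> //.
  exists ((rho / 2)^-1 * C).
  apply: (abs_bounded_ler (g := fun be => deriv_ps i c be * mon (fun=> rho / 2) be)).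
    by move=> al; rewrite mon_cst.
  by apply: (deriv_bounded r2 _ cC) => j; rewrite h2// gtr0_norm.
move=> z za; have zr : `|z - a| < rho by apply: (le_lt_trans za); lra.
have [_ dE] := ps_on_differentiable (ps_on_trans fc zr).
rewrite /pd dE lin_form_delta (comp_trans_unit r2 _ cC)// => j.
by rewrite h2// -coordB (le_trans (ler_coord_norm _ _)).
Qed.

Lemma analytic_pd i f a : analytic_at f a -> analytic_at (pd i f) a.
Proof.
by move=> /analytic_atP[c [rho /(ps_on_pd i) fc]]; apply/analytic_atP; do 2!eexists; exact: fc.
Qed.

End analytic_functions.

(** * Closure properties, identity theorem, orders of vanishing *)

Section analytic_closure.
Variables (R : realType) (k : nat).
Local Notation midx := {ffun 'I_k -> nat}.
Implicit Types (f g h : 'rV[R]_k -> R) (a b z v : 'rV[R]_k) (c : midx -> R).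

Lemma near_all (P : 'rV[R]_k -> Prop) a : (forall z, P z) -> \forall z \near a, P z.
Proof. by move=> H; apply/near_normP; exists 1. Qed.

Let w (rho : R) : midx -> R := mon (fun=> rho).

Let w_gt0 rho : 0 < rho -> forall al, 0 < w rho al.
Proof. by move=> r0 al; exact: mon_gt0. Qed.
Let w0 rho : w rho 0 = 1. Proof. exact: mon0. Qed.
Let wM rho al be : w rho (al + be) <= w rho al * w rho be.
Proof. by rewrite /w monD. Qed.

Let wb c (rho C : R) :
  abs_bounded (fun al => c al * rho ^+ deg al) C <-> wbounded (w rho) c C.
Proof.
by split; apply: abs_bounded_ler => al; rewrite /w mon_cst.
Qed.

Let xw (rho : R) a z : `|z - a| <= rho ->
  forall al : midx, `|mon (fun i => z 0 i - a 0 i) al| <= w rho al.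
Proof.
move=> za al; rewrite /w mon_cst; apply: normr_mon_le => i.
by rewrite -coordB; exact: le_trans (ler_coord_norm _ _) za.
Qed.

Lemma ps_on_near_eq f g a c rho : (\forall z \near a, f z = g z) ->
  ps_on f a c rho -> exists rho', ps_on g a c rho'.
Proof.
move=> /near_normP[e e0 fg] fc; have rho0 : 0 < rho by case: fc.
have rr : 0 < Num.min e rho <= rho by rewrite lt_min e0 rho0 ge_min lexx orbT.
exists (Num.min e rho); have [r0 C0 fE] := ps_on_shrink rr fc.
by split=> // z za; rewrite -fg ?fE// (le_trans za)// ge_min lexx.
Qed.

Lemma ps_on_min f g a c d rho rho' : ps_on f a c rho -> ps_on g a d rho' ->
  exists t, ps_on f a c t /\ ps_on g a d t.
Proof.
move=> fc gd; have [r0 _ _] := fc; have [r0' _ _] := gd.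
exists (Num.min rho rho').
by split; [apply: ps_on_shrink fc|apply: ps_on_shrink gd];
  rewrite lt_min r0 r0' ge_min lexx ?orbT.
Qed.

Lemma ps_on_cst (r : R) a : ps_on (fun=> r) a (fun al => r * one_ps R al) 1.
Proof.
have b1 := wboundedZ r (wbounded_one (w0 1)).
split=> //; first by exists (`|r| * 1); exact/wb.
move=> z za.
by rewrite (evZ (w_gt0 ltr01) (xw za) r (wbounded_one (w0 1))) ev_one mulr1.
Qed.

Lemma ps_on_coord a i : ps_on (fun z => z 0 i) a (trans_ps (fun i => a 0 i) i) 1.
Proof.
have h1 := wboundedZ (a 0 i) (wbounded_one (w0 1)).
have h2 : wbounded (w 1) (fun be => (be == unit_idx i)%:R) 1.
  apply: abs_bounded_ler (abs_boundedW _ (abs_bounded_point (unit_idx i) (fun=> 1))).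
    by move=> be; rewrite /w mon_cst expr1n; case: eqP; rewrite ?mulr1 ?mul0r.
  by rewrite normr1.
split=> //.
  exists (`|a 0 i| * 1 + 1); apply/wb.
  exact: (wboundedD h1 h2).
move=> z za; have xz := xw za.
rewrite (evD (w_gt0 ltr01) xz h1 h2) (evZ (w_gt0 ltr01) xz _ (wbounded_one (w0 1))).
rewrite ev_one mulr1.
have -> : ev (fun be : midx => (be == unit_idx i)%:R) (fun j => z 0 j - a 0 j) = z 0 i - a 0 i.
  rewrite -[RHS](tsum_point (unit_idx i) (fun=> z 0 i - a 0 i)); apply: eq_tsum => be.
  by case: eqP => [->|_]; rewrite ?mul1r ?mul0r// mon_unit.
by rewrite addrC subrK.
Qed.

Lemma ps_onD f g a c d rho : ps_on f a c rho -> ps_on g a d rho ->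
  ps_on (fun z => f z + g z) a (fun al => c al + d al) rho.
Proof.
move=> [r0 [C /wb cC] fE] [_ [D /wb dD] gE]; split=> //.
  by exists (C + D); apply/wb; exact: wboundedD.
by move=> z za; rewrite fE// gE// (evD (w_gt0 r0) (xw za) cC dD).
Qed.

Lemma ps_onZ f a c rho (r : R) : ps_on f a c rho ->
  ps_on (fun z => r * f z) a (fun al => r * c al) rho.
Proof.
move=> [r0 [C /wb cC] fE]; split=> //.
  by exists (`|r| * C); apply/wb; exact: wboundedZ.
by move=> z za; rewrite fE// (evZ (w_gt0 r0) (xw za) r cC).
Qed.

Lemma ps_onM f g a c d rho : ps_on f a c rho -> ps_on g a d rho ->
  ps_on (fun z => f z * g z) a (mul_ps c d) rho.
Proof.
move=> [r0 [C /wb cC] fE] [_ [D /wb dD] gE]; split=> //.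
  by exists (C * D); apply/wb; exact: (wbounded_mul (w_gt0 r0) (@wM rho) cC dD).
by move=> z za; rewrite fE// gE// (ev_mul (w_gt0 r0) (@wM rho) (xw za) cC dD).
Qed.

Lemma analytic_near_eq f g a : (\forall z \near a, f z = g z) ->
  analytic_at f a -> analytic_at g a.
Proof.
move=> fg /analytic_atP[c [rho /(ps_on_near_eq fg)[rho' h]]].
by apply/analytic_atP; exists c, rho'.
Qed.

Lemma analytic_cst (r : R) a : analytic_at (fun=> r) a.
Proof. by apply/analytic_atP; do 2!eexists; exact: ps_on_cst. Qed.

Lemma analytic_coord a i : analytic_at (fun z => z 0 i) a.
Proof. by apply/analytic_atP; do 2!eexists; exact: ps_on_coord. Qed.

Lemma analyticD f g a : analytic_at f a -> analytic_at g a ->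
  analytic_at (fun z => f z + g z) a.
Proof.
move=> /analytic_atP[c [rho fc]] /analytic_atP[d [rho' gd]].
have [t [ft gt]] := ps_on_min fc gd.
by apply/analytic_atP; do 2!eexists; exact: ps_onD ft gt.
Qed.

Lemma analyticZ f a (r : R) : analytic_at f a -> analytic_at (fun z => r * f z) a.
Proof.
by move=> /analytic_atP[c [rho fc]]; apply/analytic_atP; do 2!eexists; exact: ps_onZ fc.
Qed.

Lemma analyticB f g a : analytic_at f a -> analytic_at g a ->
  analytic_at (fun z => f z - g z) a.
Proof.
move=> fa /(analyticZ (-1)) ga; apply: analytic_near_eq (analyticD fa ga).
by apply: near_all => z; rewrite mulN1r.
Qed.

Lemma analyticM f g a : analytic_at f a -> analytic_at g a ->
  analytic_at (fun z => f z * g z) a.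
Proof.
move=> /analytic_atP[c [rho fc]] /analytic_atP[d [rho' gd]].
have [t [ft gt]] := ps_on_min fc gd.
by apply/analytic_atP; do 2!eexists; exact: ps_onM ft gt.
Qed.

Lemma analytic_sum (T : Type) (s : seq T) (F : T -> 'rV[R]_k -> R) a :
  (forall t, analytic_at (F t) a) -> analytic_at (fun z => \sum_(t <- s) F t z) a.
Proof.
move=> Fa; elim: s => [|t s IH].
  apply: analytic_near_eq (analytic_cst 0 a).
  by apply: near_all => z; rewrite big_nil.
apply: analytic_near_eq (analyticD (Fa t) IH).
by apply: near_all => z; rewrite big_cons.
Qed.

Lemma analyticX f a n : analytic_at f a -> analytic_at (fun z => f z ^+ n) a.
Proof.
move=> fa; elim: n => [|n IH]; first exact: analytic_cst.
by apply: analytic_near_eq (analyticM fa IH); apply: near_all => z; rewrite exprS.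
Qed.

Lemma ps_on_center f a c rho : ps_on f a c rho -> f a = c 0.
Proof.
move=> [r0 _ fE]; rewrite fE ?subrr ?normr0; last exact: ltW.
by rewrite -[RHS]ev0; congr ev; apply/funext => i; rewrite subrr.
Qed.

Lemma deriv_psC i j c : deriv_ps i (deriv_ps j c) = deriv_ps j (deriv_ps i c).
Proof.
apply/funext => al; rewrite /deriv_ps !mulrA !midxD !ffunE (addrAC al).
congr (_ * _); rewrite -!natrM; congr (_%:R); rewrite eq_sym.
by case: eqVneq => [->|]; rewrite ?addn0 ?addn1// mulnC.
Qed.

Lemma pdC i j f a : analytic_at f a -> pd i (pd j f) a = pd j (pd i f) a.
Proof.
move=> /analytic_atP[c [rho fc]].
rewrite (ps_on_center (ps_on_pd i (ps_on_pd j fc))).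
by rewrite (ps_on_center (ps_on_pd j (ps_on_pd i fc))) deriv_psC.
Qed.

Lemma diff_near_eq f g a v : (\forall z \near a, f z = g z) ->
  analytic_at f a -> 'd f a v = 'd g a v.
Proof.
move=> fg fa; have ga := analytic_near_eq fg fa.
rewrite -!deriveE; [exact: near_eq_derive|exact: analytic_differentiable..].
Qed.

(** Induction on the degree, over all functions: up to a nonzero integer factor, a coefficient of
    positive degree is a coefficient of lower degree of a partial derivative, which again vanishes
    near [a]. *)
Lemma ps_on_eq0 f a c rho : ps_on f a c rho -> (\forall z \near a, f z = 0) ->
  forall al, c al = 0.
Proof.
move=> fc fa0 al; move: {2}(deg al) (erefl (deg al)) => n.
elim: n f c rho al fc fa0 => [|n IH] f c rho al fc fa0 dal.
  by rewrite (deg_eq0 dal) -(ps_on_center fc); exact: nbhs_singleton fa0.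
have [i ai] := deg_gt0 dal; have fi := ps_on_pd i fc.
have fan : \forall z \near a, analytic_at f z.
  by apply: analytic_at_near; apply/analytic_atP; exists c, rho.
have fi0 : \forall z \near a, pd i f z = 0.
  apply: filterS2 fan (near_join fa0) => z fz f0.
  rewrite /pd (diff_near_eq _ f0 fz).
  by rewrite -[fun=> 0]/(cst 0) diff_cst.
have dp : deg (pred_idx i al) = n.
  by have := degD (pred_idx i al) (unit_idx i); rewrite pred_idxK// dal deg_unit addn1 => -[].
have /eqP := IH _ _ _ _ fi fi0 dp; rewrite /deriv_ps pred_idxK// mulf_eq0 pnatr_eq0.
by move=> /eqP.
Qed.

Lemma ps_on_unique f a c d rho rho' : ps_on f a c rho -> ps_on f a d rho' -> c = d.
Proof.
move=> fc fd; have [t [fc' fd']] := ps_on_min fc fd.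
have h := ps_onD fc' (ps_onZ (-1) fd'); apply/funext => al; apply/eqP; rewrite -subr_eq0.
by apply/eqP; rewrite -mulN1r; apply: (ps_on_eq0 h); apply: near_all => z; rewrite mulN1r subrr.
Qed.

(** With [d = deg] this is the order of vanishing at [a]; with [d] the exponent of one variable it
    is divisibility by a power of that variable. By [ps_on_unique] the choice of expansion is
    immaterial. *)
Definition vanishes (d : midx -> nat) (N : nat) f a :=
  exists c rho, ps_on f a c rho /\ forall al, (d al < N)%N -> c al = 0.

Section vanishes_lemmas.
Variable d : midx -> nat.

Lemma vanishes_analytic N f a : vanishes d N f a -> analytic_at f a.
Proof. by move=> [c [rho [fc _]]]; apply/analytic_atP; exists c, rho. Qed.

Lemma vanishes0 f a : analytic_at f a -> vanishes d 0 f a.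
Proof. by move=> /analytic_atP[c [rho fc]]; exists c, rho. Qed.

Lemma vanishesW N M f a : (N <= M)%N -> vanishes d M f a -> vanishes d N f a.
Proof.
move=> NM [c [rho [fc c0]]]; exists c, rho; split=> // al aN.
by apply: c0; exact: leq_trans NM.
Qed.

Lemma vanishes_near_eq N f g a : (\forall z \near a, f z = g z) ->
  vanishes d N f a -> vanishes d N g a.
Proof.
by move=> fg [c [rho [/(ps_on_near_eq fg)[rho' gc] c0]]]; exists c, rho'.
Qed.

Lemma vanishesD N f g a : vanishes d N f a -> vanishes d N g a ->
  vanishes d N (fun z => f z + g z) a.
Proof.
move=> [c [rho [fc c0]]] [e [rho' [ge e0]]]; have [t [ft gt]] := ps_on_min fc ge.
do 2!eexists; split; first exact: ps_onD ft gt.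
by move=> al aN /=; rewrite c0// e0// addr0.
Qed.

Lemma vanishesZ N f a (r : R) : vanishes d N f a -> vanishes d N (fun z => r * f z) a.
Proof.
move=> [c [rho [fc c0]]]; do 2!eexists; split; first exact: ps_onZ fc.
by move=> al aN /=; rewrite c0// mulr0.
Qed.

Lemma vanishesB N f g a : vanishes d N f a -> vanishes d N g a ->
  vanishes d N (fun z => f z - g z) a.
Proof.
move=> fa /(vanishesZ (-1)) ga; apply: vanishes_near_eq (vanishesD fa ga).
by apply: near_all => z; rewrite mulN1r.
Qed.

Lemma vanishes_sum N (T : Type) (s : seq T) (P : pred T) (F : T -> 'rV[R]_k -> R) a :
  (forall t, P t -> vanishes d N (F t) a) ->
  vanishes d N (fun z => \sum_(t <- s | P t) F t z) a.
Proof.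
move=> Fa; elim: s => [|t s IH].
  exists (fun al => 0 * one_ps R al), 1; split; last by move=> al _; rewrite mul0r.
  have [r0 C0 fE] := ps_on_cst 0 a; split=> // z za.
  by rewrite big_nil; exact: fE.
case Pt : (P t).
  apply: vanishes_near_eq (vanishesD (Fa t Pt) IH).
  by apply: near_all => z; rewrite big_cons Pt.
by apply: vanishes_near_eq IH; apply: near_all => z; rewrite big_cons Pt.
Qed.

Hypothesis dD : forall al be, d (al + be) = (d al + d be)%N.

Lemma vanishesM N M f g a : vanishes d N f a -> vanishes d M g a ->
  vanishes d (N + M) (fun z => f z * g z) a.
Proof.
move=> [c [rho [fc c0]]] [e [rho' [ge e0]]]; have [t [ft gt]] := ps_on_min fc ge.
do 2!eexists; split; first exact: ps_onM ft gt.
exact: mul_ps_order.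
Qed.

Lemma vanishesMl N f g a : vanishes d N f a -> analytic_at g a ->
  vanishes d N (fun z => f z * g z) a.
Proof. by move=> fN /vanishes0 g0; rewrite -(addn0 N); exact: vanishesM. Qed.

Lemma vanishesMr N f g a : analytic_at f a -> vanishes d N g a ->
  vanishes d N (fun z => f z * g z) a.
Proof. by move=> /vanishes0 f0 gN; rewrite -(add0n N); exact: vanishesM. Qed.

Lemma vanishesX f a n : vanishes d 1 f a -> vanishes d n (fun z => f z ^+ n) a.
Proof.
move=> fa; elim: n => [|n IH].
  by apply: vanishes0; apply: analyticX; exact: vanishes_analytic fa.
rewrite -(add1n n); apply: vanishes_near_eq (vanishesM fa IH).
by apply: near_all => z; rewrite exprS.
Qed.

Lemma vanishes_pd N i f a : d (unit_idx i) = 0%N -> vanishes d N f a ->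
  vanishes d N (pd i f) a.
Proof.
move=> di [c [rho [fc c0]]]; do 2!eexists; split; first exact: ps_on_pd fc.
by move=> al aN; rewrite /deriv_ps c0 ?mulr0// dD di addn0.
Qed.

End vanishes_lemmas.

Lemma vanishes_deg_step N f a : analytic_at f a -> f a = 0 ->
  (forall i, vanishes (@deg k) N (pd i f) a) -> vanishes (@deg k) N.+1 f a.
Proof.
move=> /analytic_atP[c [rho fc]] fa0 fi; exists c, rho; split=> // al.
case da : (deg al) => [|n].
  by move=> _; rewrite (deg_eq0 da) -(ps_on_center fc).
have [i ai] := deg_gt0 da; rewrite ltnS => nN.
have [e [rho' [fe e0]]] := fi i.
have dp : deg (pred_idx i al) = n.
  by have := degD (pred_idx i al) (unit_idx i); rewrite pred_idxK// da deg_unit addn1 => -[].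
have := e0 (pred_idx i al); rewrite dp => /(_ nN).
rewrite (ps_on_unique fe (ps_on_pd i fc)) /deriv_ps pred_idxK// => /eqP.
by rewrite mulf_eq0 pnatr_eq0 => /eqP.
Qed.

(** Coefficients with a positive exponent of variable [i] are recovered from the derivative, one
    order higher; those with exponent 0 form the restriction to the hyperplane, where [f] is
    zero. *)
Lemma vanishes_coord_step N i f a : analytic_at f a ->
  (\forall z \near a, (z : 'rV[R]_k) 0 i = a 0 i -> f z = 0) ->
  vanishes (fun al => al i) N (pd i f) a -> vanishes (fun al => al i) N.+1 f a.
Proof.
move=> /analytic_atP[c [rho fc]] fa0 [e [rho' [fe e0]]]; exists c, rho; split=> // al.
case: (posnP (al i)) => [ai _|ai aN]; last first.
  have := e0 (pred_idx i al).
  rewrite (ps_on_unique fe (ps_on_pd i fc)) /deriv_ps pred_idxK// !ffunE eqxx subn1.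
  rewrite prednK// => /(_ aN)/eqP; rewrite mulf_eq0 pnatr_eq0 gtn_eqF//.
  by move=> /eqP.
have [r0 [C cC] fE] := fc.
(* [c'] keeps the monomials free of variable [i]. It is the expansion of [f] composed with the
   projection [p] onto the hyperplane, hence zero. *)
pose c' (be : midx) := if be i == 0%N then c be else 0.
pose p z : 'rV[R]_k := z - (z 0 i - a 0 i) *: delta_mx 0 i.
have pE z j : p z 0 j = if j == i then a 0 i else z 0 j.
  rewrite !mxE eqxx /=; case: eqP => [->|_]; first by rewrite mulr1 subKr.
  by rewrite mulr0 subr0.
have pa z : `|p z - a| <= `|z - a|.
  apply: ler_norm_coord => // j; rewrite coordB pE; case: eqP => [->|_].
    by rewrite subrr normr0.
  by rewrite -coordB ler_coord_norm.
have fc' : ps_on (f \o p) a c' rho.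
  split=> //.
    exists C; apply: abs_bounded_ler cC => be; rewrite /c'.
    by case: eqP => // _; rewrite mul0r normr0.
  move=> z za; rewrite /= fE ?(le_trans (pa z))//; apply: eq_tsum => be; rewrite /c'.
  have [bi|bi] := eqVneq (be i) 0%N.
    congr (_ * _); apply: eq_bigr => j _; rewrite pE.
    by case: eqP => // ->; rewrite bi !expr0.
  by rewrite mul0r /mon (bigD1 i)//= pE eqxx subrr expr0n (negPf bi) mul0r mulr0.
suff /(_ al) : forall be, c' be = 0 by rewrite /c' ai.
apply: (ps_on_eq0 fc').
move: fa0 => /near_normP[t t0 ft]; apply/near_normP; exists t => // z zt.
by apply: ft; [exact: le_trans (pa z) zt|rewrite pE eqxx].
Qed.

Lemma vanishes_all_eq0 f a : (forall N, vanishes (@deg k) N f a) ->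
  \forall z \near a, f z = 0.
Proof.
move=> fN; have [c [rho [fc _]]] := fN 0%N.
have c0 al : c al = 0.
  have [e [rho' [fe e0]]] := fN (deg al).+1.
  by rewrite (ps_on_unique fc fe) e0.
case: fc => r0 _ fE; apply/near_normP; exists rho => // z za.
rewrite fE// -[RHS](tsum0 R midx); apply: eq_tsum => al.
by rewrite c0 mul0r.
Qed.

End analytic_closure.

(** * Composition of analytic maps *)

Section analytic_composition.
Variables (R : realType) (k m : nat).
Local Notation midx := {ffun 'I_k -> nat}.

Lemma ev_split (c : midx -> R) x M : abs_bounded (fun al => c al * mon x al) M ->
  ev c x = c 0 + ev (fun al => if al == 0 then 0 else c al) x.
Proof.
move=> cM.
have hq : abs_bounded (fun al => (if al == 0 then 0 else c al) * mon x al) M.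
  apply: abs_bounded_ler cM => al.
  by case: eqP => // _; rewrite mul0r normr0.
have hp := abs_bounded_point (0 : midx) c.
rewrite /ev -(tsum_point (0 : midx) c) -(tsumD hp hq); apply: eq_tsum => al.
by case: eqP => [->|_]; rewrite ?mon0 ?mulr1 ?mul0r ?addr0 ?add0r.
Qed.

(** Without its constant term a series has norm O(t) at radius [t]. This brings the inner map of a
    composition into the polydisc of the outer function. *)
Lemma ps_on_small (f : 'rV[R]_k -> R) a (c : midx -> R) rho eta : ps_on f a c rho ->
  0 < eta -> exists2 t0, 0 < t0 & forall t, 0 < t <= t0 -> t <= rho /\
    abs_bounded (fun al => (if al == 0 then 0 else c al) * t ^+ deg al) eta.
Proof.
move=> [r0 [C cC] _] eta0; have C0 := abs_bounded_ge0 cC.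
exists (Num.min rho (eta * rho / (C + 1))).
  by rewrite lt_min r0 divr_gt0 ?mulr_gt0 ?ltr_wpDl.
move=> t /andP[t0]; rewrite le_min => /andP[tr tC]; split=> //.
have tr' : t / rho <= 1 by rewrite ler_pdivrMr// mul1r.
have h : t / rho * C <= eta.
  rewrite ler_pdivlMr ?ltr_wpDl// in tC.
  by rewrite mulrAC ler_pdivrMr//; lra.
apply: abs_boundedW h _; have := abs_boundedZ (t / rho) cC.
rewrite (ger0_norm (x := t / rho)) ?divr_ge0 ?(ltW t0) ?(ltW r0)//.
apply: abs_bounded_ler => al; case: eqP => [_|/eqP a0]; first by rewrite mul0r normr0.
case d : (deg al) => [|n]; first by rewrite (deg_eq0 d) eqxx in a0.
rewrite mulrCA normrM [leRHS]normrM ler_wpM2l//.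
have -> : t / rho * rho ^+ n.+1 = t * rho ^+ n by rewrite exprS; field; rewrite gt_eqF.
rewrite exprS !ger0_norm ?mulr_ge0 ?exprn_ge0 ?(ltW t0) ?(ltW r0)//.
by rewrite ler_wpM2l ?(ltW t0)// lerXn2r// nnegrE ltW.
Qed.

Lemma finite_pos_lower_bound n (dl : 'I_n -> R) : (forall j, 0 < dl j) ->
  exists2 t, 0 < t & forall j, t <= dl j.
Proof.
move=> d0; have s0 : 0 <= \sum_j (dl j)^-1 by apply: sumr_ge0 => j _; rewrite invr_ge0 ltW.
(* The sum dominates each inverse; the added 1 keeps the witness positive when [n = 0]. *)
exists ((\sum_j (dl j)^-1 + 1)^-1); first by rewrite invr_gt0 ltr_wpDl.
move=> j; rewrite -[leRHS]invrK lef_pV2 ?posrE ?invr_gt0 ?ltr_wpDl//.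
rewrite (bigD1 j)//= -addrA lerDl addr_ge0//.
by apply: sumr_ge0 => i _; rewrite invr_ge0 ltW.
Qed.

Lemma analytic_comp (f : 'rV[R]_m -> R) (G : 'rV[R]_k -> 'rV[R]_m) b :
  analytic_at f (G b) -> (forall j, analytic_at (fun z => G z 0 j) b) ->
  analytic_at (fun z => f (G z)) b.
Proof.
move=> /analytic_atP[c [rho [r0 [C cC] fE]]] Gb.
have /choice[dr Gd] : forall j, exists dr : (midx -> R) * R,
    ps_on (fun z => G z 0 j) b dr.1 dr.2.
  by move=> j; have /analytic_atP[d [r h]] := Gb j; exists (d, r).
have /choice[t0 t0P] : forall j, exists t0 : R, 0 < t0 /\ forall t, 0 < t <= t0 ->
    t <= (dr j).2 /\ abs_bounded
    (fun al => (if al == 0 then 0 else (dr j).1 al) * t ^+ deg al) rho.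
  by move=> j; have [t t0 h] := ps_on_small (Gd j) r0; exists t.
have [t tgt0 tle] := finite_pos_lower_bound (fun j => (t0P j).1).
have tP j : t <= (dr j).2 /\ abs_bounded
    (fun al => (if al == 0 then 0 else (dr j).1 al) * t ^+ deg al) rho.
  by apply: (t0P j).2; rewrite tgt0 tle.
pose w : midx -> R := mon (fun=> t).
have w_gt0 al : 0 < w al by exact: mon_gt0.
have w0 : w 0 = 1 by exact: mon0.
have wM al be : w (al + be) <= w al * w be by rewrite /w monD.
pose g j (al : midx) := if al == 0 then 0 else (dr j).1 al.
have gw j : wbounded w (g j) rho.
  by apply: abs_bounded_ler (tP j).2 => al; rewrite /w mon_cst.
have cC' : abs_bounded (fun al => c al * mon (fun=> rho) al) C.
  by apply: abs_bounded_ler cC => al; rewrite mon_cst.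
apply/analytic_atP; exists (comp_ps c g), t; split=> //.
  exists C; have := wbounded_comp w_gt0 w0 wM gw cC'.
  by apply: abs_bounded_ler => al; rewrite /w mon_cst.
move=> z zb.
have xw al : `|mon (fun i => z 0 i - b 0 i) al| <= w al.
  rewrite /w mon_cst; apply: normr_mon_le => i.
  by rewrite -coordB; exact: le_trans (ler_coord_norm _ _) zb.
have gE j : ev (g j) (fun i => z 0 i - b 0 i) = G z 0 j - G b 0 j.
  have zbj : `|z - b| <= (dr j).2 by exact: le_trans zb (tP j).1.
  have [M hM] := ps_on_mon (Gd j) zbj.
  rewrite (ps_on_center (Gd j)); case: (Gd j) => _ _ -> //.
  by rewrite (ev_split hM) addrAC subrr add0r.
rewrite (ev_comp w_gt0 w0 wM gw cC' xw) fE.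
  by congr ev; apply/funext => j; rewrite gE.
apply: ler_norm_coord => [|j]; first exact: ltW.
by rewrite coordB -gE; exact: normr_ev (gw j).
Qed.

End analytic_composition.

(** * The Cauchy-Kovalevskaya construction *)

Section unshift.
Variables (R : realType) (k : nat) (i : 'I_k).
Local Notation midx := {ffun 'I_k -> nat}.

Lemma abs_bounded_unshift (f : midx -> R) M : (forall al : midx, al i = 0%N -> f al = 0) ->
  abs_bounded (fun be => f (be + unit_idx i)) M -> abs_bounded f M.
Proof.
move=> f0 fM; pose F be al := if be + unit_idx i == al then f al else 0.
have rowF be : abs_bounded (F be) `|f (be + unit_idx i)|.
  apply: abs_bounded_ler (abs_bounded_point (be + unit_idx i) f) => al.
  by rewrite /F eq_sym.
apply: abs_bounded_ler (abs_bounded_tsum_col rowF (abs_bounded_norm fM)) => al.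
case: (posnP (al i)) => ai; first by rewrite f0// normr0.
rewrite -[X in `|f X|](pred_idxK ai).
have -> : (fun be => F be al) = (fun be => if be == pred_idx i al then f al else 0).
  apply/funext => be; rewrite /F -{1}(pred_idxK ai).
  by rewrite (inj_eq (@add_unit_inj k i)).
by rewrite tsum_point pred_idxK.
Qed.

Lemma abs_bounded_shift_any (f : midx -> R) M : abs_bounded f M ->
  abs_bounded (fun be => f (be + unit_idx i)) M.
Proof.
move=> fM; pose f' (al : midx) := if al i == 0%N then 0 else f al.
have h0 (al : midx) : al i = 0%N -> f' al = 0 by rewrite /f' => ->.
have f'M : abs_bounded f' M.
  by apply: abs_bounded_ler fM => al; rewrite /f'; case: eqP => // _; rewrite normr0.
apply: abs_bounded_ler (abs_bounded_shift h0 f'M) => be.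
by rewrite /f' midxD ffunE eqxx addn1.
Qed.

Definition integ_ps (u : midx -> R) (al : midx) : R :=
  if al i == 0%N then 0 else u (pred_idx i al) / (al i)%:R.

Lemma pred_idx_add (be : midx) : pred_idx i (be + unit_idx i) = be :> midx.
Proof. by apply: (@add_unit_inj k i); rewrite pred_idxK// midxD ffunE eqxx addn1. Qed.

Lemma integ_ps_unit u (be : midx) : integ_ps u (be + unit_idx i) = u be / (be i).+1%:R.
Proof. by rewrite /integ_ps pred_idx_add midxD ffunE eqxx addn1. Qed.

Lemma deriv_integ_ps u : deriv_ps i (integ_ps u) = u.
Proof.
by apply/funext => be; rewrite /deriv_ps integ_ps_unit mulrC divfK.
Qed.

End unshift.

Lemma bin_le_exp2 n b : ('C(n, b) <= 2 ^ n)%N.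
Proof.
elim: n b => [|n IH] [|b] //; first by rewrite bin0 expn_gt0.
by rewrite binS expnS mul2n -addnn leq_add.
Qed.

(** A single term of Vandermonde's convolution. It makes the binomial denominator of [ck_weight]
    compatible with products. *)
Lemma leq_mul_bin n m a b : ('C(n, a) * 'C(m, b) <= 'C(n + m, a + b))%N.
Proof.
rewrite -binomial.Vandermonde (bigD1 (inord a))//= inordK; last by rewrite ltnS leq_addr.
by rewrite addKn leq_addr.
Qed.

Definition ix : 'I_2 := ord0.
Definition iy : 'I_2 := ord_max.

(* Dividing by the binomial coefficient makes d/dx after integration in y of norm
   dl, without destroying submultiplicativity. *)
HB.lock Definition ck_weight (R : realType) (rho dl : R) (al : {ffun 'I_2 -> nat}) : R :=
  rho ^+ deg al * dl ^+ al iy / 'C(deg al, al iy)%:R.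

Section cauchy_kovalevskaya.
Variable R : realType.
Local Notation midx := {ffun 'I_2 -> nat}.
Implicit Types (al be : midx) (u : midx -> R).

Lemma deg2 al : deg al = (al ix + al iy)%N.
Proof.
rewrite /deg 2!big_ord_recr big_ord0 /= add0n; congr (al _ + al _)%N; exact: val_inj.
Qed.

Lemma ix_iy : (ix == iy) = false. Proof. by []. Qed.

Lemma I2P (i : 'I_2) : i = ix \/ i = iy.
Proof.
by case: i => [[|[|//]] h]; [left|right]; apply: val_inj.
Qed.

Section weight.
Variables rho dl : R.
Hypotheses (rho0 : 0 < rho) (dl0 : 0 < dl) (dl1 : dl <= 1).
Let w := ck_weight rho dl.

Let bin_gt0' al : 0 < 'C(deg al, al iy)%:R :> R.
Proof. by rewrite ltr0n bin_gt0 deg2 leq_addl. Qed.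

Lemma ck_weight_gt0 al : 0 < w al.
Proof. by rewrite /w ck_weight.unlock divr_gt0 ?mulr_gt0 ?exprn_gt0. Qed.

Lemma ck_weight0 : w 0 = 1.
Proof. by rewrite /w ck_weight.unlock deg0 midx0 !expr0 mulr1 divr1. Qed.

Lemma ck_weightM al be : w (al + be) <= w al * w be.
Proof.
rewrite /w ck_weight.unlock degD midxD !exprD mulf_div -natrM.
rewrite (mulrACA (rho ^+ _)) ler_wpM2l ?mulr_ge0 ?exprn_ge0 ?(ltW rho0) ?(ltW dl0)//.
rewrite lef_pV2 ?posrE ?ler_nat ?leq_mul_bin// ltr0n ?muln_gt0.
  by rewrite bin_gt0 !deg2 addnACA leq_addl.
by rewrite -!(ltr0n R) !bin_gt0'.
Qed.

Lemma ck_weight_unit i : w (unit_idx i) <= rho.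
Proof.
rewrite /w ck_weight.unlock deg_unit expr1.
have -> : 'C(1, unit_idx i iy) = 1%N.
  by rewrite ffunE; case: (iy == i).
rewrite divr1 ger_pMr// exprn_ile1//; exact: ltW.
Qed.

(** Comparison with a geometric weight: a finite norm implies convergence on the polydisc of radius
    [rho * dl / 2]. *)
Lemma ck_weight_ge al : (rho * dl / 2) ^+ deg al <= w al.
Proof.
rewrite /w ck_weight.unlock exprMn exprVn exprMn -mulrA -[leRHS]mulrA.
rewrite ler_wpM2l ?exprn_ge0 ?(ltW rho0)//.
rewrite ler_pM ?exprn_ge0 ?invr_ge0 ?exprn_ge0 ?(ltW dl0)//.
  by apply: ler_wiXn2l => //; [exact: ltW|rewrite deg2 leq_addl].
by rewrite lef_pV2 ?posrE ?exprn_gt0// -natrX ler_nat bin_le_exp2.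
Qed.

Lemma wbounded_integ i u C : wbounded w u C -> wbounded w (integ_ps i u) (rho * C).
Proof.
move=> uC; apply: (abs_bounded_unshift (i := i)) => [al ai|].
  by rewrite /integ_ps ai mul0r.
have := abs_boundedZ rho uC; rewrite gtr0_norm//.
apply: abs_bounded_ler => be; rewrite integ_ps_unit.
have w1 := ck_weight_gt0 (be + unit_idx i); have w2 := ck_weight_gt0 be.
rewrite !normrM (gtr0_norm w1) (gtr0_norm w2) (gtr0_norm rho0) normfV normr_nat.
rewrite -mulrA [leRHS]mulrCA ler_wpM2l//.
apply: (@le_trans _ _ (w (be + unit_idx i))).
  by rewrite ler_piMl ?(ltW w1)// invf_le1 ?ltr0n// ler1n.
apply: le_trans (ck_weightM _ _) _; rewrite mulrC ler_wpM2r ?ck_weight_unit//.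
exact: ltW.
Qed.

(** The operator moves the coefficient at [be + unit_idx ix] to [be + unit_idx iy] with the factor
    (be ix + 1) / (be iy + 1). The quotient of the binomials in the two weights cancels this factor
    exactly, and only [dl] remains. *)
Lemma wbounded_deriv_integ u C : wbounded w u C ->
  wbounded w (deriv_ps ix (integ_ps iy u)) (dl * C).
Proof.
move=> uC; apply: (abs_bounded_unshift (i := iy)) => [al ai|].
  by rewrite /deriv_ps /integ_ps midxD ffunE ai mulr0 mul0r.
have := abs_bounded_shift_any ix (abs_boundedZ dl uC); rewrite gtr0_norm//.
apply: abs_bounded_ler => be; rewrite /deriv_ps addrAC integ_ps_unit.
rewrite le_eqVlt; apply/orP; left; apply/eqP; congr (`|_|).
rewrite /w ck_weight.unlock !degD !deg_unit !midxD !ffunE !eqxx ix_iy.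
rewrite (_ : (iy == ix) = false)// !addn0 !addn1.
have dE : deg be = (be ix + be iy)%N by exact: deg2.
have hb : ((be iy).+1 * 'C((deg be).+1, (be iy).+1) = (be ix).+1 * 'C((deg be).+1, be iy))%N.
  by rewrite mul_bin_left dE -addSn addnK.
have b1 : 'C((deg be).+1, (be iy).+1)%:R != 0 :> R.
  by rewrite pnatr_eq0 -lt0n bin_gt0 ltnS dE leq_addl.
have b2 : 'C((deg be).+1, be iy)%:R != 0 :> R.
  by rewrite pnatr_eq0 -lt0n bin_gt0 leqW// dE leq_addl.
have b3 : (be iy).+1%:R != 0 :> R by rewrite pnatr_eq0.
have {hb} : (be iy).+1%:R * 'C((deg be).+1, (be iy).+1)%:R =
    (be ix).+1%:R * 'C((deg be).+1, be iy)%:R :> R by rewrite -!natrM hb.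
move: b1 b2 b3; set B1 := 'C(_, _.+1)%:R; set B2 := 'C(_, be iy)%:R.
set a := (be ix).+1%:R; set b := (be iy).+1%:R => b1 b2 b3 hb.
rewrite [dl ^+ _.+1]exprS; set E := rho ^+ _; set D := dl ^+ _; set v := u _.
clearbody B1 B2 a b; have -> : a = b * B1 / B2 by rewrite hb mulfK.
by field; rewrite b1 b2 b3.
Qed.

End weight.

Section fixed_point.
Variables (m : nat) (cX : 'I_m -> {ffun 'I_m -> nat} -> R).
Variables (cJ : 'I_m -> 'I_m -> {ffun 'I_m -> nat} -> R) (r CX CJ : R).
Hypothesis r0 : 0 < r.
Hypothesis cXb : forall j, abs_bounded (fun mu => cX j mu * r ^+ deg mu) CX.
Hypothesis cJb : forall l j, abs_bounded (fun mu => cJ l j mu * r ^+ deg mu) CJ.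

Definition initial_ps u al : R := if al iy == 0%N then u al else 0.

Definition ck_rhs (G : 'I_m -> midx -> R) j al : R :=
  \sum_l mul_ps (deriv_ps ix (G l)) (comp_ps (cJ l j) G) al.

(** The equations of the disc in integrated form: the integral of X(G) along the x-axis from 0 to x,
    plus the integral in y of G_x J(G). [G] is the displacement from the starting point, so its
    constant term is 0. *)
Definition ck_map (G : 'I_m -> midx -> R) j al : R :=
  integ_ps ix (initial_ps (comp_ps (cX j) G)) al + integ_ps iy (ck_rhs G j) al.

(** Counting y twice, the derivative in x costs 1 and the integration in y brings 2, so [ck_map]
    determines one more degree at each step. *)
Let d al := (al ix + (al iy).*2)%N.

Let dD al be : d (al + be) = (d al + d be)%N.
Proof. by rewrite /d !midxD doubleD addnACA. Qed.

Let d_pred_x al : (0 < al ix)%N -> d al = (d (pred_idx ix al)).+1.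
Proof.
move=> ax; rewrite -{1}(pred_idxK ax) dD.
by have -> : d (unit_idx ix) = 1%N; [rewrite /d !ffunE|rewrite addn1].
Qed.

Let d_pred_y al : (0 < al iy)%N -> d al = (d (pred_idx iy al)).+2.
Proof.
move=> ay; rewrite -{1}(pred_idxK ay) dD.
by have -> : d (unit_idx iy) = 2%N; [rewrite /d !ffunE|rewrite addn2].
Qed.

Lemma ck_map_local G G' N :
  (forall j al, (d al < N)%N -> G j al = G' j al) ->
  forall j al, (d al < N.+1)%N -> ck_map G j al = ck_map G' j al.
Proof.
move=> GG j al dN; congr (_ + _); rewrite /integ_ps; case: posnP => // ap; congr (_ / _).
  rewrite (d_pred_x ap) ltnS in dN; rewrite /initial_ps; case: eqP => // _.
  exact: (comp_ps_local _ dD GG dN).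
rewrite (d_pred_y ap) ltnS in dN.
apply: eq_bigr => l _; apply: (mul_ps_local dD (N := N.-1)) => [be bN|be bN|].
- rewrite /deriv_ps GG// dD; have -> : d (unit_idx ix) = 1%N by rewrite /d !ffunE.
  by rewrite addn1; case: N bN {GG dN}.
- apply: (comp_ps_local _ dD GG); exact: leq_trans bN (leq_pred _).
- by case: N dN {GG}.
Qed.

(** [K] bounds G_x, so [B] bounds the sum of m products in [ck_rhs]. From [ck_dl] comes dl B <= 1,
    whence the x-derivative of the image is at most CX + 1 = K; from [ck_rho] comes rho (CX + B) <=
    r, whence the image stays where the coefficient series converge. *)
Let K := CX + 1.
Let B := m%:R * (K * CJ).
Definition ck_dl : R := (B + 1)^-1.
Definition ck_rho : R := r / (CX + B + 1).

(* CX and CJ are only known to be nonnegative when 'I_m is inhabited. *)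
Let CX0 (j : 'I_m) : 0 <= CX. Proof. exact: abs_bounded_ge0 (cXb j). Qed.
Let CJ0 (j : 'I_m) : 0 <= CJ. Proof. exact: abs_bounded_ge0 (cJb j j). Qed.
Let B0 (j : 'I_m) : 0 <= B.
Proof. by rewrite /B mulr_ge0// mulr_ge0 ?CJ0// addr_ge0 ?CX0. Qed.
Let dl0 (j : 'I_m) : 0 < ck_dl.
Proof. by rewrite /ck_dl invr_gt0 ltr_wpDl ?B0. Qed.
Let dl1 (j : 'I_m) : ck_dl <= 1.
Proof. by rewrite /ck_dl invf_le1 ?ltr_wpDl ?B0// lerDr B0. Qed.
Let rho0 (j : 'I_m) : 0 < ck_rho.
Proof. by rewrite /ck_rho divr_gt0// ltr_wpDl// addr_ge0 ?CX0 ?B0. Qed.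

Let w := ck_weight ck_rho ck_dl.

(** The x-derivative needs a bound of its own: it occurs in [ck_rhs], and differentiation alone is
    unbounded on the algebra. *)
Definition ck_ball (G : 'I_m -> midx -> R) := forall j,
  wbounded w (G j) r /\ wbounded w (deriv_ps ix (G j)) K.

Let to_mon C (c : {ffun 'I_m -> nat} -> R) :
  abs_bounded (fun mu => c mu * r ^+ deg mu) C ->
  abs_bounded (fun mu => c mu * mon (fun=> r) mu) C.
Proof. by apply: abs_bounded_ler => al; rewrite mon_cst. Qed.

Lemma wbounded_comp_ball G (j0 : 'I_m) C c : ck_ball G ->
  abs_bounded (fun mu => c mu * r ^+ deg mu) C -> wbounded w (comp_ps c G) C.
Proof.
move=> Gb cC; apply: (wbounded_comp _ _ _ (fun j => (Gb j).1) (to_mon cC)).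
- exact: ck_weight_gt0 (rho0 j0) (dl0 j0).
- exact: ck_weight0.
- exact: ck_weightM (rho0 j0) (dl0 j0).
Qed.

Lemma wbounded_rhs G j : ck_ball G -> wbounded w (ck_rhs G j) B.
Proof.
move=> Gb; rewrite /B -[X in X%:R * _](card_ord m) mulr_natl -sumr_const.
apply: wbounded_sum => l; apply: wbounded_mul (Gb l).2 _.
- exact: ck_weight_gt0 (rho0 j) (dl0 j).
- exact: ck_weightM (rho0 j) (dl0 j).
- exact: wbounded_comp_ball.
Qed.

Lemma wbounded_initial u C : wbounded w u C -> wbounded w (initial_ps u) C.
Proof.
apply: abs_bounded_ler => al; rewrite /initial_ps; case: eqP => // _.
by rewrite mul0r normr0.
Qed.

Lemma deriv_ck_map G j : deriv_ps ix (ck_map G j) =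
  (fun al => initial_ps (comp_ps (cX j) G) al + deriv_ps ix (integ_ps iy (ck_rhs G j)) al).
Proof.
apply/funext => al; rewrite -[X in X al + _](deriv_integ_ps ix).
by rewrite /deriv_ps -mulrDr.
Qed.

Lemma ck_map_ball G : ck_ball G -> ck_ball (ck_map G).
Proof.
move=> Gb j; have h1 := wbounded_initial (wbounded_comp_ball j Gb (cXb j)).
have h2 := wbounded_rhs j Gb; have den : 0 < CX + B + 1.
  by rewrite ltr_wpDl// addr_ge0 ?CX0 ?B0.
split.
  have := wboundedD (wbounded_integ (rho0 j) (dl0 j) (dl1 j) ix h1)
    (wbounded_integ (rho0 j) (dl0 j) (dl1 j) iy h2).
  apply: abs_boundedW; rewrite -mulrDr /ck_rho mulrAC ler_pdivrMr// ler_wpM2l ?(ltW r0)//.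
  by rewrite lerDl.
rewrite deriv_ck_map.
have := wboundedD h1 (wbounded_deriv_integ (dl0 j) h2).
apply: abs_boundedW; rewrite lerD2l /ck_dl mulrC ler_pdivrMr ?ltr_wpDl ?B0// mul1r.
by rewrite lerDl.
Qed.

Let U n := iter n ck_map (fun _ _ => 0).
Let L j al := U (d al).+1 j al.

Let U_ball n : ck_ball (U n).
Proof.
elim: n => [|n IH]; last exact: ck_map_ball.
have z C : 0 <= C -> wbounded w (fun=> 0) C.
  by move=> C0 A; rewrite big1// => i _; rewrite mul0r normr0.
move=> j; split; first by apply: z; exact: ltW.
have -> : deriv_ps ix (U 0 j) = fun=> 0 by apply/funext => al; rewrite /deriv_ps mulr0.
by apply: z; rewrite /K addr_ge0 ?(CX0 j).
Qed.

Let U_stable n j al : (d al < n)%N -> U n j al = U n.+1 j al.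
Proof.
elim: n j al => [//|n IH] j al aN.
exact: (@ck_map_local (U n) (U n.+1) n).
Qed.

Let U_L n j al : (d al < n)%N -> U n j al = L j al.
Proof.
move=> /subnK <-; elim: (n - _)%N => [//|i IH].
by rewrite addSn -U_stable// ltn_addl.
Qed.

(** Each coefficient of the iterates is eventually constant, so the limit is taken coefficientwise.
    The bounds of the ball survive because each is a statement about finite sets of indices, on
    which the limit equals an iterate. *)
Lemma ck_fixed_point : exists G, ck_ball G /\ forall j, G j = ck_map G j.
Proof.
exists L; split; last first.
  move=> j; apply/funext => al.
  rewrite -(@ck_map_local (U (d al).+1) L (d al).+1) => [|i be bN|].
  - by rewrite -(U_L j (n := (d al).+2)).
  - exact: U_L.
  - by [].
have bound (A : {fset midx}) : exists n, forall al, al \in A -> (d al < n)%N.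
  exists (\max_(al <- A) d al).+1 => al aA; rewrite ltnS.
  by apply: leq_bigmax_seq.
move=> j; split=> A; have [n hn] := bound A.
  rewrite big_seq; under eq_bigr => al aA do rewrite -(U_L j (hn _ aA)).
  by rewrite -big_seq; exact: (U_ball n j).1.
rewrite big_seq; under eq_bigr => al aA.
  rewrite /deriv_ps -(U_L j (n := n.+1)); first over.
  rewrite dD (_ : d (unit_idx ix) = 1%N); first by rewrite addn1 ltnS hn.
  by rewrite /d !ffunE.
by rewrite -big_seq; exact: (U_ball n.+1 j).2.
Qed.

End fixed_point.
End cauchy_kovalevskaya.

(** * From the fixed point to an analytic disc *)

Section holomorphic_extension.
Variable R : realType.

Lemma uniform_ps_on k (T : finType) (F : T -> 'rV[R]_k -> R) a :
  (forall t, analytic_at (F t) a) -> exists c r C, [/\ 0 < r, 0 <= C &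
    forall t, ps_on (F t) a (c t) r /\ abs_bounded (fun al => c t al * r ^+ deg al) C].
Proof.
move=> Fa.
have /choice[cr crP] : forall t, exists cr : ({ffun 'I_k -> nat} -> R) * R,
    ps_on (F t) a cr.1 cr.2.
  by move=> t; have /analytic_atP[c [rho h]] := Fa t; exists (c, rho).
have r0 t : 0 < (cr t).2 by case: (crP t).
have [r rgt0 rle] : exists2 r, 0 < r & forall t, r <= (cr t).2.
  have [r r_gt0 rP] := @finite_pos_lower_bound R #|T| (fun j => (cr (enum_val j)).2) (fun j => r0 _).
  by exists r => // t; have := rP (enum_rank t); rewrite enum_rankK.
have crP' t : ps_on (F t) a (cr t).1 r by apply: ps_on_shrink (crP t); rewrite rgt0 rle.
have /choice[C CP] : forall t, exists C,
    abs_bounded (fun al => (cr t).1 al * r ^+ deg al) C by move=> t; case: (crP' t) => _ [M hM] _; exists M.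
exists (fun t => (cr t).1), r, (\sum_t C t).
have C0 t : 0 <= C t by exact: abs_bounded_ge0 (CP t).
split=> //; first exact: sumr_ge0.
move=> t; split=> //; apply: abs_boundedW (CP t).
by rewrite (bigD1 t)//= lerDl sumr_ge0.
Qed.

Theorem cauchy_kovalevskaya m (X : 'rV[R]_m -> 'rV[R]_m) (J : 'rV[R]_m -> 'M[R]_m) p :
  analytic_field_at X p -> (forall i j, analytic_at (fun z => J z i j) p) ->
  exists gam : 'rV[R]_2 -> 'rV[R]_m,
  [/\ gam 0 = p, forall j, analytic_at (fun z => gam z 0 j) 0,
      forall j, \forall z \near (0 : 'rV[R]_2),
        pd iy (fun z => gam z 0 j) z =
        \sum_l pd ix (fun z => gam z 0 l) z * J (gam z) l j &
      forall j, \forall z \near (0 : 'rV[R]_2), (z : 'rV[R]_2) 0 iy = 0 ->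
        pd ix (fun z => gam z 0 j) z = X (gam z) 0 j].
Proof.
move=> Xa Ja.
(* The coordinates of [X] and the entries of [J] form one finite family, to obtain a common radius
   and a common bound. *)
pose F (t : 'I_m + 'I_m * 'I_m) (z : 'rV[R]_m) : R :=
  match t with inl j => X z 0 j | inr lj => J z lj.1 lj.2 end.
have Fa t : analytic_at (F t) p by case: t => [j|[l j]]; [exact: Xa|exact: Ja].
have [c [r [C [r0 C0 cP]]]] := uniform_ps_on Fa.
pose cX j := c (inl j); pose cJ l j := c (inr (l, j)).
have cXb j : abs_bounded (fun mu => cX j mu * r ^+ deg mu) C := (cP (inl j)).2.
have cJb l j : abs_bounded (fun mu => cJ l j mu * r ^+ deg mu) C := (cP (inr (l, j))).2.
have [G [Gb GE]] := ck_fixed_point r0 cXb cJb.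
set rho := ck_rho m r C C in Gb; set dl := ck_dl m C C in Gb.
have B0 : 0 <= m%:R * ((C + 1) * C) by rewrite !mulr_ge0// addr_ge0.
have dl0 : 0 < dl by rewrite /dl /ck_dl invr_gt0 ltr_wpDl.
have dl1 : dl <= 1 by rewrite /dl /ck_dl invf_le1 ?ltr_wpDl// lerDr.
have rho0 : 0 < rho by rewrite /rho /ck_rho divr_gt0// ltr_wpDl// addr_ge0.
pose w := ck_weight rho dl.
have w_gt0 := ck_weight_gt0 rho0 dl0; have w0 := ck_weight0 rho dl.
have wM := ck_weightM rho0 dl0.
pose tau := rho * dl / 2.
have tau0 : 0 < tau by rewrite /tau divr_gt0// mulr_gt0.
have wtau u A : wbounded w u A -> abs_bounded (fun al => u al * tau ^+ deg al) A.
  apply: abs_bounded_ler => al; rewrite !normrM ler_wpM2l//.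
  rewrite !ger0_norm ?(ltW (w_gt0 al)) ?exprn_ge0 ?(ltW tau0)//.
  exact: ck_weight_ge.
pose gam (z : 'rV[R]_2) : 'rV[R]_m := p + \row_j ev (G j) (fun i => z 0 i).
have gamE z j : gam z 0 j = p 0 j + ev (G j) (fun i => z 0 i) by rewrite !mxE.
have Gps j : ps_on (fun z : 'rV[R]_2 => ev (G j) (fun i => z 0 i)) 0 (G j) tau.
  split=> //; first by exists r; apply: wtau; exact: (Gb j).1.
  by move=> z _; congr ev; apply/funext => i; rewrite mxE subr0.
have /choice[t tP] : forall j, exists t, 0 < t /\ ps_on (fun z => gam z 0 j) 0
    (fun al => p 0 j * one_ps R al + G j al) t.
  move=> j; have [t [h1 h2]] := ps_on_min (ps_on_cst (p 0 j) 0) (Gps j).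
  have h := ps_onD h1 h2; exists t; split; first by case: h.
  case: h => t0 hC hE; split=> // z zt; rewrite gamE; exact: hE.
have [s s0 sle] := finite_pos_lower_bound (fun j => (tP j).1).
have dG i j : deriv_ps i (fun al => p 0 j * one_ps R al + G j al) = deriv_ps i (G j).
  apply/funext => al; rewrite /deriv_ps /one_ps midx_add_eq0 unit_idx_neq0 andbF.
  by rewrite mulr0 add0r.
(* Differentiated series represent derivatives on half the radius, hence [s / 2]; below [tau] the
   monomials are dominated by the weight. *)
pose e := Num.min (s / 2) tau.
have e0 : 0 < e by rewrite lt_min tau0 divr_gt0.
have pdE i j (z : 'rV[R]_2) : `|z - 0| <= e ->
    pd i (fun z => gam z 0 j) z = ev (deriv_ps i (G j)) (fun i => z 0 i).
  move=> ze; have := ps_on_pd i (tP j).2; rewrite dG => -[_ _ ->].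
    by congr ev; apply/funext => l; rewrite mxE subr0.
  apply: le_trans ze _; rewrite ge_min; apply/orP; left.
  by rewrite ler_wpM2r// invr_ge0.
have xw (z : 'rV[R]_2) : `|z - 0| <= e -> forall al, `|mon (fun i => z 0 i) al| <= w al.
  move=> ze al; apply: le_trans (ck_weight_ge rho0 dl0 dl1 al).
  apply: normr_mon_le => i; rewrite -[z](subr0 z).
  apply: le_trans (ler_coord_norm _ _) (le_trans ze _).
  by rewrite ge_min lexx orbT.
have to_mon mu : abs_bounded (fun al => c mu al * mon (fun=> r) al) C.
  by apply: abs_bounded_ler (cP mu).2 => al; rewrite mon_cst.
have compE mu (z : 'rV[R]_2) : `|z - 0| <= e -> ev (comp_ps (c mu) G) (fun i => z 0 i) = F mu (gam z).
  move=> ze; have xz := xw z ze; have Gr j := (Gb j).1.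
  rewrite (ev_comp w_gt0 w0 wM Gr (to_mon mu) xz).
  case: (cP mu) => -[_ _ ->]; last first.
    apply: ler_norm_coord => [|j]; first exact: ltW.
    by rewrite coordB gamE addrAC subrr add0r; exact: (normr_ev w_gt0 xz (Gr j)).
  by move=> _; congr ev; apply/funext => j; rewrite gamE addrAC subrr add0r.
have cb mu : wbounded w (comp_ps (c mu) G) C.
  exact: (wbounded_comp w_gt0 w0 wM (fun j => (Gb j).1) (to_mon mu)).
exists gam; split.
- apply/rowP => j; rewrite gamE.
  have -> : (fun i => (0 : 'rV[R]_2) 0 i) = (fun=> 0 : R) by apply/funext => i; rewrite mxE.
  by rewrite ev0 GE /ck_map /integ_ps !midx0 !eqxx !addr0.
- by move=> j; apply/analytic_atP; do 2!eexists; exact: (tP j).2.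
- move=> j; apply/near_normP; exists e => // z ze.
  have dy : deriv_ps iy (G j) = ck_rhs cJ G j.
    apply/funext => al; rewrite {1}GE /deriv_ps /ck_map mulrDr integ_ps_unit.
    rewrite mulrCA divff ?pnatr_eq0// mulr1 [X in X + _](_ : _ = 0) ?add0r//.
    (* The x-integral of the initial data carries no power of y, so it does not contribute to the
       y-derivative. *)
    rewrite /integ_ps; case: ifP => _; rewrite ?mulr0//.
    rewrite /initial_ps (_ : (pred_idx ix (al + unit_idx iy) iy == 0%N) = false).
      by rewrite mul0r mulr0.
    by rewrite ffunE midxD ffunE eqxx /= addn1 subn0.
  rewrite (pdE _ _ _ ze) dy /ck_rhs.
  rewrite (ev_sum w_gt0 (xw z ze) _ (fun l => wbounded_mul w_gt0 wM (Gb l).2 (cb (inr (l, j))))).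
  apply: eq_bigr => l _; rewrite (ev_mul w_gt0 wM (xw z ze) (Gb l).2 (cb (inr (l, j)))).
  by rewrite compE// (pdE _ _ _ ze).
move=> j; apply/near_normP; exists e => // z ze zy.
rewrite (pdE _ _ _ ze) -[RHS](compE (inl j) _ ze) GE deriv_ck_map.
apply: eq_tsum => al; rewrite /initial_ps; have [ay|ay] := eqVneq (al iy) 0%N.
  by rewrite /deriv_ps /integ_ps midxD ay !ffunE /= mulr0 addr0.
suff -> : mon (fun i => z 0 i) al = 0 by rewrite !mulr0.
by rewrite /mon (bigD1 iy)//= zy expr0n (negPf ay) mul0r.
Qed.

End holomorphic_extension.

(** * Vector fields *)

Section vector_calculus.
Variables (R : realType) (k : nat).
Implicit Types (f g : 'rV[R]_k -> R) (X Y Z : 'rV[R]_k -> 'rV[R]_k) (z v a : 'rV[R]_k).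

Lemma analytic_map_differentiable m (Y : 'rV[R]_k -> 'rV[R]_m) z :
  (forall j, analytic_at (fun z => Y z 0 j) z) -> differentiable Y z.
Proof.
move=> Ya.
have -> : Y = \sum_(j < m) (fun z => Y z 0 j *: delta_mx 0 j).
  by apply/funext => y; rewrite fct_sumE [LHS]row_sum_delta.
apply: differentiable_sum => j; apply: differentiableZl.
exact: analytic_differentiable.
Qed.

Lemma diff_map_coord m (Y : 'rV[R]_k -> 'rV[R]_m) z v j :
  (forall j, analytic_at (fun z => Y z 0 j) z) ->
  ('d Y z v : 'rV[R]_m) 0 j = 'd (fun z => Y z 0 j) z v.
Proof.
move=> Ya; have dY := analytic_map_differentiable Ya.
rewrite -!deriveE//; last exact: analytic_differentiable.
by rewrite derive_mx ?mxE//; exact: diff_derivable.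
Qed.

Lemma near_forall (T : finType) (P : T -> 'rV[R]_k -> Prop) a :
  (forall t, \forall z \near a, P t z) -> \forall z \near a, forall t, P t z.
Proof. exact: (@filter_forall _ _ _ _ (nbhs_filter a)). Qed.

Lemma analytic_field_near X a : analytic_field_at X a ->
  \forall z \near a, analytic_field_at X z.
Proof.
move=> Xa; exact: near_forall (fun j => analytic_at_near (Xa j)).
Qed.

Definition act X f z : R := 'd f z (X z).

Lemma actE X f z : analytic_at f z -> act X f z = \sum_i X z 0 i * pd i f z.
Proof. exact: diff_pd. Qed.

Lemma analytic_act X f a : analytic_field_at X a -> analytic_at f a ->
  analytic_at (act X f) a.
Proof.
move=> Xa fa; apply: (@analytic_near_eq _ _ (fun z => \sum_i X z 0 i * pd i f z)).
  by apply: filterS (analytic_at_near fa) => z fz; rewrite actE.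
by apply: analytic_sum => i; apply: analyticM => //; exact: analytic_pd.
Qed.

Lemma diffD_an f g z v : analytic_at f z -> analytic_at g z ->
  'd (fun z => f z + g z) z v = 'd f z v + 'd g z v.
Proof.
move=> /analytic_differentiable fa /analytic_differentiable ga.
by rewrite -[fun z => _]/(f + g) diffD.
Qed.

Lemma diffB_an f g z v : analytic_at f z -> analytic_at g z ->
  'd (fun z => f z - g z) z v = 'd f z v - 'd g z v.
Proof.
move=> /analytic_differentiable fa /analytic_differentiable ga.
by rewrite -[fun z => _]/(f - g) diffB.
Qed.

Lemma diffM_an f g z v : analytic_at f z -> analytic_at g z ->
  'd (fun z => f z * g z) z v = 'd f z v * g z + f z * 'd g z v.
Proof.
move=> /analytic_differentiable fa /analytic_differentiable ga.
have [df dg] := (differentiableP fa, differentiableP ga).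
have h := is_diffM df dg; have e := @diff_val _ _ _ _ _ _ _ h.
have := congr1 (fun F => F v) e; rewrite /= => e'.
apply: etrans e' _; transitivity (f z * 'd g z v + g z * 'd f z v); first by [].
by rewrite addrC [g z * _]mulrC.
Qed.

Lemma diff_cst_an (r : R) z v : 'd (fun _ : 'rV[R]_k => r) z v = 0.
Proof. by rewrite -[fun=> r]/(cst r) diff_cst. Qed.

Lemma diff_sum_an (T : Type) (s : seq T) (F : T -> 'rV[R]_k -> R) z v :
  (forall t, analytic_at (F t) z) ->
  'd (fun z => \sum_(t <- s) F t z) z v = \sum_(t <- s) 'd (F t) z v.
Proof.
move=> Fa; elim: s => [|t s IH].
  rewrite big_nil -[RHS](diff_cst_an 0 z v); congr ('d _ z v); apply/funext => y.
  by rewrite big_nil.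
rewrite big_cons -IH -(diffD_an v (Fa t) (analytic_sum s Fa)).
by congr ('d _ z v); apply/funext => y; rewrite big_cons.
Qed.

Lemma lie_bracketE X Y z j : analytic_field_at X z -> analytic_field_at Y z ->
  lie_bracket X Y z 0 j = act X (fun z => Y z 0 j) z - act Y (fun z => X z 0 j) z.
Proof.
by move=> Xa Ya; rewrite /lie_bracket !mxE (diff_map_coord _ j Ya) (diff_map_coord _ j Xa).
Qed.

Lemma analytic_bracket X Y a : analytic_field_at X a -> analytic_field_at Y a ->
  analytic_field_at (lie_bracket X Y) a.
Proof.
move=> Xa Ya j; apply: (@analytic_near_eq _ _
    (fun z => act X (fun z => Y z 0 j) z - act Y (fun z => X z 0 j) z)).
  apply: filterS2 (analytic_field_near Xa) (analytic_field_near Ya) => z Xz Yz.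
  by rewrite lie_bracketE.
by apply: analyticB; exact: analytic_act.
Qed.

Lemma act_near_eq X f g z : (\forall y \near z, f y = g y) -> analytic_at f z ->
  act X f z = act X g z.
Proof. exact: diff_near_eq. Qed.

Lemma act_act X Y f z : analytic_field_at X z -> analytic_field_at Y z ->
  analytic_at f z -> act X (act Y f) z =
  \sum_j act X (fun z => Y z 0 j) z * pd j f z +
  \sum_j \sum_i Y z 0 j * (X z 0 i * pd i (pd j f) z).
Proof.
move=> Xa Ya fa.
have pa j : analytic_at (fun z => Y z 0 j * pd j f z) z.
  by apply: analyticM => //; exact: analytic_pd.
rewrite -(@act_near_eq X (fun z => \sum_j Y z 0 j * pd j f z)).
- have h := diff_sum_an (index_enum 'I_k) (X z) pa.
  rewrite [LHS]h -big_split; apply: eq_bigr => j _.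
  have hM := diffM_an (X z) (Ya j) (analytic_pd j fa).
  rewrite [LHS]hM; congr (_ + _).
  by rewrite (diff_pd _ (analytic_pd j fa)) mulr_sumr.
- by apply: filterS (analytic_at_near fa) => y fy; rewrite actE.
- exact: analytic_sum.
Qed.

(** The second order parts cancel by symmetry of second derivatives; the first order parts are the
    coordinates of the bracket. *)
Lemma act_bracket X Y f z : analytic_field_at X z -> analytic_field_at Y z ->
  analytic_at f z ->
  act (lie_bracket X Y) f z = act X (act Y f) z - act Y (act X f) z.
Proof.
move=> Xa Ya fa; rewrite !act_act// actE//.
have -> : \sum_j \sum_i Y z 0 j * (X z 0 i * pd i (pd j f) z) =
    \sum_j \sum_i X z 0 j * (Y z 0 i * pd i (pd j f) z).
  rewrite exchange_big; apply: eq_bigr => j _; apply: eq_bigr => i _ /=.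
  by rewrite (pdC j i fa); ring.
rewrite opprD addrACA subrr addr0 -sumrB; apply: eq_bigr => j _.
by rewrite lie_bracketE// mulrBl.
Qed.

Lemma lie_bracketDl X1 X2 Y z : analytic_field_at X1 z -> analytic_field_at X2 z ->
  analytic_field_at Y z ->
  lie_bracket (fun z => X1 z + X2 z) Y z = lie_bracket X1 Y z + lie_bracket X2 Y z.
Proof.
move=> /analytic_map_differentiable a1 /analytic_map_differentiable a2 aY.
have e : 'd (fun z => X1 z + X2 z) z (Y z) = 'd X1 z (Y z) + 'd X2 z (Y z).
  exact: (congr1 (fun F => F (Y z)) (diffD a1 a2)).
have eY : 'd Y z (X1 z + X2 z) = 'd Y z (X1 z) + 'd Y z (X2 z) by exact: linearD.
apply: etrans (congr2 (fun u v : 'rV[R]_k => u - v) eY e) _.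
by rewrite opprD addrACA.
Qed.

Lemma lie_bracketZl (r : R) X Y z : analytic_field_at X z -> analytic_field_at Y z ->
  lie_bracket (fun z => r *: X z) Y z = r *: lie_bracket X Y z.
Proof.
move=> /analytic_map_differentiable aX aY.
have e : 'd (fun z => r *: X z) z (Y z) = r *: 'd X z (Y z).
  exact: (congr1 (fun F => F (Y z)) (diffZ r aX)).
have eY : 'd Y z (r *: X z) = r *: 'd Y z (X z) by exact: linearZ.
apply: etrans (congr2 (fun u v : 'rV[R]_k => u - v) eY e) _.
by rewrite -scalerBr.
Qed.

Local Opaque lie_bracket.

(** On each coordinate function both sides expand into iterated derivations, by [act_bracket] and
    its coordinate form [key]; six such terms remain and match formally. *)
Lemma jacobi X1 X2 Y z : analytic_field_at X1 z -> analytic_field_at X2 z ->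
  analytic_field_at Y z ->
  lie_bracket (lie_bracket X1 X2) Y z =
  lie_bracket X1 (lie_bracket X2 Y) z - lie_bracket X2 (lie_bracket X1 Y) z.
Proof.
move=> a1 a2 aY; apply/rowP => j.
have key U V W : analytic_field_at U z -> analytic_field_at V z -> analytic_field_at W z ->
    act U (fun y => lie_bracket V W y 0 j) z =
    act U (act V (fun y => W y 0 j)) z - act U (act W (fun y => V y 0 j)) z.
  move=> aU aV aW.
  have aa : analytic_at (act V (fun y => W y 0 j)) z by exact: analytic_act.
  have ab : analytic_at (act W (fun y => V y 0 j)) z by exact: analytic_act.
  rewrite -(@act_near_eq U
    (fun y => act V (fun y => W y 0 j) y - act W (fun y => V y 0 j) y)).
  - exact: (diffB_an (U z) aa ab).
  - apply: filterS2 (analytic_field_near aV) (analytic_field_near aW) => y Vy Wy.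
    by rewrite lie_bracketE.
  - exact: analyticB.
have a12 := analytic_bracket a1 a2.
have a1Y := analytic_bracket a1 aY; have a2Y := analytic_bracket a2 aY.
pose sub (u v : R) := u - v.
apply: (etrans (lie_bracketE j a12 aY)).
apply: (etrans (congr2 sub (act_bracket a1 a2 (aY j)) (key _ _ _ aY a1 a2))).
apply: esym; apply: (etrans (coordB _ _ j)).
apply: (etrans (congr2 sub (lie_bracketE j a1 a2Y) (lie_bracketE j a2 a1Y))).
apply: (etrans (congr2 sub
  (congr2 sub (key _ _ _ a1 a2 aY) (act_bracket a2 aY (a1 j)))
  (congr2 sub (key _ _ _ a2 a1 aY) (act_bracket a1 aY (a2 j))))).
rewrite /sub; move: (act X1 (act X2 _) z) (act X2 (act X1 _) z) (act Y (act X1 _) z).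
move: (act Y (act X2 _) z) (act X1 (act Y _) z) (act X2 (act Y _) z) => *.
by ring.
Qed.

Lemma analytic_mulJ (J : 'rV[R]_k -> 'M[R]_k) X a :
  (forall i j, analytic_at (fun z => J z i j) a) -> analytic_field_at X a ->
  analytic_field_at (mulJ J X) a.
Proof.
move=> Ja Xa j; apply: (@analytic_near_eq _ _ (fun z => \sum_l X z 0 l * J z l j)).
  by apply: near_all => z; rewrite /mulJ mxE.
by apply: analytic_sum => l; apply: analyticM.
Qed.

End vector_calculus.

(** * Fields in the kernel of the Levi form *)

Lemma differentiable_approx (R : realType) (V W : normedModType R) (f : V -> W) a :
  differentiable f a -> forall e : R, 0 < e -> \forall v \near (0 : V),
    `|f (v + a) - (f a + 'd f a v)| <= e * `|v|.
Proof. by move=> /diff_locallyP[_ /eqaddoP fa] e e0; exact: fa. Qed.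

Section levi_kernel_fields.
Variables (R : realType) (m : nat) (phi : 'rV[R]_m -> R) (J : 'rV[R]_m -> 'M[R]_m).
Implicit Types (X Y Z : 'rV[R]_m -> 'rV[R]_m) (p q z v w : 'rV[R]_m) (f : 'rV[R]_m -> R).
Hypothesis phi_an : forall a, analytic_at phi a.
Hypothesis phi_reg : forall z, hypersurface phi z -> exists v, 'd phi z v != 0.
Hypothesis J_an : forall i j a, analytic_at (fun z => J z i j) a.
Hypothesis JJ : forall z, J z *m J z = - 1%:M.
Hypothesis J_int : integrable_structure J.
Local Notation M := (hypersurface phi).

Lemma diff_vD f q v w : 'd f q (v + w) = 'd f q v + 'd f q w.
Proof. exact: linearD. Qed.

Lemma diff_vN f q v : 'd f q (- v) = - 'd f q v.
Proof. exact: linearN. Qed.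

Lemma diff_vZ f q (r : R) v : 'd f q (r *: v) = r * 'd f q v.
Proof. exact: linearZ. Qed.

(* The intermediate value theorem, applied to phi in a transverse direction,
   gives points of M at distance o(t) from q + t v. *)
Lemma tangent_diff_eq0 f q v : M q -> differentiable f q ->
  (\forall z \near q, M z -> f z = 0) -> 'd phi q v = 0 -> 'd f q v = 0.
Proof.
move=> Mq df fM dv.
have [u u0] := phi_reg Mq; pose e := ('d phi q u)^-1 *: u.
have de : 'd phi q e = 1 by rewrite /e diff_vZ mulVf.
clearbody e.
set A := 'd f q v; set C := `|'d f q e|; pose n := `|v| + `|e| + 1.
have n0 : 0 < n by rewrite /n ltr_wpDl// addr_ge0.
have C0 : 0 <= C by exact: normr_ge0.
have phiq : phi q = 0 := Mq.
have fq : f q = 0 by exact: (nbhs_singleton fM).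
suff key (ep : R) : 0 < ep <= 1 -> `|A| <= ep * (C + 1).
  apply/eqP/negPn/negP => A0; have A0' : 0 < `|A| by rewrite normr_gt0.
  have C1 : 0 < C + 1 by rewrite ltr_wpDl.
  have /key : 0 < Num.min 1 (`|A| / (2 * (C + 1))) <= 1.
    by rewrite lt_min ltr01 divr_gt0 ?mulr_gt0// ge_min lexx.
  have : Num.min 1 (`|A| / (2 * (C + 1))) * (C + 1) <= `|A| / 2.
    apply: (@le_trans _ _ (`|A| / (2 * (C + 1)) * (C + 1))).
      by rewrite ler_wpM2r ?(ltW C1)// ge_min lexx orbT.
    by rewrite le_eqVlt; apply/orP; left; apply/eqP; field; rewrite gt_eqF.
  by lra.
(* For [|s| <= ep * t] the displacement t v + s e has norm at most [t * n]. With this [eta] the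
   linearization errors of [phi] and [f] on it are at most [eta * (t * n)], that is ep t / 2. *)
move=> /andP[ep0 ep1]; pose eta := ep / (2 * n).
have eta0 : 0 < eta by rewrite divr_gt0// mulr_gt0.
have [d1 d10 H1] := (near_normP _ _).1
  (differentiable_approx (analytic_differentiable (phi_an q)) eta0).
have [d2 d20 H2] := (near_normP _ _).1 (differentiable_approx df eta0).
have [d3 d30 H3] := (near_normP _ _).1 fM.
pose t := Num.min d1 (Num.min d2 d3) / n.
have t0 : 0 < t by rewrite divr_gt0// !lt_min d10 d20.
have tn : t * n = Num.min d1 (Num.min d2 d3) by rewrite divfK// gt_eqF.
have small s : `|s| <= ep * t -> `|t *: v + s *: e| <= t * n.
  move=> st; apply: le_trans (ler_normD _ _) _; have -> : `|t *: v| = t * `|v| by rewrite normrZ gtr0_norm.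
  have -> : `|s *: e| = `|s| * `|e| by rewrite normrZ.
  have st' : `|s| <= t by apply: (le_trans st); rewrite ger_pMl.
  rewrite /n !mulrDr mulr1 -addrA lerD2l.
  apply: le_trans (ler_wpM2r (normr_ge0 e) st') _.
  by rewrite lerDl ltW.
have etn : eta * (t * n) = ep * t / 2 by rewrite /eta; field; rewrite gt_eqF.
(* As d phi vanishes on v and is 1 on e, [psi s] is within ep t / 2 of [s]; it therefore changes
   sign between -ep t and ep t. *)
pose psi (s : R) := phi ((t *: v + s *: e) + q).
have psis s : `|s| <= ep * t -> `|psi s - s| <= ep * t / 2.
  move=> st; have := small s st; rewrite tn !le_min => /andP[h1 _].
  have := H1 (t *: v + s *: e); rewrite subr0 => /(_ h1).
  rewrite phiq add0r diff_vD !diff_vZ dv mulr0 add0r de mulr1 => h.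
  by apply: (le_trans h); rewrite -etn ler_wpM2l ?(ltW eta0)// small.
have ept : 0 < ep * t by rewrite mulr_gt0.
have psic : continuous psi.
  move=> s; apply: (@continuous_comp _ _ _ (fun s : R => (t *: v + s *: e) + q) phi).
    apply: cvgD; last exact: cvg_cst.
    apply: cvgD; first exact: cvg_cst.
    by apply: cvgZr_tmp; exact: cvg_id.
  exact/differentiable_continuous/analytic_differentiable.
have [s] : exists2 s, s \in `[- (ep * t), ep * t] & psi s = 0.
  apply: IVT; first by lra.
    exact: continuous_subspaceT.
  have := psis (ep * t); have := psis (- (ep * t)).
  rewrite normrN gtr0_norm// lexx => /(_ isT) h1 /(_ isT) h2.
  rewrite !ler_norml in h1 h2.
  by rewrite ge_min le_max; apply/andP; split; apply/orP; [left|right]; lra.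
rewrite in_itv /= -ler_norml => st psi0.
have := small s st; rewrite tn !le_min => /and3P[_ h2 h3].
have fz : f ((t *: v + s *: e) + q) = 0 by apply: H3 => //; rewrite addrK.
have := H2 (t *: v + s *: e); rewrite subr0 => /(_ h2).
rewrite fz fq !add0r normrN diff_vD !diff_vZ -/A => h.
have h' : `|t * A + s * 'd f q e| <= ep * t / 2.
  by apply: (le_trans h); rewrite -etn ler_wpM2l ?(ltW eta0)// small.
have sC : `|s * 'd f q e| <= ep * t * C by rewrite normrM ler_wpM2r.
have tA : t * `|A| <= ep * t / 2 + ep * t * C.
  rewrite -(gtr0_norm t0) -normrM -[t * A](addrK (s * 'd f q e)).
  apply: le_trans (ler_normB _ _) _; rewrite (gtr0_norm t0); exact: lerD.
rewrite -(ler_pM2l t0); apply: (le_trans tA); nra.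
Qed.

Definition tangentJ q v := 'd phi q v = 0 /\ 'd phi q (v *m J q) = 0.

Lemma mulJJ q v : v *m J q *m J q = - v.
Proof. by rewrite -mulmxA JJ mulmxN mulmx1. Qed.

Lemma J_tangent_spaceP q v : J_tangent_space phi J q v <-> tangentJ q v.
Proof.
split=> [[v0 [u u0 uv]]|[v0 v1]].
  have {}u0 : 'd phi q u = 0 := u0.
  by split; [exact: v0|rewrite -uv mulJJ diff_vN u0 oppr0].
split=> //; exists (- (v *m J q)); first by rewrite /tangent_space /= diff_vN v1 oppr0.
by rewrite mulNmx mulJJ opprK.
Qed.

Lemma tangentJ_mulJ q v : tangentJ q v -> tangentJ q (v *m J q).
Proof. by move=> [v0 v1]; split=> //; rewrite mulJJ diff_vN v0 oppr0. Qed.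

Lemma tangentJD q v w : tangentJ q v -> tangentJ q w -> tangentJ q (v + w).
Proof.
by move=> [v0 v1] [w0 w1]; split; rewrite ?mulmxDl diff_vD ?v0 ?v1 ?w0 ?w1 addr0.
Qed.

Lemma tangentJZ q (r : R) v : tangentJ q v -> tangentJ q (r *: v).
Proof. by move=> [v0 v1]; split; rewrite -?scalemxAl diff_vZ ?v0 ?v1 mulr0. Qed.

Lemma tangentJB q v w : tangentJ q v -> tangentJ q w -> tangentJ q (v - w).
Proof. by move=> v0 w0; rewrite -scaleN1r; apply: tangentJD => //; exact: tangentJZ. Qed.

Local Notation section := (J_tangent_section phi J).

Lemma sectionP q Y : section q Y <-> analytic_field_at Y q /\
  \forall z \near q, M z -> tangentJ z (Y z).
Proof.
split=> [[Ya YT]|[Ya YT]]; split.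
- exact: nbhs_singleton Ya.
- by apply: filterS YT => z h Mz; apply/J_tangent_spaceP/h.
- exact: analytic_field_near.
- by apply: filterS YT => z h Mz; apply/J_tangent_spaceP/h.
Qed.

Lemma section_near q Y : section q Y -> \forall z \near q, section z Y.
Proof.
move=> [/near_join Ya /near_join YT].
by apply: filterS2 Ya YT => z Yz Tz; split.
Qed.

Lemma section_mulJ q Y : section q Y -> section q (mulJ J Y).
Proof.
move=> /sectionP[Ya YT]; apply/sectionP; split; first exact: analytic_mulJ.
by apply: filterS YT => z h Mz; apply: tangentJ_mulJ; exact: h.
Qed.

Lemma sectionD q X Y : section q X -> section q Y -> section q (fun z => X z + Y z).
Proof.
move=> /sectionP[Xa XT] /sectionP[Ya YT]; apply/sectionP; split.
  move=> j; apply: analytic_near_eq (analyticD (Xa j) (Ya j)).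
  by apply: near_all => z; rewrite mxE.
by apply: filterS2 XT YT => z h1 h2 Mz; apply: tangentJD; [exact: h1|exact: h2].
Qed.

Lemma sectionZ q (r : R) X : section q X -> section q (fun z => r *: X z).
Proof.
move=> /sectionP[Xa XT]; apply/sectionP; split.
  move=> j; apply: analytic_near_eq (analyticZ r (Xa j)).
  by apply: near_all => z; rewrite mxE.
by apply: filterS XT => z h1 Mz; apply: tangentJZ; exact: h1.
Qed.

Lemma act_vanishes Y f q : section q Y -> analytic_at f q ->
  (\forall z \near q, M z -> f z = 0) -> \forall z \near q, M z -> act Y f z = 0.
Proof.
move=> /sectionP[_ YT] fa /near_join fM.
apply: filterS3 YT (analytic_at_near fa) fM => z YTz fz fMz Mz.
by apply: tangent_diff_eq0 fMz _ => //; [exact: analytic_differentiable|case: (YTz Mz)].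
Qed.

Lemma act_phi Y q : section q Y -> \forall z \near q, M z -> act Y phi z = 0.
Proof. by move=> Ys; apply: act_vanishes => //; apply: near_all. Qed.

(** X phi and Y phi vanish on M, hence so do Y (X phi) and X (Y phi), and d phi of the bracket is
    their difference. *)
Lemma bracket_tangent X Y q : M q -> section q X -> section q Y ->
  'd phi q (lie_bracket X Y q) = 0.
Proof.
move=> Mq sX sY; have [aX _] := (sectionP q X).1 sX; have [aY _] := (sectionP q Y).1 sY.
have hX := nbhs_singleton (act_vanishes sX (analytic_act aY (phi_an q)) (act_phi sY)) Mq.
have hY := nbhs_singleton (act_vanishes sY (analytic_act aX (phi_an q)) (act_phi sX)) Mq.
apply: (etrans (act_bracket aX aY (phi_an q))).
by rewrite hX hY subr0.
Qed.

Local Opaque lie_bracket.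

Lemma nijenhuis_eq0 X Y q : analytic_field_at X q -> analytic_field_at Y q ->
  lie_bracket (mulJ J X) (mulJ J Y) q = lie_bracket X Y q +
  (lie_bracket (mulJ J X) Y q + lie_bracket X (mulJ J Y) q) *m J q.
Proof.
move=> /analytic_field_near Xa /analytic_field_near Ya.
have := J_int Xa Ya; rewrite /nijenhuis.
move: (lie_bracket (mulJ J X) (mulJ J Y) q) (lie_bracket (mulJ J X) Y q) => a b.
move: (lie_bracket X (mulJ J Y) q) (lie_bracket X Y q) => c d /eqP.
rewrite subr_eq0 => /eqP <-; rewrite mulmxDl.
by apply/rowP => j; rewrite !mxE; ring.
Qed.

(** The set K, localized at [p]. The test sections [Y] are germs at each nearby [q]: the condition
    is then open in [p], and it applies to fields that are sections only near [q], such as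
    brackets. *)
Definition levi_field p Z := section p Z /\
  \forall q \near p, M q -> forall Y, section q Y -> tangentJ q (lie_bracket Z Y q).

(** In [nijenhuis_eq0] both [J Z, J Y] and [Z, Y] are tangent to M, so d phi kills J([J Z, Y] +
    [Z, J Y]); the hypothesis disposes of the second summand. *)
Lemma tangentJ_bracket_mulJ q Z Y : M q -> section q Z -> section q Y ->
  tangentJ q (lie_bracket Z (mulJ J Y) q) -> tangentJ q (lie_bracket (mulJ J Z) Y q).
Proof.
move=> Mq sZ sY [_ c2].
have sJZ := section_mulJ sZ; have sJY := section_mulJ sY.
split; first exact: bracket_tangent.
have [aZ _] := (sectionP q Z).1 sZ; have [aY _] := (sectionP q Y).1 sY.
have := congr1 ('d phi q) (nijenhuis_eq0 aZ aY).
rewrite bracket_tangent// diff_vD bracket_tangent// add0r mulmxDl diff_vD c2 addr0.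
by [].
Qed.

Lemma levi_field_mulJ p Z : levi_field p Z -> levi_field p (mulJ J Z).
Proof.
move=> [sZ HZ]; split; first exact: section_mulJ.
apply: filterS2 HZ (section_near sZ) => q HZ sZq Mq Y sY.
apply: tangentJ_bracket_mulJ => //; apply: HZ => //; exact: section_mulJ.
Qed.

Lemma levi_fieldD p Z1 Z2 : levi_field p Z1 -> levi_field p Z2 ->
  levi_field p (fun z => Z1 z + Z2 z).
Proof.
move=> [s1 H1] [s2 H2]; split; first exact: sectionD.
have n1 := section_near s1; have n2 := section_near s2.
apply: filterS2 (filterI H1 H2) (filterI n1 n2) => q [h1 h2] [/sectionP[a1 _] /sectionP[a2 _]].
move=> Mq Y sY; have [aY _] := (sectionP q Y).1 sY.
by rewrite (lie_bracketDl a1 a2 aY); apply: tangentJD; [exact: h1|exact: h2].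
Qed.

Lemma levi_fieldZ p (r : R) Z : levi_field p Z -> levi_field p (fun z => r *: Z z).
Proof.
move=> [s1 H1]; split; first exact: sectionZ.
apply: filterS2 H1 (section_near s1) => q h1 /sectionP[a1 _] Mq Y sY.
have [aY _] := (sectionP q Y).1 sY.
by rewrite (lie_bracketZl r a1 aY); apply: tangentJZ; exact: h1.
Qed.

Lemma section_bracket p Z Y : levi_field p Z -> section p Y ->
  section p (lie_bracket Z Y).
Proof.
move=> [sZ HZ] sY; apply/sectionP; split.
  by apply: analytic_bracket; [case: (sectionP p Z).1|case: (sectionP p Y).1].
by apply: filterS2 HZ (section_near sY) => q h sYq Mq; exact: h.
Qed.

Lemma levi_field_near p Z : levi_field p Z -> \forall q \near p, levi_field q Z.
Proof.
move=> [/section_near sZ /near_join HZ].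
by apply: filterS2 sZ HZ => q sq hq; split.
Qed.

(** In the Jacobi identity the inner brackets [Z_i, Y] are themselves sections near [q], so they may
    be fed back into the conditions on [Z1] and [Z2]. *)
Lemma levi_field_bracket p Z1 Z2 : levi_field p Z1 -> levi_field p Z2 ->
  levi_field p (lie_bracket Z1 Z2).
Proof.
move=> H1 H2; split; first by apply: section_bracket => //; case: H2.
apply: filterS2 (levi_field_near H1) (levi_field_near H2) => q h1 h2 Mq Y sY.
have [a1 _] := (sectionP q Z1).1 h1.1; have [a2 _] := (sectionP q Z2).1 h2.1.
have [aY _] := (sectionP q Y).1 sY.
rewrite (jacobi a1 a2 aY); apply: tangentJB.
  by apply: (nbhs_singleton h1.2) => //; exact: section_bracket.
by apply: (nbhs_singleton h2.2) => //; exact: section_bracket.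
Qed.

Lemma levi_field_sum p n (F : 'I_n -> 'rV[R]_m -> 'rV[R]_m) Z0 : levi_field p Z0 ->
  (forall i, levi_field p (F i)) -> levi_field p (fun z => \sum_i F i z).
Proof.
(* The empty sum needs the zero field in K; it is obtained as 0 times the given [Z0]. *)
move=> H0 HF; have zero : levi_field p (fun=> 0).
  have := levi_fieldZ 0 H0.
  by rewrite (_ : (fun z => 0 *: Z0 z) = (fun=> 0))//; apply/funext => z; rewrite scale0r.
elim: (index_enum _) => [|i s IH].
  by rewrite (_ : (fun z => _) = (fun=> 0))//; apply/funext => z; rewrite big_nil.
have := levi_fieldD (HF i) IH.
by rewrite (_ : (fun z => F i z + _) = (fun z => \sum_(j <- i :: s) F j z))//;
  apply/funext => z; rewrite big_cons.
Qed.

(* On sections the second component of the polar Levi form at (X, Y) is, by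
   integrability and because brackets of sections are tangent to M, twice the
   component of [X, Y] transverse to the J-tangent space. *)
Lemma levi_field_of_kernel X : field_in_levi_kernel phi J X ->
  \forall p \near (0 : 'rV[R]_m), levi_field p X.
Proof.
move=> [/near_join Xa /near_join XK]; apply: filterS2 Xa XK => p Xa XK.
have sX : section p X.
  by split=> //; apply: filterS XK => z h Mz; case: (h Mz).
split=> //; apply: filterS2 (section_near sX) XK => q sXq h Mq Y sY.
have [_ /(_ (Y q))] := h Mq; have [_ YT] := sY.
(* The fields [X] and [Y] themselves serve as the extensions of their values at [q]. *)
move=> /(_ (nbhs_singleton YT Mq) X Y sXq sY erefl erefl) [_].
have [aX _] := (sectionP q X).1 sXq; have [aY _] := (sectionP q Y).1 sY.
have sJX := section_mulJ sXq; have sJY := section_mulJ sY.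
have t1 := bracket_tangent Mq sJX sY; have t2 := bracket_tangent Mq sXq sJY.
have t3 := bracket_tangent Mq sXq sY; rewrite (nijenhuis_eq0 aX aY) => h2.
split=> //; move: t1 t2 t3 h2.
move: (lie_bracket (mulJ J X) Y q) (lie_bracket X (mulJ J Y) q) => u v.
move: (lie_bracket X Y q) => w t1 t2 t3.
rewrite !mulmxDl !mulJJ !diff_vD !diff_vN t1 t2; lra.
Qed.

End levi_kernel_fields.

(** * The disc stays in the hypersurface *)

Lemma near_and (R : realType) k (P Q : 'rV[R]_k -> Prop) (a : 'rV[R]_k) :
  (\forall z \near a, P z) -> (\forall z \near a, Q z) -> \forall z \near a, P z /\ Q z.
Proof. exact: filterI. Qed.

Section chain_rule.
Variables (R : realType) (k m : nat) (gam : 'rV[R]_k -> 'rV[R]_m).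

Lemma pd_comp (f : 'rV[R]_m -> R) i z : analytic_at f (gam z) ->
  (forall j, analytic_at (fun z => gam z 0 j) z) ->
  pd i (fun z => f (gam z)) z = \sum_l pd i (fun z => gam z 0 l) z * pd l f (gam z).
Proof.
move=> fa ga; have dg := analytic_map_differentiable ga.
have e : 'd (fun z => f (gam z)) z (delta_mx 0 i) = 'd f (gam z) ('d gam z (delta_mx 0 i)).
  exact: (congr1 (fun F => F (delta_mx 0 i)) (diff_comp dg (analytic_differentiable fa))).
apply: (etrans e); apply: (etrans (diff_pd _ fa)); apply: eq_bigr => l _.
by congr (_ * _); exact: diff_map_coord.
Qed.

Lemma near_comp (P : 'rV[R]_m -> Prop) a :
  (forall j, analytic_at (fun z => gam z 0 j) a) ->
  (\forall w \near gam a, P w) -> \forall z \near a, P (gam z).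
Proof.
by move=> /analytic_map_differentiable/differentiable_continuous ga /ga.
Qed.

Lemma pd_near_eq (f g : 'rV[R]_k -> R) i a : analytic_at f a ->
  (\forall z \near a, f z = g z) -> \forall z \near a, pd i f z = pd i g z.
Proof.
move=> /analytic_at_near fa /near_join fg; apply: filterS2 fa fg => z fz fgz.
exact: diff_near_eq.
Qed.

Lemma pd_coord_exp (i j : 'I_k) n (z : 'rV[R]_k) :
  pd i (fun z => z 0 j ^+ n) z = (i == j)%:R * (n%:R * z 0 j ^+ n.-1).
Proof.
rewrite /pd; elim: n => [|n IH].
  rewrite mul0r mulr0 -[RHS](diff_cst_an (1 : R) z (delta_mx 0 i)).
  by congr ('d _ z _); apply/funext => y; rewrite expr0.
have ca := analytic_coord z j.
have h := diffM_an (delta_mx 0 i) ca (analyticX n ca).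
have -> : (fun z : 'rV[R]_k => z 0 j ^+ n.+1) = (fun z => z 0 j * z 0 j ^+ n).
  by apply/funext => y; rewrite exprS.
apply: (etrans h); rewrite [X in _ + _ * X]IH.
have -> : 'd (fun z : 'rV[R]_k => z 0 j) z (delta_mx 0 i) = (i == j)%:R.
  apply: etrans (_ : (delta_mx 0 i : 'rV[R]_k) 0 j = _); last by rewrite mxE eqxx eq_sym.
  rewrite -(@diff_map_coord _ _ _ (fun z => z)) => [|l]; last exact: analytic_coord.
  have dI : differentiable (fun z : 'rV[R]_k => z) z.
    by apply: analytic_map_differentiable => l; exact: analytic_coord.
  have -> // : 'd (fun z : 'rV[R]_k => z) z (delta_mx 0 i) = delta_mx 0 i.
  by rewrite -(deriveE _ dI); exact: derive_id.
case: n {IH h} => [|n] /=; first by rewrite expr0; ring.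
by rewrite exprS; ring.
Qed.

End chain_rule.

(** When [F l k] carries y^(l+k), the square coming from a product of truncations minus the triangle
    coming from the recursion leaves only terms divisible by y^K. *)
Lemma triangular_sum (V : zmodType) (F : nat -> nat -> V) K :
  \sum_(l < K.+1) \sum_(k < K.+1) F l k -
  \sum_(n < K) \sum_(l < n.+1) F l (n - l)%N =
  \sum_(l < K.+1) \sum_(k < K.+1 | (K <= l + k)%N) F l k.
Proof.
have tri n : \sum_(i < n) \sum_(l < i.+1) F l (i - l)%N =
    \sum_(l < n) \sum_(k < n - l) F l k.
  elim: n => [|n IH]; first by rewrite !big_ord0.
  rewrite big_ord_recr IH /= [RHS]big_ord_recr [X in _ + X]big_ord_recr /=.
  rewrite subSnn subnn big_ord1 addrA; congr (_ + _).
  rewrite -big_split; apply: eq_bigr => l _ /=.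
  by rewrite subSn ?(ltnW (ltn_ord l))// big_ord_recr.
have -> : \sum_(n < K) \sum_(l < n.+1) F l (n - l)%N =
    \sum_(l < K.+1) \sum_(k < K.+1 | ~~ (K <= l + k)%N) F l k.
  rewrite tri big_ord_recr /= [X in _ + X]big1 ?addr0; last first.
    by move=> k; rewrite leq_addr.
  apply: eq_bigr => l _; rewrite (big_ord_widen K.+1 (fun k => F l k)); last first.
    by rewrite (leq_trans (leq_subr _ _)).
  by apply: eq_bigl => k; rewrite -ltnNge ltn_subRL.
rewrite -sumrB; apply: eq_bigr => l _.
by rewrite (bigID (fun k : 'I_K.+1 => (K <= l + k)%N)) /= addrK.
Qed.

(** * Order in y of the error of the truncated expansions *)

Section vanishing_along_disc.
Variables (R : realType) (m : nat) (phi : 'rV[R]_m -> R) (J : 'rV[R]_m -> 'M[R]_m).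
Variables (X : 'rV[R]_m -> 'rV[R]_m) (gam : 'rV[R]_2 -> 'rV[R]_m).
Variable (A : nat -> 'rV[R]_m -> 'rV[R]_m).
Local Notation gamc l := (fun z : 'rV[R]_2 => gam z 0 l).
Hypothesis J_an : forall i j a, analytic_at (fun z => J z i j) a.
Hypothesis gam_an : forall j, analytic_at (gamc j) 0.
Hypothesis gam_y : forall j, \forall z \near (0 : 'rV[R]_2),
  pd iy (gamc j) z = \sum_l pd ix (gamc l) z * J (gam z) l j.
Hypothesis gam_x : forall j, \forall z \near (0 : 'rV[R]_2), (z : 'rV[R]_2) 0 iy = 0 ->
  pd ix (gamc j) z = X (gam z) 0 j.
Hypothesis A_an : forall n, analytic_field_at (A n) (gam 0).
Hypothesis A0 : A 0 = X.
Hypothesis A_rec : forall n z, n.+1%:R *: A n.+1 z =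
  \sum_(l < n.+1) lie_bracket (A l) (mulJ J (A (n - l)%N)) z.

(** The power of y alone: this order is not lowered by d/dx, and the initial condition on [gam]
    controls a whole segment y = 0. *)
Let dY (al : {ffun 'I_2 -> nat}) := al iy.
Let dYD al be : dY (al + be) = (dY al + dY be)%N. Proof. exact: midxD. Qed.

Lemma vanishes_le (d d' : {ffun 'I_2 -> nat} -> nat) N (f : 'rV[R]_2 -> R) a :
  (forall al, (d al <= d' al)%N) -> vanishes d N f a -> vanishes d' N f a.
Proof.
move=> dd [c [rho [fc c0]]]; exists c, rho; split=> // al aN; apply: c0.
exact: leq_ltn_trans (dd al) aN.
Qed.

Definition ycoord (z : 'rV[R]_2) : R := z 0 iy.

Lemma vanishes_y : vanishes dY 1 ycoord 0.
Proof.
do 2!eexists; split; first exact: ps_on_coord.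
move=> al; rewrite ltnS leqn0 => /eqP ay; rewrite /trans_ps mxE mul0r add0r.
by case: eqP ay => // ->; rewrite /dY ffunE eqxx.
Qed.

Let yX_an n : analytic_at (fun z => ycoord z ^+ n) 0.
Proof. by apply: analyticX; exact: analytic_coord. Qed.

Lemma comp_an (f : 'rV[R]_m -> R) : analytic_at f (gam 0) ->
  analytic_at (fun z => f (gam z)) 0.
Proof. by move=> fa; exact: analytic_comp. Qed.

Definition yseries (F : nat -> 'rV[R]_m -> 'rV[R]_m) K l (z : 'rV[R]_2) : R :=
  \sum_(n < K.+1) ycoord z ^+ n * F n (gam z) 0 l.

Lemma yseries_an F K l : (forall n, analytic_field_at (F n) (gam 0)) ->
  analytic_at (yseries F K l) 0.
Proof.
by move=> Fa; apply: analytic_sum => n; apply: analyticM => //; apply: (comp_an (Fa n l)).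
Qed.

(** By the chain rule the difference equals the sum over l of [w l] times the l-th partial
    derivative of [g] along [gam], so it inherits the order of [w]. It is applied with the order in
    y to the coordinates of the A_n and J A_n, and with the total degree to functions vanishing on
    M. *)
Lemma directional_expansion d N F K i (w : 'I_m -> 'rV[R]_2 -> R) g :
  (forall al be, d (al + be) = (d al + d be)%N) ->
  (forall l, vanishes d N (w l) 0) ->
  (forall l, \forall z \near (0 : 'rV[R]_2),
    pd i (gamc l) z = yseries F K l z + w l z) ->
  analytic_at g (gam 0) ->
  vanishes d N (fun z => pd i (fun z => g (gam z)) z -
    \sum_(n < K.+1) ycoord z ^+ n * act (F n) g (gam z)) 0.
Proof.
move=> dD wN pdE ga.
have h : vanishes d N (fun z => \sum_l w l z * pd l g (gam z)) 0.
  apply: vanishes_sum => l _; apply: vanishesMl => //.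
  by apply: comp_an; exact: analytic_pd.
apply: vanishes_near_eq h.
have gn := near_comp gam_an (analytic_at_near ga).
have gamn := near_forall (fun j => analytic_at_near (gam_an j)).
apply: filterS3 gn gamn (near_forall pdE) => z gz gamz pdz.
rewrite (pd_comp i gz gamz); under [in RHS]eq_bigr do rewrite pdz.
have -> : \sum_(n < K.+1) ycoord z ^+ n * act (F n) g (gam z) =
    \sum_l yseries F K l z * pd l g (gam z).
  under eq_bigr do rewrite (actE _ gz) mulr_sumr.
  rewrite exchange_big; apply: eq_bigr => l _; rewrite /yseries mulr_suml.
  by apply: eq_bigr => n _; rewrite mulrA.
by rewrite -sumrB; apply: eq_bigr => l _; rewrite mulrDl addrAC subrr add0r.
Qed.

Let JA n := mulJ J (A n).
Let JA_an n : analytic_field_at (JA n) (gam 0).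
Proof. by apply: analytic_mulJ. Qed.

Definition remainder K l (z : 'rV[R]_2) : R := pd ix (gamc l) z - yseries A K l z.

Definition remainderJ K j (z : 'rV[R]_2) : R := \sum_l remainder K l z * J (gam z) l j.

Lemma gam_x_expansion K l : \forall z \near (0 : 'rV[R]_2),
  pd ix (gamc l) z = yseries A K l z + remainder K l z.
Proof. by apply: near_all => z; rewrite /remainder addrC subrK. Qed.

Lemma gam_y_expansion K l : \forall z \near (0 : 'rV[R]_2),
  pd iy (gamc l) z = yseries JA K l z + remainderJ K l z.
Proof.
apply: filterS (gam_y l) => z ->; rewrite /remainderJ.
have -> : yseries JA K l z = \sum_i yseries A K i z * J (gam z) i l.
  rewrite /yseries; under [RHS]eq_bigr do rewrite mulr_suml.
  rewrite exchange_big; apply: eq_bigr => n _.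
  by rewrite /JA /mulJ mxE mulr_sumr; apply: eq_bigr => i _; rewrite mulrA.
by rewrite -big_split; apply: eq_bigr => i _ /=; rewrite -mulrDl /remainder [_ + (_ - _)]addrC subrK.
Qed.

Lemma vanishes_remainderJ d N K j : (forall al be, d (al + be) = (d al + d be)%N) ->
  (forall l, vanishes d N (remainder K l) 0) -> vanishes d N (remainderJ K j) 0.
Proof.
move=> dD uN; apply: vanishes_sum => l _; apply: vanishesMl => //.
exact: (comp_an (J_an l j (gam 0))).
Qed.

Lemma pd_yseries F K i j : (forall n, analytic_field_at (F n) (gam 0)) ->
  \forall z \near (0 : 'rV[R]_2), pd i (yseries F K j) z =
  \sum_(n < K.+1) ((i == iy)%:R * (n%:R * ycoord z ^+ n.-1) * F n (gam z) 0 j +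
    ycoord z ^+ n * pd i (fun z => F n (gam z) 0 j) z).
Proof.
move=> Fa.
have Fn : \forall z \near (0 : 'rV[R]_2), forall n : 'I_K.+1,
    analytic_at (fun z => F n (gam z) 0 j) z.
  by apply: near_forall => n; exact: analytic_at_near (comp_an (Fa n j)).
apply: filterS Fn => z Fz.
have yz n : analytic_at (fun z => ycoord z ^+ n) z.
  by apply: analyticX; exact: analytic_coord.
have h := diff_sum_an (index_enum 'I_K.+1) (delta_mx 0 i)
  (fun n : 'I_K.+1 => analyticM (yz n) (Fz n)).
apply: (etrans h); apply: eq_bigr => n _.
apply: (etrans (diffM_an (delta_mx 0 i) (yz n) (Fz n))); congr (_ * _ + _).
exact: pd_coord_exp.
Qed.

(** What remains of d/dx of the truncated J A series minus d/dy of the truncated A series, both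
    along [gam], once gam_x and gam_y are replaced by their own truncated expansions. *)
Definition main_term K j (z : 'rV[R]_2) : R :=
  \sum_(n < K.+1) ycoord z ^+ n * \sum_(l < K.+1) ycoord z ^+ l *
     act (A l) (fun w => JA n w 0 j) (gam z) -
  \sum_(n < K.+1) (n%:R * ycoord z ^+ n.-1 * A n (gam z) 0 j +
    ycoord z ^+ n * \sum_(l < K.+1) ycoord z ^+ l *
     act (JA l) (fun w => A n w 0 j) (gam z)).

(* The recursion for A is designed to cancel the terms of degree < K in y. *)
Lemma vanishes_main_term K j : vanishes dY K (main_term K j) 0.
Proof.
pose B l n (z : 'rV[R]_2) := lie_bracket (A l) (JA n) (gam z) 0 j.
have B_an l n : analytic_at (B l n) 0.
  exact: (comp_an (analytic_bracket (A_an l) (JA_an n) j)).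
apply: (@vanishes_near_eq _ _ dY K (fun z => \sum_(l < K.+1)
    \sum_(n < K.+1 | (K <= l + n)%N) ycoord z ^+ (l + n) * B l n z)); last first.
  apply: vanishes_sum => l _; apply: vanishes_sum => n Kln.
  apply: vanishesMl (B_an l n) => //; apply: vanishesW Kln _.
  by apply: vanishesX => //; exact: vanishes_y.
have An : \forall z \near (0 : 'rV[R]_2), forall n : 'I_K.+1,
    analytic_field_at (A n) (gam z) /\ analytic_field_at (JA n) (gam z).
  apply: near_forall => n.
  apply: (near_comp (P := fun w => analytic_field_at (A n) w /\ analytic_field_at (JA n) w)) => //.
  by apply: filterS2 (analytic_field_near (A_an n)) (analytic_field_near (JA_an n)).
apply: filterS An => z Az; rewrite /main_term.
rewrite -(triangular_sum (fun l n => ycoord z ^+ (l + n) * B l n z)).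
(* The term n = 0 dies with its factor [n%:R]; after the shift of index [A_rec] turns the multiples
   of A_(n+1) into brackets. *)
have e1 : \sum_(n < K.+1) n%:R * ycoord z ^+ n.-1 * A n (gam z) 0 j =
    \sum_(n < K) \sum_(l < n.+1) ycoord z ^+ (l + (n - l)) * B l (n - l)%N z.
  rewrite big_ord_recl /= !mul0r add0r; apply: eq_bigr => n _.
  rewrite /= /bump /= add1n mulrAC.
  have := congr1 (fun v : 'rV[R]_m => v 0 j) (A_rec n (gam z)).
  rewrite mxE summxE /= => ->; rewrite mulr_suml; apply: eq_bigr => l _.
  by rewrite subnKC -1?ltnS// mulrC.
rewrite big_split /= e1 opprD addrCA [RHS]addrC; congr (_ - _).
have -> : \sum_(n < K.+1) ycoord z ^+ n * (\sum_(l < K.+1) ycoord z ^+ l *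
     act (JA l) (fun w => A n w 0 j) (gam z)) =
   \sum_(l < K.+1) \sum_(n < K.+1) ycoord z ^+ (l + n) *
     act (JA n) (fun w => A l w 0 j) (gam z).
  apply: eq_bigr => n _; rewrite mulr_sumr; apply: eq_bigr => l _.
  by rewrite exprD mulrA.
have -> : \sum_(n < K.+1) ycoord z ^+ n * (\sum_(l < K.+1) ycoord z ^+ l *
     act (A l) (fun w => JA n w 0 j) (gam z)) =
   \sum_(l < K.+1) \sum_(n < K.+1) ycoord z ^+ (l + n) *
     act (A l) (fun w => JA n w 0 j) (gam z).
  rewrite exchange_big; apply: eq_bigr => n _ /=; rewrite mulr_sumr.
  by apply: eq_bigr => l _; rewrite exprD mulrA [ycoord z ^+ n * _]mulrC.
rewrite -sumrB; apply: eq_bigr => l _; rewrite -sumrB; apply: eq_bigr => n _.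
rewrite -mulrBr; congr (_ * _).
exact: (lie_bracketE j (Az l).1 (Az n).2).
Qed.

(** Equality of mixed derivatives writes d/dy of the remainder as [main_term] plus d/dx of
    [remainderJ] plus the substitution errors, all of order [N] in y. Vanishing at y = 0 then gives
    order [N.+1]. *)
Lemma vanishes_remainder_step K N j : (N <= K)%N ->
  (forall l, vanishes dY N (remainder K l) 0) -> vanishes dY N.+1 (remainder K j) 0.
Proof.
move=> NK uN.
have wN l := vanishes_remainderJ l dYD uN.
have rem_an : analytic_at (remainder K j) 0 by exact: vanishes_analytic (uN j).
apply: vanishes_coord_step => //.
  (* At y = 0 only the term n = 0 of the series survives, and it is [X] along [gam], which is gam_x
     there. *)
  apply: filterS (gam_x j) => z zx; rewrite mxE => zy; rewrite /remainder zx//.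
  rewrite /yseries big_ord_recl /= big1 ?addr0 => [|n _].
    by rewrite expr0 mul1r A0 subrr.
  by rewrite /ycoord zy expr0n mul0r.
(* [E2] and [E3] are the errors made in [main_term] when the derivatives of J A_n and A_n along
   [gam] are replaced by truncated sums. *)
pose E2 (n : nat) z := pd ix (fun z => JA n (gam z) 0 j) z -
  \sum_(l < K.+1) ycoord z ^+ l * act (A l) (fun w => JA n w 0 j) (gam z).
pose E3 (n : nat) z := pd iy (fun z => A n (gam z) 0 j) z -
  \sum_(l < K.+1) ycoord z ^+ l * act (JA l) (fun w => A n w 0 j) (gam z).
have E2N n : vanishes dY N (E2 n) 0.
  exact: (directional_expansion dYD uN (gam_x_expansion K) (JA_an n j)).
have E3N n : vanishes dY N (E3 n) 0.
  exact: (directional_expansion dYD wN (gam_y_expansion K) (A_an n j)).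
have sumN (E : nat -> 'rV[R]_2 -> R) : (forall n, vanishes dY N (E n) 0) ->
    vanishes dY N (fun z => \sum_(n < K.+1) ycoord z ^+ n * E n z) 0.
  by move=> EN; apply: vanishes_sum => n _; apply: vanishesMr.
have E1N : vanishes dY N (pd ix (remainderJ K j)) 0.
  by apply: vanishes_pd (wN j) => //; rewrite /dY ffunE.
have DN := vanishesW NK (vanishes_main_term K j).
apply: vanishes_near_eq (vanishesD (vanishesD E1N DN)
  (vanishesB (sumN E2 E2N) (sumN E3 E3N))).
have a_an := yseries_an K j A_an; have b_an := yseries_an K j JA_an.
have gy_an : analytic_at (pd iy (gamc j)) 0 by exact: analytic_pd.
have gx_an : analytic_at (pd ix (gamc j)) 0 by exact: analytic_pd.
have w_an : analytic_at (remainderJ K j) 0 by exact: vanishes_analytic (wN j).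
have F1 := pd_near_eq ix gy_an (gam_y_expansion K j).
have F2 := pd_yseries K ix j JA_an; have F3 := pd_yseries K iy j A_an.
have F4 := near_and (analytic_at_near (gam_an j)) (analytic_at_near w_an).
have F5 := near_and (analytic_at_near a_an) (analytic_at_near b_an).
have F6 := near_and F4 F5; have F7 := near_and F2 F3.
have F8 := near_and F1 (analytic_at_near gx_an).
apply: filterS3 F6 F7 F8 => z [[gz wz] [az bz]] [bE aE] [gE gxz].
apply: esym; apply: (etrans (diffB_an (delta_mx 0 iy) gxz az)).
apply: (etrans (congr2 (fun s t : R => s - t) (pdC iy ix gz) aE)).
rewrite gE; have -> : pd ix (fun z => yseries JA K j z + remainderJ K j z) z =
    pd ix (yseries JA K j) z + pd ix (remainderJ K j) z.
  exact: (diffD_an (delta_mx 0 ix) bz wz).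
have hE (E P Q : nat -> R) : (forall n, E n = P n - Q n) ->
    \sum_(n < K.+1) ycoord z ^+ n * E n =
    \sum_(n < K.+1) ycoord z ^+ n * P n - \sum_(n < K.+1) ycoord z ^+ n * Q n.
  by move=> EPQ; rewrite -sumrB; apply: eq_bigr => n _; rewrite EPQ mulrBr.
rewrite (hE (E2^~ z) _ _ (fun n => erefl)) (hE (E3^~ z) _ _ (fun n => erefl)).
rewrite bE /main_term !big_split /=.
rewrite [X in X + _ + _ - _]big1 => [|n _]; last by rewrite !mul0r.
have -> : \sum_(n < K.+1) 1 * (n%:R * ycoord z ^+ n.-1) * A n (gam z) 0 j =
    \sum_(n < K.+1) n%:R * ycoord z ^+ n.-1 * A n (gam z) 0 j.
  by apply: eq_bigr => n _; rewrite mul1r.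
by ring.
Qed.

Lemma vanishes_remainder K j : vanishes dY K.+1 (remainder K j) 0.
Proof.
suff H N : (N <= K.+1)%N -> forall l, vanishes dY N (remainder K l) 0 by exact: H.
elim: N => [_ l|N IH NK l].
  apply: vanishes0; apply: analyticB; first exact: analytic_pd.
  exact: yseries_an.
by apply: vanishes_remainder_step => //; apply: IH; exact: ltnW.
Qed.

End vanishing_along_disc.

Lemma continuous_near_eq (V W : topologicalType) (F G : V -> W) u :
  (\forall v \near u, G v = F v) -> {for u, continuous G} -> {for u, continuous F}.
Proof.
move=> GF Gc; rewrite /prop_for /continuous_at -(nbhs_singleton GF).
by apply: cvg_trans Gc; apply: near_eq_cvg.
Qed.

(** * Functions vanishing on M vanish along the disc *)

Section disc_in_hypersurface.
Variables (R : realType) (m : nat) (phi : 'rV[R]_m -> R) (J : 'rV[R]_m -> 'M[R]_m).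
Hypothesis phi_an : forall a, analytic_at phi a.
Hypothesis phi_reg : forall z, hypersurface phi z -> exists v, 'd phi z v != 0.
Hypothesis J_an : forall i j a, analytic_at (fun z => J z i j) a.
Hypothesis JJ : forall z, J z *m J z = - 1%:M.
Hypothesis J_int : integrable_structure J.
Local Notation M := (hypersurface phi).

Let next (F : nat -> 'rV[R]_m -> 'rV[R]_m) n z : 'rV[R]_m :=
  n.+1%:R^-1 *: \sum_(l < n.+1) lie_bracket (F l) (mulJ J (F (n - l)%N)) z.

Lemma levi_sequence p X : levi_field phi J p X ->
  exists A : nat -> 'rV[R]_m -> 'rV[R]_m, [/\ A 0%N = X,
    forall n, levi_field phi J p (A n) &
    forall n z, n.+1%:R *: A n.+1 z =
      \sum_(l < n.+1) lie_bracket (A l) (mulJ J (A (n - l)%N)) z].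
Proof.
move=> HX.
(* Course-of-values recursion: A_(n+1) needs all earlier terms, so [B n] is a whole sequence that is
   correct up to index [n], and [A] is its diagonal. *)
pose B := fix B n : nat -> 'rV[R]_m -> 'rV[R]_m :=
  if n is n'.+1 then fun i => if (i <= n')%N then B n' i else next (B n') n'
  else fun=> X.
have BS n i : B n.+1 i = if (i <= n)%N then B n i else next (B n) n by [].
pose A n := B n n.
have BA n i : (i <= n)%N -> B n i = A i.
  elim: n => [|n IH]; first by rewrite leqn0 => /eqP ->.
  rewrite leq_eqVlt => /predU1P[->//|]; rewrite ltnS => ni.
  by rewrite BS ni IH.
have AS n : A n.+1 = next A n.
  rewrite /A BS ltnn; apply/funext => z; rewrite /next; congr (_ *: _).
  by apply: eq_bigr => l _; rewrite !BA// ?leq_subr// -ltnS.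
exists A; split=> [//|n|n z]; last first.
  by rewrite AS /next scalerA mulfV ?scale1r// pnatr_eq0.
elim/ltn_ind: n => -[|n] IH; first exact: HX.
have HL (l : 'I_n.+1) : levi_field phi J p (A l) by exact: IH.
have HR (l : 'I_n.+1) : levi_field phi J p (mulJ J (A (n - l)%N)).
  by apply: (levi_field_mulJ phi_an phi_reg J_an JJ J_int); apply: IH; rewrite ltnS leq_subr.
rewrite AS /next; apply: (levi_fieldZ JJ).
apply: (levi_field_sum JJ HX) => l.
exact: (levi_field_bracket JJ (HL l) (HR l)).
Qed.

Variables (X : 'rV[R]_m -> 'rV[R]_m) (gam : 'rV[R]_2 -> 'rV[R]_m).
Local Notation gamc l := (fun z : 'rV[R]_2 => gam z 0 l).
Hypothesis gam_an : forall j, analytic_at (gamc j) 0.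
Hypothesis gam_y : forall j, \forall z \near (0 : 'rV[R]_2),
  pd iy (gamc j) z = \sum_l pd ix (gamc l) z * J (gam z) l j.
Hypothesis gam_x : forall j, \forall z \near (0 : 'rV[R]_2), (z : 'rV[R]_2) 0 iy = 0 ->
  pd ix (gamc j) z = X (gam z) 0 j.
Hypothesis X_levi : levi_field phi J (gam 0) X.
Hypothesis gam0M : M (gam 0).

Lemma disc_in_hypersurface : \forall z \near (0 : 'rV[R]_2), M (gam z).
Proof.
have [A [A0 A_levi A_rec]] := levi_sequence X_levi.
have A_sec n : J_tangent_section phi J (gam 0) (A n) by exact: (A_levi n).1.
have JA_sec n : J_tangent_section phi J (gam 0) (mulJ J (A n)) by exact: (section_mulJ J_an JJ (A_sec n)).
have A_an n : analytic_field_at (A n) (gam 0) := ((sectionP phi JJ (gam 0) (A n)).1 (A_sec n)).1.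
have dY_deg (al : {ffun 'I_2 -> nat}) : (al iy <= deg al)%N by rewrite deg2 leq_addl.
(* The order is raised for all [g] at once: the induction hypothesis is needed for A_n g and (J A_n)
   g, not for [g] itself. *)
suff key N : forall g, analytic_at g (gam 0) -> (\forall z \near gam 0, M z -> g z = 0) ->
    vanishes (@deg 2) N (fun z => g (gam z)) 0.
  apply: vanishes_all_eq0 => N; apply: key => //; exact: near_all.
elim: N => [|N IH] g ga gM; first by apply: vanishes0; exact: comp_an.
apply: vanishes_deg_step; [exact: comp_an|exact: (nbhs_singleton gM)|].
(* Truncation at [N] leaves order N + 1 in y, and the power of y never exceeds the total degree. *)
have rem l : vanishes (@deg 2) N (remainder gam A N l) 0.
  apply: (vanishesW (leqnSn N)); apply: vanishes_le dY_deg _.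
  exact: (vanishes_remainder J_an gam_an gam_y gam_x A_an A0 A_rec).
have sum0 (F : nat -> _) : (forall n, J_tangent_section phi J (gam 0) (F n)) ->
    vanishes (@deg 2) N
      (fun z => \sum_(n < N.+1) ycoord z ^+ n * act (F n) g (gam z)) 0.
  move=> Fs; apply: vanishes_sum => n _; apply: vanishesMr.
  - exact: degD.
  - by apply: analyticX; exact: analytic_coord.
  apply: IH; last exact: (act_vanishes phi_an phi_reg JJ (Fs n) ga gM).
  exact: (analytic_act ((sectionP phi JJ (gam 0) (F n)).1 (Fs n)).1 ga).
have expand F i w : (forall n, J_tangent_section phi J (gam 0) (F n)) ->
    (forall l, vanishes (@deg 2) N (w l) 0) ->
    (forall l, \forall z \near (0 : 'rV[R]_2),
      pd i (gamc l) z = yseries gam F N l z + w l z) ->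
    vanishes (@deg 2) N (pd i (fun z => g (gam z))) 0.
  move=> Fs wN pdE.
  have h := directional_expansion gam_an (@degD 2) wN pdE ga.
  apply: vanishes_near_eq (vanishesD h (sum0 F Fs)).
  by apply: near_all => z; rewrite subrK.
move=> i; case: (I2P i) => ->.
  exact: (expand _ _ _ A_sec rem (gam_x_expansion gam A N)).
have remJ l := vanishes_remainderJ J_an gam_an l (@degD 2) rem.
exact: (expand _ _ _ JA_sec remJ (gam_y_expansion A gam_y N)).
Qed.

End disc_in_hypersurface.

(** * Transfer from row vectors to the plane *)

Section plane.
Variable R : realType.

Definition row_of_plane (h : R * R) : 'rV[R]_2 :=
  h.1 *: delta_mx 0 ix + h.2 *: delta_mx 0 iy.

Fact row_of_plane_linear : linear row_of_plane.
Proof.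
move=> r u v; rewrite /row_of_plane /= !scalerDr !scalerA !scalerDl -!scalerA.
by rewrite addrACA.
Qed.

HB.instance Definition _ := GRing.isLinear.Build R (R * R)%type 'rV[R]_2 *:%R
  row_of_plane row_of_plane_linear.

Lemma row_of_plane_continuous : continuous row_of_plane.
Proof.
move=> u; apply: cvgD; apply: cvgZr_tmp; [exact: cvg_fst|exact: cvg_snd].
Qed.

Lemma row_of_plane_differentiable u : differentiable row_of_plane u.
Proof. exact/linear_differentiable/row_of_plane_continuous. Qed.

(** The Euclidean disc lies in the sup-norm ball on which the properties of the constructed map are
    known. *)
Lemma row_of_plane_disc (eps : R) u : 0 < eps -> disc eps u -> `|row_of_plane u - 0| <= eps.
Proof.
move=> eps0; rewrite /disc /= => ueps; rewrite subr0.
apply: ler_norm_coord => [|i]; first exact: ltW.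
rewrite !mxE /= -(ler_pXn2r (n := 2))// ?nnegrE ?(ltW eps0)// -normrX ger0_norm ?sqr_ge0//.
apply: le_trans (ltW ueps); case: (I2P i) => ->; rewrite !eqxx ?ix_iy /=.
  by rewrite mulr1 mulr0 addr0 lerDl sqr_ge0.
by rewrite mulr1 mulr0 add0r lerDr sqr_ge0.
Qed.

Variables (m : nat) (gam : 'rV[R]_2 -> 'rV[R]_m).

Definition row_pd i z : 'rV[R]_m := \row_j pd i (fun z => gam z 0 j) z.

Lemma diff_disc u h : (forall j, analytic_at (fun z => gam z 0 j) (row_of_plane u)) ->
  differentiable (gam \o row_of_plane) u /\
  'd (gam \o row_of_plane) u h =
    h.1 *: row_pd ix (row_of_plane u) + h.2 *: row_pd iy (row_of_plane u).
Proof.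
move=> ga; have dg := analytic_map_differentiable ga.
have dL := row_of_plane_differentiable u.
split; first exact: differentiable_comp.
have e : 'd (gam \o row_of_plane) u h =
    'd gam (row_of_plane u) ('d row_of_plane u h) :=
  congr1 (fun F => F h) (diff_comp dL dg).
have eL : 'd row_of_plane u h = row_of_plane h :=
  congr1 (fun F => F h) (diff_lin u row_of_plane_continuous).
apply: (etrans e); apply: (etrans (congr1 (fun v => 'd gam (row_of_plane u) v) eL)).
apply/rowP => j; apply: (etrans (diff_map_coord (row_of_plane h) j ga)).
by rewrite diff_vD !diff_vZ !mxE.
Qed.

End plane.

Theorem theorem4p4 (R : realType) (n : nat)
    (phi : 'rV[R]_(2 * n) -> R) (J : 'rV[R]_(2 * n) -> 'M[R]_(2 * n))
    (hphi : analytic_defining_function phi)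
    (h0 : hypersurface phi 0)
    (hJ : analytic_almost_complex J)
    (hint : integrable_structure J)
    (X : 'rV[R]_(2 * n) -> 'rV[R]_(2 * n))
    (hX : field_in_levi_kernel phi J X) :
  \forall p \near (0 : 'rV[R]_(2 * n)), hypersurface phi p ->
    exists gamma : R * R -> 'rV[R]_(2 * n),
      [/\ holomorphic_disc_germ J gamma,
          germ_included gamma (hypersurface phi),
          gamma (0, 0) = p
        & 'D_((1, 0) : R * R) gamma ((0, 0) : R * R) = X p].
Proof.
have [phi_an phi_reg] := hphi; have [J_an JJ] := hJ.
have J_an' i j a : analytic_at (fun z => J z i j) a by exact: J_an.
apply: filterS (levi_field_of_kernel phi_an phi_reg J_an' JJ hint hX) => p Xp Mp.
have [Xa _] := (sectionP phi JJ p X).1 Xp.1.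
have [gam [gam0 gam_an gam_y gam_x]] := cauchy_kovalevskaya Xa (fun i j => J_an i j p).
rewrite -gam0 in Xp Mp.
have gamM := disc_in_hypersurface phi_an phi_reg J_an' JJ hint gam_an gam_y gam_x Xp Mp.
have gan := near_forall (fun j => analytic_at_near (gam_an j)).
have [e e0 H] := (near_normP _ _).1 (near_and gamM (near_and gan (near_forall gam_y))).
have L0 : row_of_plane (0, 0) = 0 :> 'rV[R]_2 by rewrite /row_of_plane !scale0r addr0.
have Dy z : `|z - 0| <= e -> row_pd gam iy z = row_pd gam ix z *m J (gam z).
  move=> /H[_ [_ hy]]; apply/rowP => j; rewrite !mxE hy.
  by apply: eq_bigr => l _; rewrite mxE.
exists (gam \o @row_of_plane R); split.
- exists e => //; split=> [u ue|u ue h].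
    have /H[_ [ua _]] := row_of_plane_disc e0 ue.
    split; first by have [] := diff_disc 0 ua.
    move=> h.
    have near_a : \forall v \near u, forall j,
        analytic_at (fun z => gam z 0 j) (row_of_plane v).
      have := near_forall (fun j => analytic_at_near (ua j)).
      by apply: row_of_plane_continuous.
    have pc i : {for u, continuous (fun v => row_pd gam i (row_of_plane v))}.
      apply: (@continuous_comp _ _ _ (@row_of_plane R) (row_pd gam i)).
        exact: row_of_plane_continuous.
      apply: differentiable_continuous; apply: analytic_map_differentiable => j.
      apply: analytic_near_eq (analytic_pd i (ua j)).
      by apply: near_all => z; rewrite mxE.
    have Gc : {for u, continuous (fun v => h.1 *: row_pd gam ix (row_of_plane v) +
        h.2 *: row_pd gam iy (row_of_plane v))}.
      by apply: cvgD; apply: cvgZl_tmp; exact: pc.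
    apply: continuous_near_eq Gc; apply: filterS near_a => v va.
    exact: esym (diff_disc h va).2.
  have ue' := row_of_plane_disc e0 ue; have [_ [ua _]] := H _ ue'.
  have [_ ->] := diff_disc (J0 h) ua; have [_ ->] := diff_disc h ua.
  (* With gam_y = gam_x J and J^2 = -1 both sides equal h.1 gam_x J - h.2 gam_x. *)
  rewrite (Dy _ ue') mulmxDl -!scalemxAl mulJJ//= scalerN scaleNr.
  by rewrite addrC.
- exists e => // u ue; have [? _] := H _ (row_of_plane_disc e0 ue).
  by [].
- by rewrite /= L0.
have z0 : `|(0 : 'rV[R]_2) - 0| <= e by rewrite subrr normr0 ltW.
have [_ [ua _]] := H _ z0; rewrite -L0 in ua.
have [dg dE] := diff_disc (1, 0) ua.
rewrite (deriveE _ dg) dE /= scale1r scale0r addr0 L0.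
apply/rowP => j; rewrite mxE -gam0.
by apply: (nbhs_singleton (gam_x j)); rewrite mxE.
Qed.
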